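(* Let $u_0,v_0\in H^1(\mathbb{R})$ be real-valued. Assume that $u_0$ has compact support in an interval of length $\delta>0$ and that $v_0\le -3$ on this interval. Suppose that $$\delta^{1/2}\left(\|v_{0x}\|_{L^2}+\frac13\,\delta^{1/2}\,\|u_{0x}\|_{L^2}^2\right)<\frac14 .$$ Then the $H^1$ norm of the solution $(u,v)$ of the initial value problem $$u_t=2uv,\qquad v_t=H(u^2),\qquad u(\cdot,0)=u_0,\quad v(\cdot,0)=v_0,\qquad x\in\mathbb{R},$$ remains bounded for all time (in particular the solution exists for all $t\ge 0$). Moreover, there is a constant $C$ depending only on $u_0$, $v_0$ and $\delta$ such that for all $t\ge 0$ $$\|u(\cdot,t)\|_{L^\infty}\le Ce^{-3t},\qquad \|u(\cdot,t)\|_{H^1}\le Ce^{-3t},\qquad \|v(\cdot,t)\|_{H^1}\le C .$$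
   Context: $H$ denotes the Hilbert transform on $\mathbb{R}$: $(Hf)(x)=\frac{1}{\pi}\,\mathrm{P.V.}\int_{-\infty}^{\infty}\frac{f(y)}{x-y}\,dy$; it acts in the spatial variable $x$. $H^1=H^1(\mathbb{R})$ is the usual Sobolev space, $L^2=L^2(\mathbb{R})$, $L^\infty=L^\infty(\mathbb{R})$, and $u_{0x},v_{0x}$ denote the (weak) derivatives of $u_0,v_0$. A solution on $[0,T)$ means a pair $(u,v)$ with $u,v\in C^1([0,T);H^1)$ satisfying the system and the initial conditions; for given $u_0,v_0\in H^1$ there is a unique solution on a maximal time interval. *)

(* Defs.v *)
From HB Require Import structures.
From mathcomp Require Import all_boot all_order all_algebra.
From mathcomp Require Import all_classical all_reals all_analysis.
Set Implicit Arguments.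
Unset Strict Implicit.
Unset Printing Implicit Defensive.
Import Order.TTheory GRing.Theory Num.Theory.
Import numFieldNormedType.Exports.
Local Open Scope classical_set_scope.
Local Open Scope ring_scope.

(* Elements of L^2(R) and H^1(R) are represented by measurable functions
   R -> R; equality in these spaces is equality almost everywhere. *)

Section Sobolev.
Context {R : realType}.
Local Notation mu := (@lebesgue_measure R).
Implicit Types (f g phi : R -> R).

Definition L2 : set (R -> R) := [set f | f \in Lfun mu 2%:E].

Definition L2norm f : R := fine ('N[mu]_2%:E[EFin \o f])%E.

Definition test_function phi : Prop :=
  (forall (n : nat) (x : R), derivable (derive1n n phi) x 1) /\
  compact (closure [set x | phi x != 0]).

Definition weak_derivative f g : Prop :=
  forall phi, test_function phi ->
    \int[mu]_x (f x * derive1 phi x) = - \int[mu]_x (g x * phi x).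

Definition H1 : set (R -> R) :=
  [set f | L2 f /\ exists2 g, L2 g & weak_derivative f g].

(* The weak derivative of a function of H^1 is unique almost everywhere; this
   picks a representative of it. The value is meaningless if there is none. *)
Definition wderiv f : R -> R :=
  xget (cst 0) [set g | L2 g /\ weak_derivative f g].

Definition H1norm f : R := Num.sqrt (L2norm f ^+ 2 + L2norm (wderiv f) ^+ 2).

(* For f in L^p with 1 <= p < oo the truncated integral converges absolutely
   at infinity, so only the singularity y = x needs a principal value. *)
Definition hilbert f : R -> R := fun x =>
  pi^-1 * lim ((\int[mu]_(y in [set y | (e < `|x - y|)%R]) (f y / (x - y)))
                 @[e --> 0^'+]).

End Sobolev.

Section Evolution.
Context {R : realType}.
Local Notation mu := (@lebesgue_measure R).

Definition time_interval (T : \bar R) : set R := [set t | 0 <= t /\ (t%:E < T)%E].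

(* [C1_H1 T w w'] : w belongs to C^1([0, T); H^1) and w' is its time derivative,
   difference quotients converging in the H^1 norm (one-sidedly at t = 0). *)
Definition C1_H1 (T : \bar R) (w w' : R -> R -> R) : Prop :=
  forall t, time_interval T t ->
    [/\ H1 (w t), H1 (w' t),
        H1norm (fun x => (w s x - w t x) / (s - t) - w' t x)
          @[s --> within (time_interval T) t^'] --> 0
      & H1norm (fun x => w' s x - w' t x)
          @[s --> within (time_interval T) (nbhs t)] --> 0].

Definition solution (u0 v0 : R -> R) (T : \bar R) (u v : R -> R -> R) : Prop :=
  (exists u' v',
    [/\ C1_H1 T u u', C1_H1 T v v'
      & forall t, time_interval T t ->
          u' t = (fun x => 2 * u t x * v t x) %[ae mu] /\
          v' t = hilbert (fun x => u t x ^+ 2) %[ae mu]]) /\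
  u 0 = u0 %[ae mu] /\ v 0 = v0 %[ae mu].

End Evolution.

(* Main.v *)
(* The velocity u -> (2uv, H(u^2)) is quadratic, hence locally Lipschitz, on
   H^1 x H^1, because H^1 is an algebra and H is bounded on H^1.  Boundedness of
   H comes from the kernels q_a(x) = x / (x^2 + a^2): the scalar product of
   q_a(. - s) and q_b(. - t) is pi P_(a+b)(s - t) with P the Poisson kernel, so a + b |-> <q_a * g, q_b * g> is midpoint convex and
   at most pi^2 |g|^2; thus q_a * g is Cauchy in L^2 as a -> 0, with limit
   pi H g.  Euler's method then solves the equation with the vector field frozen
   outside a large ball.
   The solution never leaves that ball.  Let y = |u_x|, z = |v_x| in L^2 and let
   I be the interval of length delta.  As long as v + sqrt delta z <= -3/2 on I,
   u vanishes off I, so |u| <= sqrt delta y and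
     (y^2)' = 4 \int (u_x^2 v + u u_x v_x) <= 4 y^2 sup_I (v + sqrt delta z) <= -6 y^2.
   Hence y^2 <= y(0)^2 exp(-6t), z' <= 2 sqrt delta y^2 and |H(u^2)| <= 2 delta y^2.
   Integrating, z <= z(0) + sqrt delta y(0)^2 / 3 and v <= -3 + delta y(0)^2 / 3
   on I, so by the smallness assumption v + sqrt delta z <= -5/2 on I: the
   condition improves itself and therefore holds for all time. *)

Require Import Defs.
From HB Require Import structures.
From mathcomp Require Import all_boot all_order all_algebra.
From mathcomp Require Import all_classical all_reals all_analysis.
From mathcomp Require Import measurable_realfun ess_sup_inf.
From mathcomp Require Import ring lra.
Import Order.TTheory GRing.Theory Num.Theory.
Import numFieldNormedType.Exports.
Local Open Scope classical_set_scope.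
Local Open Scope ring_scope.
Set Implicit Arguments.
Unset Strict Implicit.
Unset Printing Implicit Defensive.

(** Up to the final comparison with the definition of a solution, the flow is described without time
    derivatives: its only property is [N (X t - X s - (t - s) *: F (X s)) <= K * (t - s) ^+ 2],
    which Euler polygons supply directly. Each differential inequality of the overview becomes an
    inequality between increments with a quadratic error, and summation over a fine partition
    removes the error. [H] is applied only to [u^2], which together with its derivative [2 u u_x]
    lies in [L^1] as well as in [L^2]. This makes every exchange of integrals absolutely convergent
    and replaces Fourier analysis. The pointwise principal value is a separate matter: once [f x] is
    subtracted near [x], the truncated kernel and [q_a] are two odd approximations of [1/z] with the
    same dominated limit. The number [1/4] enters twice: on the support,
    [v + sqrt delta z < -3 + 1/4 + 1/4 = -5/2]. The distance 1 from there to [-3/2] is what the flow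
    may use up during one continuation step, and [-3/2] yields the rate [6 = 4 * 3/2] for [y^2],
    hence [3] for [u]. *)

(** * Inner products and Euler's method *)

(* The inner product is only required to be bilinear on the subspace [D], so
   that spaces of functions need not be packaged as types, and it may be
   degenerate, so that functions need not be quotiented by a.e. equality. *)
Record inner_product {R : realType} {V : lmodType R} (D : set V)
    (ip : V -> V -> R) : Prop := InnerProduct {
  ip_mem0 : D 0;
  ip_memD : forall x y, D x -> D y -> D (x + y);
  ip_memZ : forall c x, D x -> D (c *: x);
  ip_sym : forall x y, D x -> D y -> ip x y = ip y x;
  ip_addl : forall x y z, D x -> D y -> D z -> ip (x + y) z = ip x z + ip y z;
  ip_scalel : forall c x y, D x -> D y -> ip (c *: x) y = c * ip x y;
  ip_ge0 : forall x, D x -> 0 <= ip x x }.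

Definition ip_norm {R : realType} {V : Type} (ip : V -> V -> R) (x : V) : R :=
  Num.sqrt (ip x x).

(** Completeness only along sequences with geometrically decaying increments, which is what halving
    a step size produces. The limit comes with a rate, and in a degenerate inner product it is
    determined only up to norm zero. *)
Definition ip_complete {R : realType} {V : lmodType R} (D : set V)
    (ip : V -> V -> R) : Prop :=
  forall (x : nat -> V) (C : R), (forall n, D (x n)) ->
    (forall n, ip_norm ip (x n.+1 - x n) <= C * 2^-1 ^+ n) ->
    exists2 l, D l & forall n, ip_norm ip (x n - l) <= 2 * C * 2^-1 ^+ n.

Section InnerProductTheory.
Context {R : realType} {V : lmodType R} {D : set V} {ip : V -> V -> R}.
Hypothesis ipP : inner_product D ip.
Local Notation N := (ip_norm ip).

Lemma ip_memN x : D x -> D (- x).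
Proof. by move=> Dx; rewrite -scaleN1r; apply: (ip_memZ ipP). Qed.

Lemma ip_memB x y : D x -> D y -> D (x - y).
Proof. by move=> Dx Dy; apply: (ip_memD ipP) => //; exact: ip_memN. Qed.

Lemma ip_addr x y z : D x -> D y -> D z -> ip z (x + y) = ip z x + ip z y.
Proof.
move=> Dx Dy Dz; rewrite (ip_sym ipP)// ?(ip_addl ipP)//; last exact: (ip_memD ipP).
by rewrite (ip_sym ipP Dx Dz) (ip_sym ipP Dy Dz).
Qed.

Lemma ip_scaler c x y : D x -> D y -> ip y (c *: x) = c * ip y x.
Proof.
move=> Dx Dy; rewrite (ip_sym ipP)// ?(ip_scalel ipP)//; last exact: (ip_memZ ipP).
by rewrite (ip_sym ipP Dx Dy).
Qed.

Lemma ip_sqD x y : D x -> D y ->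
  ip (x + y) (x + y) = ip x x + 2 * ip x y + ip y y.
Proof.
move=> Dx Dy; have Dxy := ip_memD ipP Dx Dy.
by rewrite (ip_addl ipP)// !ip_addr// (ip_sym ipP Dy Dx); ring.
Qed.

Lemma ip_subl x y z : D x -> D y -> D z -> ip (x - y) z = ip x z - ip y z.
Proof.
move=> Dx Dy Dz; rewrite (ip_addl ipP)//; last exact: ip_memN.
by rewrite -scaleN1r (ip_scalel ipP)// mulN1r.
Qed.

Lemma ip_subr x y z : D x -> D y -> D z -> ip z (x - y) = ip z x - ip z y.
Proof.
move=> Dx Dy Dz; rewrite (ip_sym ipP)//; last exact: ip_memB.
by rewrite ip_subl// (ip_sym ipP Dx Dz) (ip_sym ipP Dy Dz).
Qed.

Lemma ip_norm_ge0 x : 0 <= N x. Proof. exact: sqrtr_ge0. Qed.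

Lemma ip_normE x : D x -> N x ^+ 2 = ip x x.
Proof. by move=> Dx; rewrite sqr_sqrtr// (ip_ge0 ipP). Qed.

Lemma ip_cauchy_schwarz x y : D x -> D y -> `|ip x y| <= N x * N y.
Proof.
move=> Dx Dy.
have Q t : 0 <= ip x x + 2 * t * ip x y + t ^+ 2 * ip y y.
  have := ip_ge0 ipP (ip_memD ipP Dx (ip_memZ ipP t Dy)).
  rewrite ip_sqD// ?ip_scaler// ?(ip_scalel ipP)//; try exact: (ip_memZ ipP).
  by move=> h; apply: le_trans h _; rewrite le_eqVlt; apply/orP; left; apply/eqP; ring.
rewrite -(@ler_pXn2r _ 2)// ?nnegrE ?mulr_ge0 ?ip_norm_ge0//.
rewrite exprMn !ip_normE// real_normK ?num_real//.
have y0 := ip_ge0 ipP Dy; have x0 := ip_ge0 ipP Dx.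
have [yy|yy] := eqVneq (ip y y) 0; last first.
  have yp : 0 < ip y y by rewrite lt_neqAle eq_sym yy.
  have := Q (- (ip x y / ip y y)).
  rewrite -(pmulr_lge0 _ yp) => h; rewrite -subr_ge0; apply: le_trans h _.
  rewrite le_eqVlt; apply/orP; left; apply/eqP; field.
  by rewrite gt_eqF.
(* Degenerate case: [ip y y = 0] does not give [y = 0], but the quadratic [Q] is then affine in [t],
   and a nonnegative affine function has slope zero. *)
suff -> : ip x y = 0 by rewrite expr0n/= mulr_ge0.
apply/eqP; case: (eqVneq (ip x y) 0) => // xy.
have := Q (- ((ip x x + 1) / ip x y)); rewrite yy mulr0 addr0.
have -> : 2 * - ((ip x x + 1) / ip x y) * ip x y = - 2 * (ip x x + 1).
  by field.
lra.
Qed.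

Lemma ip_normD x y : D x -> D y -> N (x + y) <= N x + N y.
Proof.
move=> Dx Dy.
rewrite -(@ler_pXn2r _ 2)// ?nnegrE ?addr_ge0 ?ip_norm_ge0//.
rewrite ip_normE; last exact: (ip_memD ipP).
rewrite ip_sqD// sqrrD !ip_normE//.
by have := le_trans (ler_norm _) (ip_cauchy_schwarz Dx Dy); lra.
Qed.

Lemma ip_normZ c x : D x -> N (c *: x) = `|c| * N x.
Proof.
move=> Dx; rewrite /ip_norm (ip_scalel ipP)//; last exact: (ip_memZ ipP).
by rewrite ip_scaler// mulrA -expr2 sqrtrM ?sqr_ge0// sqrtr_sqr.
Qed.

Lemma ip_normN x : D x -> N (- x) = N x.
Proof. by move=> Dx; rewrite -scaleN1r ip_normZ// normrN1 mul1r. Qed.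

Lemma ip_normB x y : D x -> D y -> N (x - y) <= N x + N y.
Proof. by move=> Dx Dy; rewrite -(ip_normN Dy); apply: ip_normD => //; exact: ip_memN. Qed.

Lemma ip_normBC x y : D x -> D y -> N (x - y) = N (y - x).
Proof. by move=> Dx Dy; rewrite -opprB ip_normN//; exact: ip_memB. Qed.

Lemma ip_norm0 : N 0 = 0.
Proof.
have := ip_normZ 0 (ip_mem0 ipP); rewrite scaler0 => ->.
by rewrite normr0 mul0r.
Qed.

Lemma ip_norm_triangle y x z : D x -> D y -> D z -> N (x - z) <= N (x - y) + N (y - z).
Proof.
move=> Dx Dy Dz; have -> : x - z = (x - y) + (y - z) by rewrite addrA subrK.
by apply: ip_normD; exact: ip_memB.
Qed.

Lemma ip_norm_dist x y : D x -> D y -> `|N x - N y| <= N (x - y).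
Proof.
move=> Dx Dy; have h a b : D a -> D b -> N a <= N (a - b) + N b.
  by move=> Da Db; rewrite -{1}(subrK b a); apply: ip_normD => //; exact: ip_memB.
rewrite ler_norml; have := h _ _ Dx Dy; have := h _ _ Dy Dx.
by rewrite (ip_normBC Dy Dx) => h1 h2; apply/andP; split; lra.
Qed.

End InnerProductTheory.

(** * Dyadic Euler polygons for a bounded Lipschitz field *)

Section Euler.
Context {R : realType} {V : lmodType R} {D : set V} {ip : V -> V -> R}.
Hypothesis ipP : inner_product D ip.
Local Notation N := (ip_norm ip).
Variables (F : V -> V) (K L : R) (x0 : V).
Hypothesis Dx0 : D x0.
Hypothesis DF : forall x, D x -> D (F x).
Hypothesis FK : forall x, D x -> N (F x) <= K.
Hypothesis FL : forall x y, D x -> D y -> N (F x - F y) <= L * N (x - y).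
Hypothesis L0 : 0 <= L.

Let h n : R := 2^-1 ^+ n.
Let h_gt0 n : 0 < h n. Proof. by rewrite exprn_gt0. Qed.
Let hS n : h n = 2 * h n.+1. Proof. by rewrite /h exprS mulrA divff// mul1r. Qed.
Let K_ge0 : 0 <= K. Proof. exact: le_trans (ip_norm_ge0 _) (FK Dx0). Qed.

Definition euler_poly n k := iter k (fun x => x + h n *: F x) x0.
Local Notation y := euler_poly.

Lemma euler_poly_mem n k : D (y n k).
Proof.
elim: k => //= k Dk; apply: (ip_memD ipP) => //.
by apply: (ip_memZ ipP); exact: DF.
Qed.
Local Hint Resolve euler_poly_mem : core.

Lemma euler_poly_dist n k j : N (y n (k + j) - y n k) <= j%:R * h n * K.
Proof.
elim: j => [|j IH]; first by rewrite addn0 subrr (ip_norm0 ipP) !mul0r.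
rewrite addnS/= addrAC.
have Dj : D (h n *: F (y n (k + j))) by apply: (ip_memZ ipP); exact: DF.
apply: le_trans (ip_normD ipP (ip_memB ipP _ _) Dj) _ => //.
rewrite -natr1 mulrDl mul1r mulrDl lerD// (ip_normZ ipP)//; last exact: DF.
by rewrite gtr0_norm// ler_pM2l//; exact: FK.
Qed.

(** Every velocity met along the block differs from the one at its start by at most [L] times the
    distance travelled so far, [j * h n * K]; adding these errors gives the square of the elapsed
    time. *)
Lemma euler_poly_local n k j :
  N (y n (k + j) - y n k - (j%:R * h n) *: F (y n k)) <= L * K * (j%:R * h n) ^+ 2.
Proof.
elim: j => [|j IH].
  by rewrite addn0 subrr !mul0r scale0r subr0 (ip_norm0 ipP) expr0n/= mulr0.
have DFj i : D (F (y n i)) by exact: DF.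
rewrite addnS/=.
set a := y n (k + j) in IH *; set b := y n k in IH *.
have -> : a + h n *: F a - b - (j.+1%:R * h n) *: F b =
  (a - b - (j%:R * h n) *: F b) + h n *: (F a - F b).
  rewrite -natr1 mulrDl mul1r scalerDl scalerBr opprD.
  rewrite -[LHS]addrA -!addrA; congr (_ + _).
  by rewrite addrCA; congr (_ + _); rewrite [RHS]addrCA; congr (_ + _); rewrite addrC.
have Da : D a by exact: euler_poly_mem. have Db : D b by exact: euler_poly_mem.
have DFa : D (F a) by exact: DF. have DFb : D (F b) by exact: DF.
have D1 : D (a - b - (j%:R * h n) *: F b).
  by apply: (ip_memB ipP); [exact: (ip_memB ipP)|exact: (ip_memZ ipP)].
have D2 : D (F a - F b) by exact: (ip_memB ipP).
apply: le_trans (ip_normD ipP D1 (ip_memZ ipP _ D2)) _ => //.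
rewrite (ip_normZ ipP)// gtr0_norm//.
have h1 := FL Da Db; have h2 := euler_poly_dist n k j.
have h3 : h n * N (F a - F b) <= h n * (L * (j%:R * h n * K)).
  rewrite ler_pM2l//; apply: le_trans h1 _; exact: ler_wpM2l.
apply: le_trans (lerD IH h3) _; rewrite -natr1.
have : 0 <= L * K * (h n)^+2 * (j%:R + 1).
  by rewrite !mulr_ge0 ?addr_ge0 ?ler0n// ltW.
rewrite -subr_ge0 => hh; rewrite -subr_ge0.
by apply: le_trans hh _; rewrite le_eqVlt; apply/orP; left; apply/eqP; ring.
Qed.

(** Two steps of size [h n.+1] against one of size [h n]. [euler_poly_local] with two steps gives a
    fresh error [L * K * h n ^+ 2], and the accumulated error is multiplied by at most
    [1 + h n * L <= expR (h n * L)]. *)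
Lemma euler_poly_refine n k :
  N (y n.+1 k.*2 - y n k) <= k%:R * h n ^+ 2 * L * K * expR (k%:R * h n * L).
Proof.
elim: k => [|k IH]; first by rewrite /= subrr (ip_norm0 ipP) !mul0r.
have := euler_poly_local n.+1 k.*2 2; rewrite addn2 -hS.
set a := y n.+1 k.*2.+2; set b := y n.+1 k.*2 in IH *; rewrite /=.
set c := y n k in IH * => h1.
have Da : D a by exact: euler_poly_mem. have Db : D b by exact: euler_poly_mem. have Dc : D c by exact: euler_poly_mem.
have DFb : D (F b) by exact: DF. have DFc : D (F c) by exact: DF.
have -> : a - (c + h n *: F c) = (a - b - h n *: F b) + ((b - c) + h n *: (F b - F c)).
  rewrite scalerBr opprD addrA; rewrite (addrA (a - b - _)) (addrA (a - b - _ + _)).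
  by rewrite (addrAC (a - b)) subrKA (addrAC _ (- (h n *: F b))) addrK.
have Dhb : D (h n *: F b) by exact: (ip_memZ ipP).
have D1 : D (a - b - h n *: F b) by do 2 apply: (ip_memB ipP) => //.
have D2 : D (F b - F c) by exact: (ip_memB ipP).
have D3 : D (b - c) by exact: (ip_memB ipP).
apply: le_trans (ip_normD ipP D1 (ip_memD ipP D3 (ip_memZ ipP _ D2))) _.
have h2 := ip_normD ipP D3 (ip_memZ ipP (h n) D2).
rewrite (ip_normZ ipP)// gtr0_norm// in h2.
have h3 := FL Db Dc.
have h4 : N (b - c) + h n * N (F b - F c) <= (1 + h n * L) * N (b - c).
  by rewrite mulrDl mul1r lerD2l -mulrA ler_pM2l.
apply: le_trans (lerD h1 (le_trans h2 (le_trans h4 (ler_wpM2l _ IH)))) _.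
  by rewrite addr_ge0// mulr_ge0// ltW.
have e1 : 1 + h n * L <= expR (h n * L) by exact: expR_ge1Dx.
have LKh : 0 <= L * K * h n ^+ 2 by rewrite !mulr_ge0// ltW.
have -> : k.+1%:R * h n * L = k%:R * h n * L + h n * L by rewrite -natr1; ring.
rewrite expRD.
have e2 : 1 <= expR (k%:R * h n * L) * expR (h n * L).
  by rewrite -expRD -expR0 ler_expR addr_ge0// !mulr_ge0 ?ler0n// ltW.
set A := expR (k%:R * h n * L) in e2 *; set B := expR (h n * L) in e1 e2 *.
have A0 : 0 <= A by exact: expR_ge0.
have : 0 <= L * K * h n ^+ 2 * (A * B - 1) by rewrite mulr_ge0// subr_ge0.
have : 0 <= k%:R * (L * K * h n ^+ 2) * A * (B - (1 + h n * L)).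
  by rewrite mulr_ge0 ?subr_ge0// mulr_ge0// mulr_ge0 ?ler0n.
rewrite -natr1 -(subr_ge0 (_ + _)) => g1 g2; apply: le_trans (addr_ge0 g1 g2) _.
rewrite le_eqVlt; apply/orP; left; apply/eqP; ring.
Qed.

Let ix n (t : R) := Num.truncn (t * 2 ^+ n).

Let ix_le n t : 0 <= t -> (ix n t)%:R * h n <= t < (ix n t).+1%:R * h n.
Proof.
move=> t0; have /truncn_itv : 0 <= t * 2 ^+ n by rewrite mulr_ge0.
rewrite -/(ix n t) => /andP[h1 h2]; rewrite /h exprVn.
by rewrite ler_pdivrMr ?exprn_gt0// ltr_pdivlMr ?exprn_gt0// h1.
Qed.

(** The last node before [t] on the finer grid is the last coarse node or one fine step beyond it.
    That step costs at most [K * h n], and [euler_poly_refine] bounds the rest with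
    [k * h n <= t]. *)
Lemma euler_poly_cauchy n t : 0 <= t ->
  N (y n.+1 (ix n.+1 t) - y n (ix n t)) <= (K + t * L * K * expR (t * L)) * h n.
Proof.
move=> t0; set k := ix n t; set k' := ix n.+1 t.
have /andP[a1 a2] := ix_le n t0; have /andP[b1 b2] := ix_le n.+1 t0.
have hn := h_gt0 n.+1.
have c1 : (k.*2 < k'.+1)%N.
  rewrite -(ltr_nat R) -(ltr_pM2r hn); apply: le_lt_trans b2.
  by apply: le_trans a1; rewrite (hS n) -/k -mul2n natrM; lra.
have c2 : (k' < k.*2.+2)%N.
  rewrite -(ltr_nat R) -(ltr_pM2r hn); apply: le_lt_trans b1 _.
  by apply: lt_le_trans a2 _; rewrite (hS n) -/k -doubleS -mul2n natrM; lra.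
have Ek : k' = (k.*2 + (k' - k.*2))%N by rewrite subnKC.
have j1 : (k' - k.*2 <= 1)%N by rewrite leq_subLR addn1.
have yD := euler_poly_mem.
apply: le_trans (ip_norm_triangle ipP (yD _ _) (yD n.+1 k.*2) (yD _ _)) _.
rewrite mulrDl; apply: lerD.
  rewrite Ek; apply: le_trans (euler_poly_dist _ _ _) _.
  rewrite mulrC ler_wpM2l// (hS n) ler_pM2r//.
  by apply: (@le_trans _ _ 1%:R); rewrite ?ler_nat// lerD2l.
apply: le_trans (euler_poly_refine n k) _.
have -> : k%:R * h n ^+ 2 * L * K * expR (k%:R * h n * L) =
   (k%:R * h n) * (L * K) * expR (k%:R * h n * L) * h n by ring.
rewrite ler_pM2r// -(mulrA t).
apply: ler_pM; rewrite ?expR_ge0 ?mulr_ge0 ?ler0n//; first exact: ltW.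
  by apply: ler_wpM2r => //; exact: mulr_ge0.
by rewrite ler_expR; exact: ler_wpM2r.
Qed.

Lemma euler_exists : ip_complete D ip -> exists X : R -> V,
  [/\ X 0 = x0, forall t, 0 <= t -> D (X t) &
   forall s t, 0 <= s -> s <= t ->
     N (X t - X s - (t - s) *: F (X s)) <= L * K * (t - s) ^+ 2].
Proof.
move=> cpl; pose C t := 2 * (K + t * L * K * expR (t * L)).
have /choice[X PX] : forall t, exists l, 0 <= t ->
    [/\ D l, forall n, N (y n (ix n t) - l) <= C t * h n & t = 0 -> l = x0].
  move=> t; case: (ltP 0 t) => [tp|tn]; last first.
    (* At [t = 0] the value [x0] is imposed: a limit in a degenerate norm would agree with it only
       up to norm zero. *)
    exists x0 => t0; have -> : t = 0 by apply/le_anti/andP.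
    split=> // n; rewrite /ix mul0r truncn0/= subrr (ip_norm0 ipP).
    rewrite /C !mul0r addr0 mulr_ge0//; last exact/ltW.
    exact: mulr_ge0.
  have [l Dl Pl] := cpl _ _ (fun n => euler_poly_mem n (ix n t))
     (fun n => euler_poly_cauchy n (ltW tp)).
  by exists l => _; split => // t0; rewrite t0 ltxx in tp.
exists X; split; first by have [] := PX 0 (lexx _) => // _ _; exact.
  by move=> t /PX[].
move=> s t s0 st; have t0 := le_trans s0 st.
have [Ds Ps _] := PX _ s0; have [Dt Pt _] := PX _ t0.
set d := t - s; have d0 : 0 <= d by rewrite subr_ge0.
have LK0 : 0 <= L * K by exact: mulr_ge0.
(* [c] collects the errors proportional to [h n]: the distances from [X t] and [X s] to the polygon,
   the gap [jh - d] between grid time and true time, and the change of velocity from the node to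
   [X s]. *)
pose c := C t + C s + L * K * (2 * d + 1) + K + d * L * C s.
suff main n : N (X t - X s - d *: F (X s)) <= L * K * d ^+ 2 + c * h n.
  apply/ler_addgt0Pr => e e0.
  have [c0|c0] := leP c 0.
    apply: le_trans (main 0%N) _; rewrite lerD2l; apply: le_trans _ (ltW e0).
    by rewrite /h expr0 mulr1.
  have : h n @[n --> \oo] --> (0 : R).
    by apply: cvg_expr; rewrite ger0_norm// invf_lt1// ltr1n.
  move=> /cvgrPdist_lt /(_ (e / c)); rewrite divr_gt0// => /(_ erefl) [m _ /(_ m)] /=.
  rewrite leqnn sub0r normrN (gtr0_norm (h_gt0 m)) => /(_ erefl) hm.
  apply: le_trans (main m) _; rewrite lerD2l mulrC -ler_pdivlMr//; exact: ltW.
have hn := h_gt0 n.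
have /andP[a1 a2] := ix_le n t0; have /andP[b1 b2] := ix_le n s0.
have kk : (ix n s <= ix n t)%N.
  rewrite -ltnS -(ltr_nat R) -(ltr_pM2r hn); exact: le_lt_trans b1 (le_lt_trans st a2).
have [j Ej] : exists j, ix n t = (ix n s + j)%N by exists (ix n t - ix n s)%N; rewrite subnKC.
have := euler_poly_local n (ix n s) j; rewrite -Ej.
have := Ps n; have := Pt n.
set a := y n (ix n t); set b := y n (ix n s); set jh := j%:R * h n.
move=> Hat Hbs Hl.
have jhE : jh = (ix n t)%:R * h n - (ix n s)%:R * h n by rewrite Ej natrD mulrDl addrC addKr.
have j1 : jh <= d + h n by rewrite jhE /d -natr1 in b2 *; rewrite mulrDl mul1r in b2; lra.
have j2 : d <= jh + h n by rewrite jhE /d -natr1 in a2 *; rewrite mulrDl mul1r in a2; lra.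
have jh0 : 0 <= jh by rewrite mulr_ge0 ?ler0n// ltW.
have Da : D a by exact: euler_poly_mem. have Db : D b by exact: euler_poly_mem.
have Ft := DF Dt; have Fs := DF Ds; have Fb := DF Db.
have hle1 : h n <= 1 by rewrite exprn_ile1// invf_le1// ler1n.
have -> : X t - X s - d *: F (X s) =
  (a - b - jh *: F b) + ((X t - a) + ((b - X s) + ((jh - d) *: F b + d *: (F b - F (X s))))).
  rewrite (scalerBl jh d) (scalerBr d) subrKA (addrACA b) -[a - b - _]addrA -opprD.
  by rewrite [RHS]addrCA [(a - _) + _]addrA subrK [RHS]addrA subrK addrA.
have D1 : D (a - b - jh *: F b).
  by apply: (ip_memB ipP); [exact: (ip_memB ipP)|exact: (ip_memZ ipP)].
have D2 : D (X t - a) by exact: (ip_memB ipP).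
have D3 : D (b - X s) by exact: (ip_memB ipP).
have D4 : D ((jh - d) *: F b) by exact: (ip_memZ ipP).
have D5 : D (F b - F (X s)) by exact: (ip_memB ipP).
have D6 : D (d *: (F b - F (X s))) by exact: (ip_memZ ipP).
have n1 := ip_normD ipP D1 (ip_memD ipP D2 (ip_memD ipP D3 (ip_memD ipP D4 D6))).
have n2 := ip_normD ipP D2 (ip_memD ipP D3 (ip_memD ipP D4 D6)).
have n3 := ip_normD ipP D3 (ip_memD ipP D4 D6).
have n4 := ip_normD ipP D4 D6.
have n5 : N ((jh - d) *: F b) <= h n * K.
  rewrite (ip_normZ ipP)//; apply: ler_pM => //; first exact: ip_norm_ge0.
    by rewrite ler_norml; apply/andP; split; lra.
  exact: FK.
have n6 : N (d *: (F b - F (X s))) <= d * (L * (C s * h n)).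
  rewrite (ip_normZ ipP)// ger0_norm// ler_wpM2l//; apply: le_trans (FL _ _) _ => //.
  exact: ler_wpM2l.
have n7 : L * K * jh ^+ 2 <= L * K * (d ^+ 2 + h n * (2 * d + 1)).
  rewrite ler_wpM2l//; apply: (@le_trans _ _ ((d + h n) ^+ 2)).
    by rewrite ler_pXn2r// nnegrE// addr_ge0// ltW.
  have : h n * h n <= h n by rewrite ger_pMr.
  by move: (h n) => r; nra.
rewrite (ip_normBC ipP Da Dt) in Hat.
have -> : c * h n = C t * h n + C s * h n + L * K * (h n * (2 * d + 1)) + h n * K
   + d * (L * (C s * h n)) by rewrite /c; ring.
rewrite mulrDr in n7; lra.
Qed.

End Euler.

(** * Square-integrable functions *)

Notation lebesgue_integrable f :=
  ((@lebesgue_measure _).-integrable setT (EFin \o f)).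
Local Notation itg f := (lebesgue_integrable f).

Definition ip2 {R : realType} (f g : R -> R) : R :=
  \int[@lebesgue_measure R]_x (f x * g x).

Section Integrable.
Context {R : realType}.
Local Notation mu := (@lebesgue_measure R).
Implicit Types f g : R -> R.

Lemma itg_measurable f : itg f -> measurable_fun setT f.
Proof. by move=> /integrableP[/measurable_EFinP]. Qed.

Lemma itg_le f g : measurable_fun setT f -> itg g ->
  (forall x, `|f x| <= g x) -> itg f.
Proof.
move=> mf ig fg; apply: le_integrable ig => //; first exact/measurable_EFinP.
move=> x _ /=; rewrite lee_fin; apply: le_trans (fg x) _; exact: ler_norm.
Qed.

Lemma itgD f g : itg f -> itg g -> itg (fun x => f x + g x).
Proof. by move=> hf hg; exact: (integrableD measurableT hf hg). Qed.

Lemma itgB f g : itg f -> itg g -> itg (fun x => f x - g x).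
Proof. by move=> hf hg; exact: (integrableB measurableT hf hg). Qed.

Lemma itgZ c f : itg f -> itg (fun x => c * f x).
Proof. by move=> hf; exact: (integrableZl measurableT c hf). Qed.

Lemma itg_norm f : itg f -> itg (fun x => `|f x|).
Proof. by move=> hf; exact: (integrable_norm hf). Qed.

Lemma ae_null (P : R -> Prop) : {ae mu, forall x, P x} ->
  exists N, [/\ measurable N, mu N = 0 & forall x, ~ N x -> P x].
Proof.
move=> [N [mN N0 sN]]; exists N; split => // x Nx.
by apply: contrapT => Px; apply: Nx; exact: sN.
Qed.

Lemma ae_off_null (N : set R) (P : R -> Prop) : measurable N -> mu N = 0 ->
  (forall x, ~ N x -> P x) -> {ae mu, forall x, P x}.
Proof.
move=> mN N0 h; exists N; split => // x /= Px; apply: contrapT => Nx; exact/Px/h.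
Qed.

Lemma aeS (P Q : R -> Prop) : (forall x, P x -> Q x) ->
  {ae mu, forall x, P x} -> {ae mu, forall x, Q x}.
Proof. by move=> PQ /ae_null[N [mN N0 h]]; apply: (ae_off_null mN N0) => x /h/PQ. Qed.

Lemma aeS2 (P Q S : R -> Prop) : (forall x, P x -> Q x -> S x) ->
  {ae mu, forall x, P x} -> {ae mu, forall x, Q x} -> {ae mu, forall x, S x}.
Proof.
move=> PQS /ae_null[N [mN N0 h]] /ae_null[M [mM M0 k]].
apply: (@ae_off_null (N `|` M)); first exact: measurableU.
  by rewrite null_set_setU.
by move=> x /not_orP[Nx Mx]; apply: PQS; [exact: h|exact: k].
Qed.

Lemma Rintegral_ae_eq f g : measurable_fun setT f -> measurable_fun setT g ->
  f = g %[ae mu] -> \int[mu]_x f x = \int[mu]_x g x.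
Proof.
move=> mf mg fg; rewrite /Rintegral; congr fine.
apply: ae_eq_integral => //; try exact/measurable_EFinP.
by apply: aeS fg => x /= h /h ->.
Qed.

Lemma itg_ae_eq f g : measurable_fun setT g -> f = g %[ae mu] -> itg f -> itg g.
Proof.
move=> mg fg /integrableP[mf fo]; apply/integrableP; split; first exact/measurable_EFinP.
rewrite (_ : integral _ _ _ = \int[mu]_x `|(EFin \o f) x|)%E//.
apply: ae_eq_integral => //; try exact: measurableT_comp.
  by apply: measurableT_comp => //; exact/measurable_EFinP.
by apply: aeS fg => x /= h /h ->.
Qed.

Lemma L2P f : L2 f <-> measurable_fun setT f /\ itg (fun x => f x ^+ 2).
Proof.
split.
  rewrite /L2/= => hf; split; last exact: Lfun2_integrable_sqr.
  by move: hf; rewrite inE => /andP[/[!inE]/=].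
move=> [mf /integrableP[_ fo]]; rewrite /L2/= inE; apply/andP; split; rewrite inE//=.
rewrite /finite_norm unlock /Lnorm poweR_lty//.
apply: le_lt_trans fo; apply: ge0_le_integral => //.
- by move=> x _; rewrite poweR_ge0.
- apply/measurable_EFinP => /=.
  apply/(@measurableT_comp _ _ _ _ _ _ (fun x : R => x `^ 2)%R) => //.
  exact/measurableT_comp.
- by apply: measurableT_comp => //; apply/measurable_EFinP; exact: measurable_funX.
- by move=> x _ /=; rewrite lee_fin powR_mulrn// -normrX.
Qed.

Lemma L2_measurable f : L2 f -> measurable_fun setT f. Proof. by move=> /L2P[]. Qed.

Lemma L2_mul f g : L2 f -> L2 g -> itg (fun x => f x * g x).
Proof. by move=> hf hg; apply/Lfun1_integrable; exact: Lfun2_mul_Lfun1. Qed.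

Lemma L2_sqE f : L2 f -> (\int[mu]_x (f x ^+ 2)%:E)%E = (ip2 f f)%:E.
Proof.
move=> hf; rewrite /ip2 /Rintegral fineK; last exact: (integrable_fin_num measurableT (L2_mul hf hf)).
by apply: eq_integral => x _; rewrite expr2.
Qed.

Lemma L2_normE f : L2 f -> L2norm f = ip_norm ip2 f.
Proof.
move=> /L2P[mf fo]; rewrite /L2norm unlock /Lnorm /ip_norm /ip2 /Rintegral.
rewrite -[RHS]powR12_sqrt; last by rewrite fine_ge0// integral_ge0// => x _; rewrite lee_fin -expr2 sqr_ge0.
rewrite fine_poweR; congr (fine _ `^ _).
by apply: eq_integral => x _ /=; rewrite powR_mulrn// -normrX ger0_norm ?sqr_ge0// expr2.
Qed.

Lemma L2_le f g : measurable_fun setT f -> L2 g -> (forall x, `|f x| <= `|g x|) -> L2 f.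
Proof.
move=> mf /L2P[mg g2] fg; apply/L2P; split=> //; apply: itg_le g2 _ => //.
  exact: measurable_funX.
move=> x; rewrite normrX -(real_normK (num_real (g x))).
by rewrite ler_pXn2r// nnegrE.
Qed.

Lemma L2D f g : L2 f -> L2 g -> L2 (f + g).
Proof.
move=> hf hg; have [mf f2] := proj1 (L2P f) hf; have [mg g2] := proj1 (L2P g) hg.
apply/L2P; split; first exact: measurable_funD.
apply: (@itg_le _ (fun x => 2 * (f x ^+ 2 + g x ^+ 2))).
- by apply: measurable_funX; exact: measurable_funD.
- by apply: itgZ; exact: itgD.
- move=> x; rewrite ger0_norm ?sqr_ge0//.
  change ((f x + g x) ^+ 2 <= 2 * (f x ^+ 2 + g x ^+ 2)).
  by have := sqr_ge0 (f x - g x); rewrite sqrrB sqrrD; lra.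
Qed.

Lemma L2Z c f : L2 f -> L2 (c *: f).
Proof.
move=> /L2P[mf f2]; apply/L2P; split; first exact: measurable_funM.
have -> : (fun x => (c *: f) x ^+ 2) = (fun x => c ^+ 2 * f x ^+ 2).
  by apply/funext => x; rewrite -exprMn.
exact: itgZ.
Qed.

Lemma L20 : L2 (0 : R -> R).
Proof.
apply/L2P; split; first exact: measurable_cst.
have -> : (fun x : R => (0 : R -> R) x ^+ 2) = cst 0 by apply/funext => x; rewrite expr0n.
exact: integrable0.
Qed.

Lemma L2B f g : L2 f -> L2 g -> L2 (f - g).
Proof. by move=> hf hg; apply: L2D => //; rewrite -scaleN1r; exact: L2Z. Qed.

Lemma ip2P : inner_product (@L2 R) ip2.
Proof.
split.
- exact: L20.
- exact: L2D.
- exact: L2Z.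
- by move=> f g _ _; rewrite /ip2; apply: eq_Rintegral => x _; rewrite mulrC.
- move=> f g h hf hg hh; rewrite /ip2 -RintegralD//; try exact: L2_mul.
  by apply: eq_Rintegral => x _; rewrite -mulrDl.
- move=> c f g hf hg; rewrite /ip2 -RintegralZl//; last exact: L2_mul.
  by apply: eq_Rintegral => x _; rewrite mulrA.
- by move=> f hf; apply: Rintegral_ge0 => x _; rewrite -expr2 sqr_ge0.
Qed.

Let L2_fatou_pointwise (f : nat -> R -> R) g B : (forall n, L2 (f n)) ->
  (forall x, f n x @[n --> \oo] --> g x) ->
  (forall n, ip_norm ip2 (f n) <= B) -> L2 g /\ ip_norm ip2 g <= B.
Proof.
move=> hf fg fB.
have mg : measurable_fun setT g.
  by apply: (measurable_fun_cvg (h := f)) => // n; exact: L2_measurable.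
have B0 : 0 <= B by apply: le_trans (fB 0%N); exact: ip_norm_ge0.
have F : (\int[mu]_x (g x ^+ 2)%:E <= (B ^+ 2)%:E)%E.
  have := @fatou _ _ _ mu setT measurableT (fun n x => (f n x ^+ 2)%:E).
  have mf n : measurable_fun setT (fun x => (f n x ^+ 2)%:E).
    by apply/measurable_EFinP; apply: measurable_funX; exact: L2_measurable.
  move=> /(_ mf (fun _ _ _ => _)) h.
  have {h} := h (fun n x => ltac:(by rewrite lee_fin sqr_ge0)).
  have -> : (fun x => limn_einf (fun n => (f n x ^+ 2)%:E)) = (fun x => (g x ^+ 2)%:E).
    apply/funext => x; have : (f n x ^+ 2)%:E @[n --> \oo] --> (g x ^+ 2)%:E.
      apply: cvg_EFin; first exact: nearW.
      rewrite (_ : _ \o _ = (fun n => f n x ^+ 2))//.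
      by rewrite expr2; under eq_fun do rewrite expr2; exact: cvgM.
    by move=> /cvg_limn_einf_sup[].
  move=> h; apply: le_trans h _; rewrite limn_einf_lim.
  apply: lime_le; first exact: is_cvg_einfs.
  apply: nearW => n; apply: le_trans (@ereal_inf_lbound _ _ _ _) _; first by exists n => /=.
  have := fB n; rewrite -(@ler_pXn2r _ 2)// ?nnegrE ?ip_norm_ge0// (ip_normE ip2P)// => {}h.
  by rewrite L2_sqE// lee_fin.
have hg : L2 g.
  apply/L2P; split=> //; apply/integrableP; split.
    by apply/measurable_EFinP; exact: measurable_funX.
  apply: le_lt_trans (ltry (B ^+ 2)); apply: le_trans F.
  by under eq_integral do rewrite /= ger0_norm ?sqr_ge0//.
split => //; rewrite -(@ler_pXn2r _ 2)// ?nnegrE ?ip_norm_ge0// (ip_normE ip2P)//.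
by rewrite -lee_fin -L2_sqE.
Qed.

(** Fatou's lemma for the squares gives membership and bound together, which spares an appeal to
    weak compactness. *)
Lemma L2_fatou (f : nat -> R -> R) g B : measurable_fun setT g ->
  (forall n, L2 (f n)) -> {ae mu, forall x, f n x @[n --> \oo] --> g x} ->
  (forall n, ip_norm ip2 (f n) <= B) -> L2 g /\ ip_norm ip2 g <= B.
Proof.
move=> mg hf /ae_null[N [mN N0 cvN]] fB.
(* Multiplication by this indicator turns convergence off a null set into convergence everywhere and
   changes no integral. *)
pose c : R -> R := \1_(~` N).
have mc : measurable_fun setT c by apply: measurable_indic; exact: measurableC.
have cE x : c x = (x \notin N)%:R by rewrite /c indicE in_setC.
have ceq h : (fun x => h x * c x) = h %[ae mu].
  apply: (ae_off_null mN N0) => x Nx _; rewrite /= cE memNset// mulr1//.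
have hfc n : L2 (fun x => f n x * c x).
  apply: L2_le (hf n) _; first by apply: measurable_funM => //; exact: L2_measurable.
  by move=> x; rewrite normrM cE; case: (_ \in _); rewrite /= ?normr0 ?mulr0 ?normr1 ?mulr1.
have mgc : measurable_fun setT (fun x => g x * c x) by exact: measurable_funM.
have ip_eq (h : R -> R) : measurable_fun setT h -> ip_norm ip2 (fun x => h x * c x) = ip_norm ip2 h.
  move=> mh; rewrite /ip_norm /ip2; congr Num.sqrt; apply: Rintegral_ae_eq.
  - by do 2 apply: measurable_funM.
  - exact: measurable_funM.
  - by apply: aeS (ceq h) => x /= e _; rewrite e.
have [] := @L2_fatou_pointwise (fun n x => f n x * c x) (fun x => g x * c x) B hfc.
- move=> x; rewrite cE; case: (boolP (x \in N)) => /= xN.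
    by rewrite mulr0; under eq_fun do rewrite mulr0; exact: cvg_cst.
  rewrite mulr1; under eq_fun do rewrite mulr1.
  by apply: cvN => Nx; rewrite mem_set in xN.
- by move=> n; rewrite ip_eq//; exact: L2_measurable.
move=> /L2P[_ h1]; rewrite ip_eq// => h2; split => //; apply/L2P; split => //.
apply: itg_ae_eq h1; first exact: measurable_funX.
by apply: aeS (ceq g) => x /= e _; rewrite e.
Qed.

Lemma half_expn_gt0 n : 0 < 2^-1 ^+ n :> R.
Proof. by rewrite exprn_gt0. Qed.

(** The geometric rate makes the whole sequence converge almost everywhere, with no passage to a
    subsequence. *)
Lemma L2_complete_ae (f : nat -> R -> R) C : (forall n, L2 (f n)) ->
  (forall n, ip_norm ip2 (f n.+1 - f n) <= C * 2^-1 ^+ n) ->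
  exists l, [/\ L2 l, forall n, ip_norm ip2 (f n - l) <= 2 * C * 2^-1 ^+ n
    & {ae mu, forall x, f n x @[n --> \oo] --> l x}].
Proof.
move=> hf fC.
have C0 : 0 <= C by have := le_trans (ip_norm_ge0 _) (fC 0%N); rewrite expr0 mulr1.
(* The weight [2 ^+ n] is a compromise: the integral of [d n] is at most [C ^+ 2 * 2^-1 ^+ n], and
   [|r| <= 2^-1 ^+ n + 2 ^+ n * r ^+ 2], so the increments are absolutely summable wherever the
   [d n] are. *)
pose d n (x : R) : R := 2 ^+ n * (f n.+1 x - f n x) ^+ 2.
have hd n : L2 (f n.+1 - f n) by exact: L2B.
have d0 n x : 0 <= d n x by apply: mulr_ge0; [exact: exprn_ge0|exact: sqr_ge0].
have di n : itg (d n) by apply: itgZ; have /L2P[] := hd n.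
have md n : measurable_fun setT (EFin \o d n) by apply/measurable_EFinP; exact: itg_measurable.
pose W x := (\sum_(0 <= n <oo) (d n x)%:E)%E.
have IW : (\int[mu]_x W x < +oo)%E.
  rewrite integral_nneseries//; last by move=> n x _; rewrite lee_fin.
  apply: (@le_lt_trans _ _ (\sum_(0 <= n <oo) (C ^+ 2 / (2 ^ n)%:R)%:E)%E).
    apply: lee_nneseries => [n _ _|n _]; first by apply: integral_ge0 => x _; rewrite lee_fin.
    rewrite -[leLHS]fineK; last exact: (integrable_fin_num measurableT (di n)).
    rewrite lee_fin -/(Rintegral mu setT (d n)) /d.
    rewrite RintegralZl//; last by have /L2P[] := hd n.
    have : ip2 (f n.+1 - f n) (f n.+1 - f n) <= (C * 2^-1 ^+ n) ^+ 2.
      by rewrite -(ip_normE ip2P)// ler_pXn2r// nnegrE ?ip_norm_ge0// (le_trans _ (fC n))// ip_norm_ge0.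
    rewrite /ip2; under [X in _ -> _ * X <= _]eq_Rintegral do rewrite expr2.
    have p2 : 0 < 2 ^+ n :> R by rewrite exprn_gt0.
    move=> /(ler_wpM2l (ltW p2)) h; apply: le_trans h _.
    rewrite le_eqVlt; apply/orP; left; apply/eqP; rewrite natrX exprMn exprVn; field.
    by rewrite gt_eqF.
  have cg : cvgn (series (geometric (C ^+ 2) (2^-1 : R))).
    by apply: is_cvg_geometric_series; rewrite ger0_norm// invf_lt1// ltr1n.
  rewrite (_ : (fun n => _) = EFin \o series (geometric (C ^+ 2) 2^-1)); last first.
    apply/funext => n /=; rewrite sumEFin /series/=; congr EFin.
    by apply: eq_bigr => i _; rewrite natrX exprVn.
  by rewrite EFin_lim// ltry.
have W0 x : (0 <= W x)%E by apply: nneseries_ge0 => n _ _; rewrite lee_fin.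
have mW : measurable_fun setT W.
  apply: (@ge0_emeasurable_sum _ _ _ setT (fun n x => (d n x)%:E) xpredT) => //.
  - by move=> n x _ _; rewrite lee_fin.
  - by move=> n _; exact: md.
have Wi : mu.-integrable setT W.
  apply/integrableP; split; first exact: mW.
  by under eq_integral do rewrite gee0_abs//.
have /ae_null[N [mN N0 WN]] := integrable_ae measurableT Wi.
have cvN x : ~ N x -> cvgn (f ^~ x).
  move=> /WN /(_ I) Wf.
  have dW n : \sum_(0 <= i < n) d i x <= fine (W x).
    rewrite -lee_fin fineK// -sumEFin; apply: nneseries_lim_ge => i _ _.
    by rewrite lee_fin.
  pose u i := f i.+1 x - f i x.
  have cu : cvgn (series u).
    apply: normed_cvg; apply: nondecreasing_is_cvgn.
      by apply: nondecreasing_series => n _ _ /=.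
    exists (2 + fine (W x)) => _ [n _ <-]; rewrite /series/=.
    apply: (@le_trans _ _ (\sum_(0 <= i < n) ((2^-1 ^+ i) + d i x))).
      apply: ler_sum => i _; rewrite /d /u.
      set r := f i.+1 x - f i x; have p2 : 0 < 2 ^+ i :> R by rewrite exprn_gt0.
      rewrite exprVn -(ler_pM2l p2) mulrDr divff ?gt_eqF//.
      have := sqr_ge0 (2 ^+ i * `|r| - 1); rewrite -(real_normK (num_real r)).
      by move: (2 ^+ i) p2 (`|r|) (normr_ge0 r) => q q0 s s0; nra.
    rewrite big_split/= lerD//.
    have : \sum_(0 <= i < n) 2^-1 ^+ i <= 2 - 2 * 2^-1 ^+ n :> R.
      elim: n => [|n IH]; first by rewrite big_nil expr0; lra.
      by rewrite big_nat_recr//= exprS; lra.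
    by move=> h; apply: le_trans h _; have := half_expn_gt0 n; lra.
  have -> : f ^~ x = (fun n => series u n + f 0%N x).
    by apply/funext => n; rewrite /series/= telescope_sumr// subrK.
  by apply: is_cvgD => //; exact: is_cvg_cst.
pose l x := if x \in N then 0 else limn (f ^~ x).
have fl x : ~ N x -> f n x @[n --> \oo] --> l x.
  by move=> Nx; rewrite /l memNset//; exact: cvN.
have ml : measurable_fun setT l.
  apply: (@measurable_fun_cvg _ _ _ _ (fun n x => f n x * \1_(~` N) x)).
    move=> n; apply: measurable_funM; first exact: L2_measurable.
    by apply: measurable_indic; exact: measurableC.
  move=> x _; rewrite indicE in_setC; case: (boolP (x \in N)) => xN /=.
    by rewrite /l xN; under eq_fun do rewrite mulr0; exact: cvg_cst.
  by under eq_fun do rewrite mulr1; apply: fl => Nx; rewrite mem_set in xN.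
have fn n m : ip_norm ip2 (f (n + m)%N - f n) <= 2 * C * 2^-1 ^+ n.
  suff : ip_norm ip2 (f (n + m)%N - f n) <= 2 * C * (2^-1 ^+ n - 2^-1 ^+ (n + m)).
    move=> h1; apply: le_trans h1 _; rewrite mulrBr gerBl mulr_ge0 ?(ltW (half_expn_gt0 _))//.
    by rewrite mulr_ge0.
  elim: m => [|m IH]; first by rewrite addn0 !subrr (ip_norm0 ip2P) mulr0.
  rewrite addnS; apply: le_trans (ip_norm_triangle ip2P (hf _) (hf (n + m)%N) (hf _)) _.
  apply: le_trans (lerD (fC _) IH) _; rewrite exprS; lra.
(* Fatou applied to [f n - f (n + m)], with [m] going to infinity, turns the Cauchy bound into the
   rate of convergence. *)
have key n : L2 (f n - l) /\ ip_norm ip2 (f n - l) <= 2 * C * 2^-1 ^+ n.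
  apply: (@L2_fatou (fun m => f n - f (n + m)%N)).
  - by apply: measurable_funB => //; exact: L2_measurable.
  - by move=> m; exact: L2B.
  - apply: (ae_off_null mN N0) => x Nx; apply: cvgB; first exact: cvg_cst.
    have := fl x Nx; rewrite -(cvg_shiftn n).
    by under eq_fun do rewrite addnC.
  - by move=> m; rewrite (ip_normBC ip2P)//; exact: fn.
exists l; split; last exact: (ae_off_null mN N0).
- have [h _] := key 0%N; have -> : l = f 0%N - (f 0%N - l) by rewrite opprB addrC subrK.
  exact: L2B.
- by move=> n; have [] := key n.
Qed.

Lemma L2_complete : ip_complete (@L2 R) ip2.
Proof.
by move=> f C hf fC; have [l [hl fl _]] := L2_complete_ae hf fC; exists l.
Qed.

Lemma L2_ae_eq f g : measurable_fun setT g -> f = g %[ae mu] -> L2 f -> L2 g.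
Proof.
move=> mg fg /L2P[mf fi]; apply/L2P; split=> //.
apply: itg_ae_eq fi; first exact: measurable_funX.
by apply: aeS fg => x /= h _; rewrite h.
Qed.

Lemma ip_norm2_ae_eq f g : measurable_fun setT f -> measurable_fun setT g ->
  f = g %[ae mu] -> ip_norm ip2 f = ip_norm ip2 g.
Proof.
move=> mf mg fg; rewrite /ip_norm /ip2; congr Num.sqrt; apply: Rintegral_ae_eq.
- exact: measurable_funM.
- exact: measurable_funM.
- by apply: aeS fg => x /= h _; rewrite h.
Qed.

Lemma ip2_ae_eq f1 g1 f2 g2 : L2 f1 -> L2 g1 -> L2 f2 -> L2 g2 ->
  f1 = f2 %[ae mu] -> g1 = g2 %[ae mu] -> ip2 f1 g1 = ip2 f2 g2.
Proof.
move=> hf1 hg1 hf2 hg2 ef eg; apply: Rintegral_ae_eq.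
- by apply: measurable_funM; exact: L2_measurable.
- by apply: measurable_funM; exact: L2_measurable.
- by apply: aeS2 ef eg => x /= h1 h2 _; rewrite h1// h2.
Qed.

Lemma L2_bounded_mul f g M : measurable_fun setT f -> (forall x, `|f x| <= M) -> L2 g ->
  L2 (fun x => f x * g x) /\ ip_norm ip2 (fun x => f x * g x) <= M * ip_norm ip2 g.
Proof.
move=> mf fM hg; have M0 : 0 <= M by exact: le_trans (normr_ge0 _) (fM 0).
have le x : `|f x * g x| <= `|(M *: g) x|.
  by rewrite !normrM (ger0_norm M0) ler_wpM2r.
have mfg : measurable_fun setT (fun x => f x * g x).
  by apply: measurable_funM => //; exact: L2_measurable.
have hMg := L2Z M hg; have hfg := L2_le mfg hMg le.
split => //; rewrite -{1}(ger0_norm M0) -(ip_normZ ip2P)//.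
rewrite /ip_norm ler_wsqrtr// /ip2; apply: le_Rintegral => //; try exact: L2_mul.
move=> x _; rewrite -!expr2 -[leLHS]ger0_norm ?sqr_ge0// -[leRHS]ger0_norm ?sqr_ge0//.
by rewrite !normrX ler_pXn2r// nnegrE.
Qed.

End Integrable.

(** * Absolutely continuous functions *)

Notation seg_itg f a b := ((@lebesgue_measure _).-integrable `[a, b] (EFin \o f)).

Definition primitive {R : realType} (g f : R -> R) : Prop :=
  forall a b, a <= b -> f b - f a = \int[@lebesgue_measure R]_(x in `[a, b]) g x.

(** An element of [H^1], given by its continuous representative; the derivative is carried along
    because it is determined only almost everywhere. *)
Definition ac_pair {R : realType} (f g : R -> R) : Prop :=
  [/\ L2 f, L2 g & primitive g f].

Section AbsoluteContinuity.
Context {R : realType}.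
Local Notation mu := (@lebesgue_measure R).
Local Notation itg f := (lebesgue_integrable f).
Local Notation N2 := (ip_norm ip2).
Implicit Types f g : R -> R.

Lemma seg_itgB f g a b : seg_itg f a b -> seg_itg g a b -> seg_itg (fun x => f x - g x) a b.
Proof. by move=> hf hg; have := integrableB _ hf hg; apply. Qed.

Lemma seg_itgD f g a b : seg_itg f a b -> seg_itg g a b -> seg_itg (fun x => f x + g x) a b.
Proof. by move=> hf hg; have := integrableD _ hf hg; apply. Qed.

Lemma seg_itgZ c f a b : seg_itg f a b -> seg_itg (fun x => c * f x) a b.
Proof. by move=> hf; have := integrableZl _ c hf; apply. Qed.

Lemma seg_itg_patch f a b : seg_itg f a b -> itg (f \_ `[a, b]).
Proof.
move=> hf; rewrite -restrict_EFin.
by apply/(@integrable_mkcond _ _ _ mu `[a, b]%classic (EFin \o f)).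
Qed.

Lemma seg_norm_le f a b : seg_itg f a b ->
  `|\int[mu]_(x in `[a, b]) f x| <= \int[mu]_(x in `[a, b]) `|f x|.
Proof. by move=> hf; apply: le_normr_Rintegral. Qed.

Lemma Rintegral_segE g a b : \int[mu]_(x in `[a, b]) g x = ip2 (\1_`[a, b]) g.
Proof.
rewrite Rintegral_mkcond /ip2; apply: eq_Rintegral => x _.
by rewrite patchE indicE; case: (x \in _); rewrite ?mul1r ?mul0r.
Qed.

Lemma itg_seg f a b : itg f -> mu.-integrable `[a, b] (EFin \o f).
Proof. by apply: integrableS. Qed.

Lemma L2_indic a b : L2 (\1_`[a, b] : R -> R).
Proof.
apply/L2P; split; first exact: measurable_indic.
have -> : (fun x => \1_`[a, b] x ^+ 2) = \1_`[a, b] :> (R -> R).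
  by apply/funext => x; rewrite indicE; case: (x \in _); rewrite ?expr1n ?expr0n.
exact: integrable_indic_itv.
Qed.

Lemma ip2_indic a b : a <= b -> ip2 (\1_`[a, b]) (\1_`[a, b]) = b - a :> R.
Proof.
move=> ab; rewrite -Rintegral_segE.
rewrite (_ : \int[mu]_(x in _) _ = \int[mu]_(x in `[a, b]) 1); last first.
  by apply: eq_Rintegral => x xab; rewrite indicE xab.
rewrite Rintegral_cst//= mul1r lebesgue_measure_itv/= lte_fin.
by move: ab; rewrite le_eqVlt => /predU1P[->|->]; rewrite ?ltxx ?subrr.
Qed.

Lemma N2_indic a b : a <= b -> N2 (\1_`[a, b]) = Num.sqrt (b - a) :> R.
Proof. by move=> ab; rewrite /ip_norm ip2_indic. Qed.

Lemma L2_seg_itg g a b : L2 g -> mu.-integrable `[a, b] (EFin \o g).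
Proof.
move=> hg; apply/integrable_mkcond => //.
have := L2_mul (L2_indic a b) hg.
rewrite restrict_EFin => h; apply: eq_integrable h => // x _ /=.
by rewrite patchE indicE; case: (x \in _); rewrite ?mul1r ?mul0r.
Qed.

Lemma Rintegral_seg_add g a b c : a <= b -> b <= c -> mu.-integrable `[a, c] (EFin \o g) ->
  \int[mu]_(x in `[a, c]) g x = \int[mu]_(x in `[a, b]) g x + \int[mu]_(x in `[b, c]) g x.
Proof.
move=> ab bc hg; have := @Rintegral_itvB _ g (BLeft a) (BRight c) b hg.
rewrite !bnd_simp => /(_ ab bc); rewrite Rintegral_itv_obnd_cbnd; first by move=> <-; rewrite addrC subrK.
apply: integrableS hg => // x /=; rewrite !in_itv/= => /andP[bx ->]; rewrite andbT.
by rewrite (le_trans ab)// ltW.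
Qed.

Lemma Rintegral_seg_hoelder g a b : a <= b -> L2 g ->
  `|\int[mu]_(x in `[a, b]) g x| <= Num.sqrt (b - a) * N2 g.
Proof.
move=> ab hg; rewrite Rintegral_segE -(N2_indic ab).
by apply: (ip_cauchy_schwarz ip2P) => //; exact: L2_indic.
Qed.

Lemma L2_norm_fun g : L2 g -> L2 (fun x => `|g x|).
Proof.
move=> hg; have mg := L2_measurable hg.
by apply: L2_le hg _; [exact: measurableT_comp|move=> x; rewrite normr_id].
Qed.

Lemma N2_norm_fun g : N2 (fun x => `|g x|) = N2 g.
Proof.
by rewrite /ip_norm /ip2; under eq_Rintegral do rewrite -normrM -expr2 ger0_norm ?sqr_ge0// expr2.
Qed.

Lemma primitive_hoelder g f x y : L2 g -> primitive g f ->
  `|f x - f y| <= Num.sqrt `|x - y| * N2 g.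
Proof.
move=> hg pf; wlog xy : x y / y <= x.
  by move=> h; case: (leP y x) => [/h//|/ltW/h]; rewrite distrC (distrC x).
by rewrite (pf _ _ xy) (ger0_norm (_ : 0 <= x - y)) ?subr_ge0//; exact: Rintegral_seg_hoelder.
Qed.

Lemma primitive_continuous g f : L2 g -> primitive g f -> continuous f.
Proof.
move=> hg pf x; apply/cvgrPdist_lt => e e0.
have M0 : 0 < N2 g + 1 by apply: ltr_wpDl => //; exact: ip_norm_ge0.
near=> y; apply: le_lt_trans (primitive_hoelder x y hg pf) _.
have : `|x - y| < (e / (N2 g + 1)) ^+ 2.
  near: y; apply: cvgr_dist_lt => //; first by rewrite exprn_gt0// divr_gt0.
move=> h0; have h : Num.sqrt `|x - y| < e / (N2 g + 1).
  by rewrite -(@ltr_pXn2r _ 2)// ?nnegrE ?sqrtr_ge0 ?divr_ge0 ?(ltW e0) ?(ltW M0)// sqr_sqrtr.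
apply: (@le_lt_trans _ _ (Num.sqrt `|x - y| * (N2 g + 1))).
  by rewrite ler_wpM2l ?sqrtr_ge0// lerDl.
by rewrite -ltr_pdivlMr.
Unshelve. all: by end_near. Qed.

Lemma continuous_seg_itg f a b : continuous f -> seg_itg f a b.
Proof.
move=> cf; apply: continuous_compact_integrable; first exact: segment_compact.
exact: continuous_subspaceT.
Qed.

Lemma continuous_seg_bounded f a b : continuous f ->
  exists M, forall x, x \in `[a, b] -> `|f x| <= M.
Proof.
move=> cf; case: (leP a b) => [ab|ba]; last first.
  by exists 0 => x; rewrite in_itv/= => /andP[h1 h2]; have := le_lt_trans (le_trans h1 h2) ba; rewrite ltxx.
have cn : {within `[a, b], continuous (fun x => `|f x|)}.
  by apply: continuous_subspaceT => x; apply: cvg_norm; exact: cf.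
have [c _ Pc] := EVT_max ab cn.
by exists `|f c|.
Qed.

Lemma continuous_mul_seg_itg f g a b : continuous f -> L2 g ->
  mu.-integrable `[a, b] (EFin \o (fun x => f x * g x)).
Proof.
move=> cf hg; have [M fM] := continuous_seg_bounded a b cf.
have M0 : 0 <= Num.max M 0 by rewrite le_max lexx orbT.
have [] := @L2_bounded_mul _ (fun x => f x * \1_`[a, b] x) g (Num.max M 0) _ _ hg.
- apply: measurable_funM; last exact: measurable_indic.
  exact: continuous_measurable_fun.
- move=> x; rewrite indicE; case: (boolP (x \in _)) => xab; last by rewrite mulr0 normr0.
  by rewrite mulr1 le_max fM//; move: xab; rewrite inE.
move=> h _; have := L2_seg_itg a b h; apply: eq_integrable => // x xab /=.
by rewrite indicE xab mulr1.
Qed.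

(** The defect [D a b] of the product rule is additive under concatenation of segments and at most
    [sqrt (b - a) * m a b] with [m] additive as well. Cutting the segment into [n] equal pieces
    gains a factor [sqrt n], so the defect is zero. No density of smooth functions is involved. *)
Lemma primitive_product f1 g1 f2 g2 : L2 g1 -> L2 g2 ->
  primitive g1 f1 -> primitive g2 f2 ->
  primitive (fun x => f1 x * g2 x + g1 x * f2 x) (fun x => f1 x * f2 x).
Proof.
move=> hg1 hg2 p1 p2.
have c1 := primitive_continuous hg1 p1; have c2 := primitive_continuous hg2 p2.
have i12 a b := continuous_mul_seg_itg a b c1 hg2.
have i21 a b : mu.-integrable `[a, b] (EFin \o (fun x => g1 x * f2 x)).
  by have := continuous_mul_seg_itg a b c2 hg1; apply: eq_integrable => // x _; rewrite /= mulrC.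
set w := fun x => f1 x * g2 x + g1 x * f2 x.
have iw a b : mu.-integrable `[a, b] (EFin \o w).
  exact: seg_itgD.
pose D a b := f1 b * f2 b - f1 a * f2 a - \int[mu]_(x in `[a, b]) w x.
pose m a b := N2 g1 * (\int[mu]_(x in `[a, b]) `|g2 x|) + N2 g2 * (\int[mu]_(x in `[a, b]) `|g1 x|).
have ig1 a b := L2_seg_itg a b hg1. have ig2 a b := L2_seg_itg a b hg2.
have ia1 a b := L2_seg_itg a b (L2_norm_fun hg1). have ia2 a b := L2_seg_itg a b (L2_norm_fun hg2).
have D0 a b : a <= b -> `|D a b| <= Num.sqrt (b - a) * m a b.
  move=> ab.
  (* Each derivative is integrated against the increment of the other factor from an endpoint, which
     [primitive_hoelder] makes of order [sqrt (b - a)]. *)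
  have E : D a b = \int[mu]_(x in `[a, b]) ((f1 b - f1 x) * g2 x) + \int[mu]_(x in `[a, b]) ((f2 a - f2 x) * g1 x).
    under [in X in _ = X + _]eq_Rintegral do rewrite mulrBl.
    under [in X in _ = _ + X]eq_Rintegral do rewrite mulrBl.
    rewrite !RintegralB//; first last.
    - exact: seg_itgZ.
    - by have := i21 a b; apply: eq_integrable => // x _; rewrite /= mulrC.
    - exact: seg_itgZ.
    rewrite !RintegralZl// /D /w RintegralD// -(p1 _ _ ab) -(p2 _ _ ab).
    under [X in _ = _ + (_ - X)]eq_Rintegral do rewrite mulrC.
    ring.
  have B (f g h : R -> R) c : L2 g -> primitive h f -> L2 h -> c \in `[a, b] ->
      mu.-integrable `[a, b] (EFin \o (fun x => f x * g x)) ->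
      `|\int[mu]_(x in `[a, b]) ((f c - f x) * g x)| <=
      Num.sqrt (b - a) * (N2 h * \int[mu]_(x in `[a, b]) `|g x|).
    move=> hg pf hh cab ifg.
    have ii : mu.-integrable `[a, b] (EFin \o (fun x => (f c - f x) * g x)).
      have := seg_itgB (seg_itgZ (f c) (L2_seg_itg a b hg)) ifg.
      by apply: eq_integrable => // x _ /=; rewrite mulrBl.
    apply: le_trans (seg_norm_le ii) _.
    rewrite mulrA -RintegralZl//; last exact: (L2_seg_itg _ _ (L2_norm_fun hg)).
    apply: le_Rintegral => //.
    - exact: (integrable_norm ii).
    - by apply: seg_itgZ; apply: L2_seg_itg; exact: L2_norm_fun.
    move=> x xab; rewrite normrM ler_wpM2r//.
    apply: le_trans (primitive_hoelder c x hh pf) _.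
    rewrite ler_wpM2r ?ip_norm_ge0// ler_wsqrtr//.
    move: cab xab; rewrite /= !in_itv/= => /andP[ac cb] /andP[ax xb].
    by rewrite ler_norml; apply/andP; split; lra.
  rewrite E; apply: le_trans (ler_normD _ _) _; rewrite /m mulrDr; apply: lerD.
    by apply: B => //; rewrite in_itv/= ab lexx.
  apply: B => //; first by rewrite in_itv/= ab lexx.
  by have := i21 a b; apply: eq_integrable => // x _; rewrite /= mulrC.
have Dadd a b c : a <= b -> b <= c -> D a c = D a b + D b c.
  by move=> ab bc; rewrite /D (Rintegral_seg_add ab bc)//; ring.
have madd a b c : a <= b -> b <= c -> m a c = m a b + m b c.
  by move=> ab bc; rewrite /m !(Rintegral_seg_add ab bc)//; ring.
have Dn a h n : 0 <= h -> `|D a (a + n%:R * h)| <= Num.sqrt h * m a (a + n%:R * h).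
  move=> h0; elim: n => [|n IH].
    rewrite mul0r addr0; apply: le_trans (D0 _ _ (lexx _)) _.
    rewrite ler_wpM2r ?ler_wsqrtr ?subrr//.
    by rewrite addr_ge0// mulr_ge0 ?ip_norm_ge0// Rintegral_ge0.
  have e1 : a <= a + n%:R * h by rewrite lerDl mulr_ge0 ?ler0n.
  have e2 : a + n%:R * h <= a + n.+1%:R * h by rewrite lerD2l ler_wpM2r// ler_nat.
  rewrite (Dadd _ _ _ e1 e2) (madd _ _ _ e1 e2) mulrDr.
  apply: le_trans (ler_normD _ _) _; apply: lerD => //.
  have := D0 _ _ e2; rewrite -natr1 (_ : a + (n%:R + 1) * h - (a + n%:R * h) = h)//; ring.
move=> a b ab; apply/eqP; rewrite -subr_eq0; apply/eqP.
rewrite -[LHS]/(D a b).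
have m0 : 0 <= m a b by rewrite addr_ge0// mulr_ge0 ?ip_norm_ge0// Rintegral_ge0.
have Dle n : `|D a b| ^+ 2 * n.+1%:R <= (b - a) * m a b ^+ 2.
  have n0 : 0 < n.+1%:R :> R by rewrite ltr0n.
  have h0 : 0 <= (b - a) / n.+1%:R by rewrite divr_ge0 ?subr_ge0// ler0n.
  have := Dn a _ n.+1 h0; rewrite mulrC divfK ?gt_eqF// addrC subrK.
  rewrite -(@ler_pXn2r _ 2)// ?nnegrE ?mulr_ge0 ?sqrtr_ge0// exprMn sqr_sqrtr//.
  by rewrite mulrAC ler_pdivlMr.
apply/eqP; apply: contraT => Dn0.
have Dp : 0 < `|D a b| ^+ 2 by rewrite exprn_gt0// normr_gt0.
have := Dle (Num.truncn ((b - a) * m a b ^+ 2 / `|D a b| ^+ 2)).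
rewrite leNgt [_ * _.+1%:R]mulrC -ltr_pdivrMr// => /negP; case.
have : 0 <= (b - a) * m a b ^+ 2 / `|D a b| ^+ 2.
  by rewrite divr_ge0 ?(ltW Dp)// mulr_ge0 ?sqr_ge0// subr_ge0.
by move=> /truncn_itv/andP[].
Qed.

(** Were the bound to fail by [c > 0] at [x], the fundamental theorem for [f ^+ 2] would keep
    [f ^+ 2 >= c] on the whole half-line left of [x], contradicting square integrability. *)
Lemma ac_pair_sup f g x : ac_pair f g -> f x ^+ 2 <= 2 * (N2 f * N2 g).
Proof.
move=> [hf hg pf]; rewrite leNgt; apply/negP => lt.
set c := f x ^+ 2 - 2 * (N2 f * N2 g); have c0 : 0 < c by rewrite subr_gt0.
have ifg := L2_mul (L2_norm_fun hf) (L2_norm_fun hg).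
have fy y : y <= x -> c <= f y ^+ 2.
  move=> yx; have := primitive_product hg hg pf pf yx; rewrite /c -!expr2 => e.
  have i2 : mu.-integrable `[y, x] (EFin \o (fun z => f z * g z + g z * f z)).
    apply: itg_seg; apply: itgD; exact: L2_mul.
  have h : `|\int[mu]_(z in `[y, x]) (f z * g z + g z * f z)| <= 2 * (N2 f * N2 g).
    apply: le_trans (seg_norm_le i2) _.
    apply: (@le_trans _ _ (2 * ip2 (fun z => `|f z|) (fun z => `|g z|))); last first.
      rewrite ler_pM2l//; apply: le_trans (ler_norm _) _.
      rewrite -(N2_norm_fun f) -(N2_norm_fun g).
      by apply: (ip_cauchy_schwarz ip2P); exact: L2_norm_fun.
    rewrite /ip2 -RintegralZl// Rintegral_mkcond; apply: le_Rintegral => //.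
    - by apply: seg_itg_patch; exact: (integrable_norm i2).
    - exact: itgZ.
    move=> z _; rewrite patchE; case: (_ \in _); last by rewrite !mulr_ge0.
    by apply: le_trans (ler_normD _ _) _; rewrite !normrM; lra.
  move: h; rewrite -e ler_norml => /andP[h1 h2]; lra.
have lower n : n%:R * c <= N2 f ^+ 2.
  have [mf f2] := proj1 (L2P f) hf.
  have xn : x - n%:R <= x by rewrite gerBl.
  rewrite (ip_normE ip2P)// /ip2.
  apply: (@le_trans _ _ (\int[mu]_(z in `[x - n%:R, x]) c)).
    rewrite Rintegral_cst//= lebesgue_measure_itv/= lte_fin mulrC ler_pM2l//.
    by case: ltP => h; [rewrite /= opprB addrC subrK|rewrite /=; lra].
  rewrite Rintegral_mkcond; apply: le_Rintegral => //.
  - by apply: seg_itg_patch; apply: continuous_seg_itg => z; exact: cvg_cst.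
  move=> z _; rewrite patchE; case: ifPn => [|_]; last by rewrite -expr2 sqr_ge0.
  by rewrite inE/= in_itv/= -expr2 => /andP[_ /fy].
have := lower (Num.truncn (N2 f ^+ 2 / c)).+1.
rewrite leNgt -ltr_pdivrMr// => /negP; case.
by have /truncn_itv/andP[] : 0 <= N2 f ^+ 2 / c by rewrite divr_ge0 ?sqr_ge0// ltW.
Qed.

Lemma ac_pair_bounded f g : ac_pair f g ->
  forall x, `|f x| <= Num.sqrt (2 * (N2 f * N2 g)).
Proof.
move=> h x; rewrite -sqrtr_sqr ler_wsqrtr//; exact: ac_pair_sup.
Qed.

Lemma ac_pair_measurable f g : ac_pair f g -> measurable_fun setT f.
Proof. by move=> [/L2_measurable]. Qed.

Lemma ac_pair_continuous f g : ac_pair f g -> continuous f.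
Proof. by move=> [_ hg pf]; exact: primitive_continuous hg pf. Qed.

Lemma ac_pair_product f1 g1 f2 g2 : ac_pair f1 g1 -> ac_pair f2 g2 ->
  ac_pair (fun x => f1 x * f2 x) (fun x => f1 x * g2 x + g1 x * f2 x).
Proof.
move=> h1 h2; have [hf1 hg1 p1] := h1; have [hf2 hg2 p2] := h2; split.
- by have [] := L2_bounded_mul (ac_pair_measurable h1) (ac_pair_bounded h1) hf2.
- apply: L2D; first by have [] := L2_bounded_mul (ac_pair_measurable h1) (ac_pair_bounded h1) hg2.
  have [h _] := L2_bounded_mul (ac_pair_measurable h2) (ac_pair_bounded h2) hg1.
  by under eq_fun do rewrite mulrC.
- exact: primitive_product.
Qed.

Lemma ac_pair0 : ac_pair (0 : R -> R) 0.
Proof.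
split; [exact: L20|exact: L20|move=> a b _].
by rewrite subrr Rintegral_cst// mul0r.
Qed.

Lemma ac_pairD f1 g1 f2 g2 : ac_pair f1 g1 -> ac_pair f2 g2 -> ac_pair (f1 + f2) (g1 + g2).
Proof.
move=> [hf1 hg1 p1] [hf2 hg2 p2]; split; [exact: L2D|exact: L2D|move=> a b ab].
rewrite [RHS]RintegralD//; try exact: L2_seg_itg.
rewrite -p1// -p2//.
by rewrite -[(f1 + f2) b]/(f1 b + f2 b) -[(f1 + f2) a]/(f1 a + f2 a); ring.
Qed.

Lemma ac_pairZ c f g : ac_pair f g -> ac_pair (c *: f) (c *: g).
Proof.
move=> [hf hg p]; split; [exact: L2Z|exact: L2Z|move=> a b ab].
rewrite [RHS]RintegralZl//; last exact: L2_seg_itg.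
by rewrite -p// mulrBr.
Qed.

(** Cut off to [[-n, n]], [h] is integrable with an identically vanishing primitive, and Lebesgue's
    differentiation theorem recovers it almost everywhere as the derivative of that primitive. *)
Lemma seg_integral0_ae0 h : (forall a b, seg_itg h a b) ->
  (forall a b, \int[mu]_(x in `[a, b]) h x = 0) -> {ae mu, forall x, h x = 0}.
Proof.
move=> ih h0.
pose hn (n : nat) x := h x * \1_`[- n%:R, n%:R] x.
have ihn n : itg (hn n).
  have := seg_itg_patch (ih (- n%:R) n%:R); apply: eq_integrable => // x _ /=.
  by rewrite patchE /hn indicE; case: (x \in _); rewrite ?mulr1 ?mulr0.
have z n : {ae mu, forall x, hn n x = 0}.
  have iy y : mu.-integrable `]-oo, y] (EFin \o hn n).
    by apply: integrableS (ihn n).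
  have := integrable_locally measurableT (ihn n); rewrite patch_setT => li.
  have := FTC1Ny iy li.
  apply: aeS => x [_ <-].
  rewrite (_ : (fun _ => _) = cst 0) ?derive1_cst//; apply/funext => y.
  rewrite Rintegral_mkcond -[RHS](h0 (- n%:R) (Num.min y n%:R)) [RHS]Rintegral_mkcond.
  apply: eq_Rintegral => t _; rewrite !patchE /hn indicE !mem_setE !in_itv/= le_min.
  by case: (t <= y); case: (- n%:R <= t); case: (t <= n%:R); rewrite /= ?mulr1 ?mulr0.
have /ae_foralln : forall n, {ae mu, forall x, hn n x = 0} by [].
apply: aeS => x /(_ (Num.truncn `|x|).+1).
have /truncn_itv/andP[_ /ltW] : 0 <= `|x| by [].
rewrite ler_norml => /andP[x1 x2].
by rewrite /hn indicE mem_setE in_itv/= x1 x2 mulr1.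
Qed.

(** Both primitives are continuous, so they agree everywhere; then the derivatives have equal
    integrals over every segment. *)
Lemma primitive_unique g g' f f' : L2 g -> L2 g' -> primitive g f -> primitive g' f' ->
  f = f' %[ae mu] -> g = g' %[ae mu].
Proof.
move=> hg hg' p p' ff'.
have E : f = (fun x => f' x).
  apply/funext => x; apply/eqP; rewrite -subr_eq0; apply: contraT => nz.
  have cd : continuous (fun x => f x - f' x).
    move=> y; apply: cvgB; first exact: (primitive_continuous hg p).
    exact: (primitive_continuous hg' p').
  have : \forall y \near x, f y - f' y != 0.
    have nz0 : 0 < `|f x - f' x| by rewrite normr_gt0.
    near=> y; have : `|(f x - f' x) - (f y - f' y)| < `|f x - f' x|.
      by near: y; apply: cvgr_dist_lt => //; exact: cd.
    by apply: contraTneq => ->; rewrite subr0 ltxx.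
  move=> [e /= e0 he].
  have [N [mN N0 sN]] := ae_null ff'.
  have : (mu `](x - e)%R, (x + e)%R[%classic <= mu N)%E.
    apply: le_measure; rewrite ?inE//.
    move=> y; rewrite /= in_itv/= => /andP[y1 y2]; apply: contrapT => Ny.
    have := he y; rewrite /ball_/= ltr_norml => /(_ _)/negP; case.
      by apply/andP; split; lra.
    by rewrite sN// subrr.
  rewrite N0 lebesgue_measure_itv/= lte_fin (_ : x - e < x + e); last by lra.
  by rewrite -EFinD lee_fin => h; exfalso; lra.
suff: {ae mu, forall x, (g - g') x = 0}.
  by apply: aeS => x /eqP; rewrite subr_eq0 => /eqP.
apply: seg_integral0_ae0; first by move=> a b; apply: L2_seg_itg; exact: L2B.
move=> a b; case: (leP a b) => ab; last by rewrite set_itv_ge ?Rintegral_set0// bnd_simp -ltNge.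
rewrite [LHS]RintegralB//; try exact: L2_seg_itg.
by rewrite -(p _ _ ab) -(p' _ _ ab) E subrr.
Unshelve. all: by end_near. Qed.

End AbsoluteContinuity.

(** * Smooth bump functions and weak derivatives *)

Section Calculus.
Context {R : realType}.
Implicit Types f g : R -> R.

(** This settles the derivative of [flat_exp] at the origin, where no differentiation rule
    applies. *)
Lemma is_derive_quadratic f (x l C : R) :
  (forall h, `|f (x + h) - f x - h * l| <= C * h ^+ 2) -> is_derive x (1 : R) f l.
Proof.
move=> fC; apply/is_derive1_caratheodory.
exists (fun z => if z == x then l else (f z - f x) / (z - x)); split.
- move=> z; case: eqVneq => [->|zx]; first by rewrite !subrr mulr0.
  by rewrite divfK// subr_eq0.
- apply/cvgrPdist_lt => e e0; rewrite eqxx.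
  have C0 : 0 < `|C| + 1 by rewrite ltr_wpDl.
  near=> z; case: eqVneq => [_|zx]; first by rewrite subrr normr0.
  have zx0 : 0 < `|z - x| by rewrite normr_gt0 subr_eq0.
  have := fC (z - x); rewrite [x + (z - x)]addrC subrK => h.
  have zxe : `|z - x| < e / (`|C| + 1).
    rewrite distrC; near: z; apply: cvgr_dist_lt; first exact: cvg_id.
    by rewrite divr_gt0.
  rewrite -(ltr_pM2r zx0) -normrM mulrBl divfK; last by rewrite subr_eq0.
  rewrite distrC (mulrC l); apply: le_lt_trans h _.
  rewrite -(real_normK (num_real (z - x))) expr2 mulrA ltr_pM2r//.
  rewrite ltr_pdivlMr// in zxe; apply: le_lt_trans zxe.
  by rewrite mulrC ler_wpM2l//; apply: le_trans (ler_norm C) _; rewrite lerDl.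
- by rewrite eqxx.
Unshelve. all: by end_near. Qed.

Lemma is_derive_mul f g (x a b : R) : is_derive x (1 : R) f a -> is_derive x (1 : R) g b ->
  is_derive x (1 : R) (fun y => f y * g y) (a * g x + f x * b).
Proof.
move=> hf hg; apply: is_derive_eq (is_deriveM hf hg) _.
by rewrite /GRing.scale/= addrC mulrC.
Qed.

Lemma is_derive_add f g (x a b : R) : is_derive x (1 : R) f a -> is_derive x (1 : R) g b ->
  is_derive x (1 : R) (fun y => f y + g y) (a + b).
Proof. by move=> hf hg; exact: is_deriveD. Qed.

Lemma is_derive_derive1 f (x l : R) : is_derive x (1 : R) f l -> f^`()%classic x = l.
Proof. by move=> [_ <-]; rewrite derive1E. Qed.

Lemma is_derive_continuous f (x l : R) : is_derive x (1 : R) f l -> {for x, continuous f}.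
Proof. by move=> [/derivable1_diffP/differentiable_continuous]. Qed.

Lemma primitive_of_derive f g : (forall x, is_derive x (1 : R) f (g x)) ->
  continuous g -> primitive g f.
Proof.
move=> fg cg a b; rewrite le_eqVlt => /predU1P[->|ab].
  by rewrite set_itv1 Rintegral_set1 subrr.
have cf x : {for x, continuous f} by exact: (is_derive_continuous (fg x)).
rewrite /Rintegral (@continuous_FTC2 _ g f a b)//=.
- exact: continuous_subspaceT.
- split; first by move=> x _; have [] := fg x.
  + by apply: cvg_at_right_filter; exact: cf.
  + by apply: cvg_at_left_filter; exact: cf.
- by move=> x _; exact: is_derive_derive1.
Qed.

Lemma derive_of_primitive f g : continuous g -> primitive g f ->
  forall x, is_derive x (1 : R) f (g x).
Proof.
move=> cg pg x.
have ig : (@lebesgue_measure R).-integrable `[x - 1, x + 1] (EFin \o g).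
  exact: continuous_seg_itg.
pose F y := \int[@lebesgue_measure R]_(t in `[x - 1, y]) g t.
have x1 : x < x + 1 by rewrite ltrDl.
have x2 : x - 1 < x by rewrite gtrBl.
have [dF F'] : derivable F x 1 /\ F^`()%classic x = g x.
  exact: (continuous_FTC1_closed x1 ig x2 (cg x)).
have : is_derive x 1 (fun y => F y + cst (f (x - 1)) y) (g x).
  rewrite -[g x]addr0; apply: (@is_derive_add F (fun=> f (x - 1)) x (g x) 0).
  by split; [exact: dF|rewrite -derive1E].
apply: near_eq_is_derive; near=> y.
rewrite /F -pg ?subrK//.
by apply: ltW; near: y; exact: lt_nbhsr.
Unshelve. all: by end_near. Qed.

Lemma is_derive_const (c x : R) : is_derive x (1 : R) (fun _ : R => c) 0.
Proof. exact: is_derive_cst. Qed.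

Lemma is_derive_affine (c d x : R) : is_derive x (1 : R) (fun y => c * y + d) c.
Proof.
have := is_derive_mul (is_derive_const c x) (is_derive_id x (1 : R)).
rewrite mul0r add0r mulr1 => h.
by have := is_derive_add h (is_derive_const d x); rewrite addr0.
Qed.

Lemma is_derive_exp f (x a : R) n : is_derive x (1 : R) f a ->
  is_derive x (1 : R) (fun y => f y ^+ n) (n%:R * f x ^+ n.-1 * a).
Proof.
move=> fa; elim: n => [|n IH]; first by rewrite !mul0r; exact: is_derive_const.
rewrite (_ : (fun y => f y ^+ n.+1) = (fun y => f y * f y ^+ n)); last first.
  by apply/funext => y; rewrite exprS.
apply: is_derive_eq (is_derive_mul fa IH) _.
by case: n {IH} => [|n]; rewrite ?expr0 -?natr1 ?exprS /=; ring.
Qed.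

(** The derivative is asked to exist rather than computed, so that products and affine substitutions
    are handled by induction on the order, without formulas for iterated derivatives. *)
Fixpoint smooth_upto k f : Prop :=
  if k is k'.+1 then
    exists2 f', (forall x, is_derive x (1 : R) f (f' x)) & smooth_upto k' f'
  else True.

Lemma smooth_le k f : smooth_upto k.+1 f -> smooth_upto k f.
Proof. by elim: k f => // k IH f [f' df sf]; exists f' => //; exact: IH. Qed.

Lemma smoothD k f g : smooth_upto k f -> smooth_upto k g -> smooth_upto k (fun x => f x + g x).
Proof.
elim: k f g => // k IH f g [f' df hf] [g' dg hg].
exists (fun x => f' x + g' x); last exact: IH.
by move=> x; exact: is_derive_add.
Qed.

Lemma smoothM k f g : smooth_upto k f -> smooth_upto k g -> smooth_upto k (fun x => f x * g x).
Proof.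
elim: k f g => // k IH f g hf hg.
have [f' df sf] := hf; have [g' dg sg] := hg.
exists (fun x => f' x * g x + f x * g' x); first by move=> x; exact: is_derive_mul.
by apply: smoothD; apply: IH => //; exact: smooth_le.
Qed.

Lemma smooth_cst k c : smooth_upto k (fun _ : R => c).
Proof.
by elim: k c => // k IH c; exists (fun=> 0) => // x; exact: is_derive_const.
Qed.

Lemma smooth_affine k f c d : smooth_upto k f -> smooth_upto k (fun x => f (c * x + d)).
Proof.
elim: k f => // k IH f [f' df sf].
exists (fun x => f' (c * x + d) * c).
  by move=> x; apply: (@is_derive1_comp _ f (fun x => c * x + d)) => //; exact: is_derive_affine.
by apply: smoothM; [exact: IH|exact: smooth_cst].
Qed.

Lemma smooth_continuous f : smooth_upto 1 f -> continuous f.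
Proof. by move=> [f' df _] x; exact: is_derive_continuous (df x). Qed.

Lemma smooth_derive1 k f : smooth_upto k.+1 f -> smooth_upto k f^`()%classic.
Proof.
move=> [f' df sf]; rewrite (_ : f^`()%classic = f')//.
by apply/funext => x; exact: is_derive_derive1.
Qed.

Lemma smooth_derivable f : (forall k, smooth_upto k f) ->
  forall n x, derivable (derive1n n f) x 1.
Proof.
move=> sf n; elim: n f sf => [|n IH] f sf x; first by have [f' /(_ x)[]] := sf 1%N.
by rewrite derive1Sn; apply: IH => k; exact: smooth_derive1.
Qed.

(** The classical flat function is the case [n = 0]; the powers of [1/x] make the family closed
    under differentiation. *)
Definition flat_exp n (x : R) := if 0 < x then x^-1 ^+ n * expR (- x^-1) else 0.

(** One term of the exponential series at [1/x], that of order [n + 2], is kept; its two extra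
    powers leave the factor [x ^+ 2] that [is_derive_quadratic] asks for. *)
Lemma flat_exp_le n (x : R) : 0 < x -> x^-1 ^+ n * expR (- x^-1) <= (n.+2)`!%:R * x ^+ 2.
Proof.
move=> x0; have y0 : 0 < x^-1 by rewrite invr_gt0.
have F0 : 0 < (n.+2)`!%:R :> R by rewrite ltr0n fact_gt0.
have := expR_ge1Dxn n.+1 (ltW y0) => h.
have {h} h : x^-1 ^+ n.+2 / (n.+2)`!%:R <= expR x^-1 by apply: le_trans h; rewrite lerDr.
rewrite expRN -ler_pdivlMr ?invr_gt0 ?expR_gt0// invrK.
rewrite ler_pdivrMr// in h.
rewrite -(ler_pM2r (exprn_gt0 2 y0)) -exprD addn2; apply: le_trans h _.
rewrite le_eqVlt; apply/orP; left; apply/eqP; field.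
by rewrite gt_eqF.
Qed.

Lemma is_derive_flat_exp n x :
  is_derive x (1 : R) (flat_exp n) (- n%:R * flat_exp n.+1 x + flat_exp n.+2 x).
Proof.
case: (ltgtP 0 x) => x0.
- pose g y := (y^-1 : R) ^+ n * expR (- y^-1).
  have dV : is_derive x (1 : R) (fun y => y^-1) (- x^-1 ^+ 2).
    apply: is_derive_eq (is_deriveV (lt0r_neq0 x0) (is_derive_id x (1 : R))) _.
    by rewrite /GRing.scale/= mulr1 exprVn.
  have dg : is_derive x (1 : R) g (- n%:R * flat_exp n.+1 x + flat_exp n.+2 x).
    have dE : is_derive x (1 : R) (fun y => expR (- y^-1)) (expR (- x^-1) * (x^-1 ^+ 2)).
      apply: (@is_derive1_comp _ expR (fun y => - y^-1)) => //.
      by apply: is_derive_eq (is_deriveN dV) _; rewrite opprK.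
    apply: is_derive_eq (is_derive_mul (is_derive_exp n dV) dE) _.
    rewrite /flat_exp x0.
    by case: n {g} => [|n]; rewrite /= !exprS ?expr0; ring.
  apply: near_eq_is_derive dg; near=> y; rewrite /flat_exp ifT//.
  by near: y; exact: lt_nbhsr.
- rewrite /flat_exp !ltNge (ltW x0)/= mulr0 addr0.
  apply: near_eq_is_derive (is_derive_cst (0 : R) x (1 : R)); near=> y.
  rewrite /= ltNge (_ : y <= 0)//; apply: ltW.
  by near: y; exact: lt_nbhsl.
- rewrite -x0 /flat_exp ltxx mulr0 addr0.
  apply: (@is_derive_quadratic _ _ _ (n.+2)`!%:R) => h.
  rewrite add0r ltxx mulr0 !subr0; case: ifPn => h0; last first.
    by rewrite normr0 mulr_ge0 ?ler0n ?sqr_ge0.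
  rewrite ger0_norm; first exact: flat_exp_le.
  by rewrite mulr_ge0 ?expR_ge0// exprn_ge0// invr_ge0 ltW.
Unshelve. all: by end_near. Qed.

Lemma smooth_flat_exp k n : smooth_upto k (flat_exp n).
Proof.
elim: k n => // k IH n.
exists (fun x => - n%:R * flat_exp n.+1 x + flat_exp n.+2 x); first exact: is_derive_flat_exp.
by apply: smoothD => //; apply: smoothM => //; exact: smooth_cst.
Qed.

(** The support stays in [[a, b]] for all [n], while the factor [n] steepens the flanks so that the
    values inside tend to 1. *)
Definition bump n (a b x : R) :=
  flat_exp 0 (n%:R * (x - a)) * flat_exp 0 (n%:R * (b - x)).

Lemma smooth_bump k n a b : smooth_upto k (bump n a b).
Proof.
rewrite /bump; apply: smoothM.
  have := smooth_affine n%:R (- (n%:R * a)) (smooth_flat_exp k 0).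
  by congr smooth_upto; apply/funext => x; congr flat_exp; ring.
have := smooth_affine (- n%:R) (n%:R * b) (smooth_flat_exp k 0).
by congr smooth_upto; apply/funext => x; congr flat_exp; ring.
Qed.

Lemma flat_exp0_bound (x : R) : 0 <= flat_exp 0 x <= 1.
Proof.
rewrite /flat_exp; case: ifPn => x0; last by rewrite lexx ler01.
by rewrite expr0 mul1r expR_ge0/= -expR0 ler_expR oppr_le0 invr_ge0 ltW.
Qed.

Lemma bump_bound n a b x : 0 <= bump n a b x <= 1.
Proof.
have /andP[h1 h2] := flat_exp0_bound (n%:R * (x - a)).
have /andP[h3 h4] := flat_exp0_bound (n%:R * (b - x)).
by rewrite mulr_ge0//= mulr_ile1.
Qed.

Lemma bump_out n a b x : x \notin `]a, b[ -> bump n a b x = 0.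
Proof.
rewrite in_itv/= negb_and -!leNgt /bump /flat_exp => /orP[xa|xb].
  by rewrite ifF ?mul0r//; apply/negbTE; rewrite -leNgt mulr_ge0_le0 ?ler0n// subr_le0.
by rewrite [X in _ * X]ifF ?mulr0//; apply/negbTE; rewrite -leNgt mulr_ge0_le0 ?ler0n// subr_le0.
Qed.

Lemma bump_gt0 a b x : x \in `]a, b[ -> 0 < bump 1 a b x.
Proof.
rewrite in_itv/= => /andP[ax xb]; rewrite /bump /flat_exp !mul1r !subr_gt0 ax xb.
by rewrite mulr_gt0// expR_gt0.
Qed.

Lemma bump_cvg a b x : bump n a b x @[n --> \oo] --> (\1_`]a, b[ x : R).
Proof.
rewrite indicE; case: (boolP (x \in `]a, b[)) => xab; last first.
  rewrite memNset; last exact/negP.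
  by under eq_fun do rewrite bump_out//; exact: cvg_cst.
rewrite mem_set//= -[1%:R]mulr1.
have E (z : R) : 0 < z -> flat_exp 0 (n%:R * z) @[n --> \oo] --> (1 : R).
  move=> z0.
  have c : - ((n%:R : R)^-1 * z^-1) @[n --> \oo] --> (0 : R).
    rewrite -oppr0 -(mul0r z^-1); apply: cvgN; apply: cvgMl.
    by rewrite -(cvg_shiftS (fun n => (n%:R : R)^-1)); exact: cvg_harmonic.
  have := continuous_cvg _ (@continuous_expR R 0) c; rewrite expR0 => hc.
  apply: (cvg_trans _ (hc _)); apply: near_eq_cvg; near=> n; rewrite /flat_exp expr0 mul1r invfM mulr_gt0//.
  by rewrite ltr0n; near: n; exact: nbhs_infty_gt.
move: xab; rewrite in_itv/= => /andP[ax xb].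
by apply: cvgM; apply: E; rewrite subr_gt0.
Unshelve. all: by end_near. Qed.

Lemma continuous_bump n a b : continuous (bump n a b).
Proof. exact: (smooth_continuous (smooth_bump 1 n a b)). Qed.

Lemma test_function_of_smooth f A : (forall k, smooth_upto k f) ->
  (forall x, A <= `|x| -> f x = 0) -> test_function f.
Proof.
move=> sf fA; split; first exact: smooth_derivable.
apply: (@subclosed_compact _ _ `[- A, A]%classic); [exact: closed_closure|exact: segment_compact|].
rewrite [X in _ `<=` X](closure_id _).1; last exact: itv_closed.
apply: closure_subset => x /= fx; rewrite in_itv/=.
have : `|x| < A by rewrite ltNge; apply: contra fx => /fA ->.
by rewrite ltr_norml => /andP[/ltW -> /ltW ->].
Qed.

Lemma test_function_support f : test_function f ->
  exists2 A, 0 < A & forall x, A <= `|x| -> f x = 0.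
Proof.
move=> [_ /compact_bounded[M [_ hM]]].
exists (`|M| + 2); first by rewrite ltr_wpDl.
move=> x xA; apply/eqP; apply: contraT => fx.
have := hM (`|M| + 1) _ x (@subset_closure _ [set z | f z != 0] x fx).
rewrite /= => /(_ _)/(le_trans xA); rewrite lerD2l => h; exfalso.
have : (2 <= 1 :> R) by apply: h; rewrite (le_lt_trans (ler_norm M))// ltrDl.
by rewrite leNgt ltr1n.
Qed.

End Calculus.

(** * Weak derivatives and the continuous representative *)

Section WeakDerivatives.
Context {R : realType}.
Local Notation mu := (@lebesgue_measure R).
Local Notation itg f := (lebesgue_integrable f).
Local Notation N2 := (ip_norm ip2).
Implicit Types f g h phi : R -> R.

Lemma Rintegral_dominated (f : nat -> R -> R) g h :
  (forall n, measurable_fun setT (f n)) -> measurable_fun setT g ->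
  {ae mu, forall x, f n x @[n --> \oo] --> g x} -> itg h ->
  (forall n x, `|f n x| <= h x) ->
  itg g /\ \int[mu]_x f n x @[n --> \oo] --> \int[mu]_x g x.
Proof.
move=> mf mg fg ih fh.
have fg' : {ae mu, forall x, setT x -> (f n x)%:E @[n --> \oo] --> (g x)%:E}.
  by apply: aeS fg => x c _; apply: cvg_EFin => //; exact: nearW.
have fh' : {ae mu, forall x, forall n, setT x -> (`|(f n x)%:E| <= (h x)%:E)%E}.
  by apply: aeW => x n _; rewrite lee_fin.
have mf' n : measurable_fun setT (EFin \o f n) by exact/measurable_EFinP.
have mg' : measurable_fun setT (EFin \o g) by exact/measurable_EFinP.
have [ig _ cv] := @dominated_convergence _ _ _ mu setT measurableT
  (fun n => EFin \o f n) _ _ mf' mg' fg' ih fh'.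
split => //.
have If n : itg (f n).
  by apply: itg_le ih (fh n).
have E n : (\int[mu]_x (f n x)%:E)%E = (\int[mu]_x f n x)%:E.
  by rewrite fineK//; exact: (integrable_fin_num measurableT (If n)).
have Eg : (\int[mu]_x (EFin \o g) x)%E = (\int[mu]_x g x)%:E.
  by rewrite fineK//; exact: (integrable_fin_num measurableT ig).
move: cv; rewrite Eg => cv; apply: fine_cvg; apply: cvg_trans cv.
by apply: near_eq_cvg; apply: nearW => n /=; rewrite E.
Qed.

Lemma Rintegral_outside f A : (forall x, A <= `|x| -> f x = 0) ->
  \int[mu]_x f x = \int[mu]_(x in `[- A, A]) f x.
Proof.
move=> fA; rewrite [RHS]Rintegral_mkcond; apply: eq_Rintegral => x _.
rewrite patchE; case: ifPn => //; rewrite notin_setE/= in_itv/= -ler_norml => /negP.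
by rewrite -ltNge => /ltW/fA.
Qed.

Lemma continuous_outside_L2 f A : continuous f -> (forall x, A <= `|x| -> f x = 0) -> L2 f.
Proof.
move=> cf fA; have [M fM] := continuous_seg_bounded (- A) A cf.
apply: L2_le (L2Z M (L2_indic (- A) A)) _; first exact: continuous_measurable_fun.
move=> x; rewrite -[(_ *: _) x]/(M * \1_`[- A, A] x) indicE.
case: (boolP (x \in _)) => [|]; rewrite ?inE ?notin_setE/= in_itv/= -ler_norml => xA.
  by rewrite mulr1; apply: le_trans (fM x _) (ler_norm M); rewrite in_itv/= -ler_norml.
by move/negP: xA; rewrite -ltNge => /ltW/fA ->; rewrite normr0.
Qed.

Lemma test_function_derive phi : test_function phi ->
  forall x, is_derive x (1 : R) phi (phi^`()%classic x).
Proof. by move=> [d _] x; apply: DeriveDef; [exact: (d 0%N x)|rewrite derive1E]. Qed.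

Lemma test_function_derive_continuous phi : test_function phi -> continuous phi^`()%classic.
Proof. by move=> [d _] x; have /derivable1_diffP/differentiable_continuous := d 1%N x. Qed.

Lemma test_function_continuous phi : test_function phi -> continuous phi.
Proof. by move=> tp x; exact: is_derive_continuous (test_function_derive tp x). Qed.

Lemma test_function_support2 phi : test_function phi ->
  exists A, [/\ 0 < A, forall x, A <= `|x| -> phi x = 0 &
    forall x, A <= `|x| -> phi^`()%classic x = 0].
Proof.
move=> tp; have [A A0 pA] := test_function_support tp.
(* The radius is enlarged by one so that [phi] vanishes near every point in question, and its
   derivative with it. *)
exists (A + 1); split; first by rewrite addr_gt0.
- by move=> x xA; apply: pA; apply: le_trans xA; rewrite lerDl.
- move=> x xA; apply: is_derive_derive1.
  apply: near_eq_is_derive (is_derive_const 0 x); near=> y.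
  rewrite pA//; have : `|x - y| < 1 by near: y; exact: cvgr_dist_lt.
  by have := ler_normD (x - y) y; rewrite subrK; lra.
Unshelve. all: by end_near. Qed.

Lemma test_function_L2 phi : test_function phi -> L2 phi /\ L2 phi^`()%classic.
Proof.
move=> tp; have [A [_ pA dA]] := test_function_support2 tp; split.
  exact: continuous_outside_L2 (test_function_continuous tp) pA.
exact: continuous_outside_L2 (test_function_derive_continuous tp) dA.
Qed.

(** Integration by parts is the product rule on a segment at whose ends the test function
    vanishes. *)
Lemma primitive_weak f g : L2 g -> primitive g f -> weak_derivative f g.
Proof.
move=> hg pf phi tp; have [A [A0 pA dA]] := test_function_support2 tp.
have [_ ldp] := test_function_L2 tp.
have pp : primitive phi^`()%classic phi.
  apply: primitive_of_derive; first exact: test_function_derive.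
  exact: test_function_derive_continuous.
have AA : - A <= A by apply: (@le_trans _ _ 0); rewrite ?oppr_le0 ltW.
have := primitive_product hg ldp pf pp AA.
rewrite !pA ?normrN ?ger0_norm ?(ltW A0)// !mulr0 subrr => E.
rewrite (@Rintegral_outside _ A); last by move=> x /dA ->; rewrite mulr0.
rewrite (@Rintegral_outside _ A); last by move=> x /pA ->; rewrite mulr0.
apply/eqP; rewrite -subr_eq0 opprK -RintegralD//.
- by rewrite -E.
- exact: continuous_mul_seg_itg (primitive_continuous hg pf) ldp.
- have := continuous_mul_seg_itg (- A) A (test_function_continuous tp) hg.
  by apply: eq_integrable => // x _; rewrite /= mulrC.
Qed.

Lemma test_function_bump n (a b : R) : test_function (bump n a b).
Proof.
apply: (@test_function_of_smooth _ _ (`|a| + `|b|)); first by move=> k; exact: smooth_bump.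
move=> x xA; apply: bump_out; rewrite in_itv/= negb_and -!leNgt.
have := ler_norm a; have := ler_norm b; have := ler_norm (- a); have := ler_norm (- b).
rewrite !normrN; move: xA; case: (ler0P x) => x0 h1 h2 h3 h4 h5.
  by apply/orP; left; have := normr_ge0 b; lra.
by apply/orP; right; have := normr_ge0 a; lra.
Qed.

Lemma seg_itg_mul_bump h n a b : (forall a b, seg_itg h a b) -> itg (fun x => h x * bump n a b x).
Proof.
move=> ih; have i1 := seg_itg_patch (ih a b).
apply: (@itg_le _ _ (fun x => `|(h \_ `[a, b]) x|)).
- have -> : (fun x => h x * bump n a b x) = (fun x => (h \_ `[a, b]) x * bump n a b x).
    apply/funext => x; rewrite patchE; case: (boolP (x \in _)) => //.
    rewrite notin_setE/= in_itv/= => /negP xab; rewrite mul0r bump_out ?mulr0// in_itv/=.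
    by apply: contra xab => /andP[/ltW -> /ltW ->].
  apply: measurable_funM; first exact: itg_measurable.
  by apply: continuous_measurable_fun; exact: continuous_bump.
- exact: itg_norm.
- move=> x; have /andP[b0 b1] := bump_bound n a b x.
  rewrite patchE; case: (boolP (x \in _)) => xab.
    by rewrite normrM (ger0_norm b0) ler_piMr.
  rewrite notin_setE/= in_itv/= in xab; rewrite bump_out ?mulr0 ?normr0// in_itv/=.
  by move/negP: xab; apply: contra => /andP[/ltW -> /ltW ->].
Qed.

(** The bumps converge boundedly to the indicator of the open segment, whose end points carry no
    mass. *)
Lemma bump_integral0 h : (forall a b, seg_itg h a b) ->
  (forall n a b, \int[mu]_x (h x * bump n a b x) = 0) ->
  forall a b, \int[mu]_(x in `[a, b]) h x = 0.
Proof.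
move=> ih h0 a b.
have i1 := seg_itg_patch (ih a b).
have dom n x : `|h x * bump n a b x| <= `|(h \_ `[a, b]) x|.
  have /andP[b0 b1] := bump_bound n a b x.
  rewrite patchE; case: (boolP (x \in _)) => xab.
    by rewrite normrM (ger0_norm b0) ler_piMr.
  rewrite notin_setE/= in_itv/= in xab; rewrite bump_out ?mulr0 ?normr0// in_itv/=.
  by move/negP: xab; apply: contra => /andP[/ltW -> /ltW ->].
have E : (fun x => h x * \1_`]a, b[ x) = (fun x => (h \_ `[a, b]) x * \1_`]a, b[ x).
  apply/funext => x; rewrite patchE indicE; case: ifPn => // xab.
  rewrite [x \in `]a, b[%classic]memNset ?mulr0//= in_itv/= => /andP[ax xb].
  by move: xab; rewrite notin_setE/= in_itv/= (ltW ax) (ltW xb).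
have mE : measurable_fun setT (fun x => h x * \1_`]a, b[ x).
  rewrite E; apply: measurable_funM; last exact: measurable_indic.
  exact: (itg_measurable i1).
have cvE : {ae mu, forall x, h x * bump n a b x @[n --> \oo] --> h x * \1_`]a, b[ x}.
  by apply: aeW => x; apply: cvgM; [exact: cvg_cst|exact: bump_cvg].
have [ig cv] := Rintegral_dominated (fun n => itg_measurable (seg_itg_mul_bump n a b ih))
  mE cvE (itg_norm i1) dom.
have : \int[mu]_x (h x * \1_`]a, b[ x) = 0.
  rewrite -(cvg_lim _ cv)//; under eq_fun do rewrite h0.
  exact: lim_cst.
have io : mu.-integrable `]a, b[ (EFin \o h).
  by apply: integrableS (ih a b) => //; exact: subset_itv_oo_cc.
have ioc : mu.-integrable `]a, b] (EFin \o h).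
  by apply: integrableS (ih a b) => //; exact: subset_itv_oc_cc.
rewrite -Rintegral_itv_obnd_cbnd// -Rintegral_itv_bndo_bndc// => e0.
rewrite -[RHS]e0 Rintegral_mkcond; apply: eq_Rintegral => x _.
by rewrite patchE indicE; case: (x \in _); rewrite ?mulr1 ?mulr0.
Qed.

Lemma weak_derivative_unique f g g' : L2 g -> L2 g' ->
  weak_derivative f g -> weak_derivative f g' -> g = g' %[ae mu].
Proof.
move=> hg hg' wg wg'.
suff: {ae mu, forall x, (g - g') x = 0}.
  by apply: aeS => x /eqP; rewrite subr_eq0 => /eqP.
have iB a b : mu.-integrable `[a, b] (EFin \o (g - g')) by apply: L2_seg_itg; exact: L2B.
apply: seg_integral0_ae0 => //; apply: bump_integral0 => // n a b.
have tb := test_function_bump n a b; have [lb _] := test_function_L2 tb.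
rewrite (_ : \int[mu]_x _ = \int[mu]_x (g x * bump n a b x - g' x * bump n a b x)); last first.
  by apply: eq_Rintegral => x _; rewrite -mulrBl.
rewrite RintegralB//; try exact: L2_mul.
have := wg _ tb; have := wg' _ tb => -> /eqP; rewrite eqr_opp => /eqP ->.
by rewrite subrr.
Qed.

Lemma primitive_exists g : (forall a b, mu.-integrable `[a, b] (EFin \o g)) ->
  exists f, primitive g f.
Proof.
move=> ig; pose J a b := \int[mu]_(x in `[a, b]) g x.
exists (fun x => if 0 <= x then J 0 x else - J x 0) => a b ab.
have add := fun x y z xy yz => @Rintegral_seg_add _ g x y z xy yz (ig _ _).
case: (leP 0 a) => a0.
  by rewrite (le_trans a0 ab) /J (add 0 a b)// addrAC subrr add0r.
case: (leP 0 b) => b0; first by rewrite opprK addrC -(add a 0 b)// ltW.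
by rewrite /J (add a b 0 ab (ltW b0)); ring.
Qed.

(** The lemma of du Bois-Reymond. With [F] a primitive of the weak derivative, [d = f - F] has weak
    derivative zero; it annihilates every test function of integral zero, hence is almost everywhere
    the constant [c], and [F + c] is the continuous representative. *)
Lemma H1_ac_pair f : H1 f -> exists f0 g,
  [/\ ac_pair f0 g, f = f0 %[ae mu] & weak_derivative f g].
Proof.
move=> [hf [g hg wg]].
have mf := L2_measurable hf.
have [F pF] := primitive_exists (fun a b => L2_seg_itg a b hg).
have cF := primitive_continuous hg pF.
pose d x := f x - F x.
have id a b : mu.-integrable `[a, b] (EFin \o d).
  by apply: seg_itgB; [exact: L2_seg_itg|exact: continuous_seg_itg].
pose th := bump 1 0 (1 : R); pose It := \int[mu]_x th x.
have i1 n (a b : R) : itg (fun x => 1 * bump n a b x).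
  by apply: (@seg_itg_mul_bump (fun=> 1)) => u v; apply: continuous_seg_itg => z; exact: cvg_cst.
have ib n (a b : R) : itg (bump n a b).
  by have := i1 n a b; apply: eq_integrable => // x _; rewrite /= mul1r.
have It0 : It != 0.
  apply/eqP => I0.
  have /ae_eq_integral_abs : (\int[mu]_(x in setT) `|(th x)%:E| = 0)%E.
    rewrite (_ : integral _ _ _ = \int[mu]_x (th x)%:E)%E; last first.
      by apply: eq_integral => x _; rewrite /= ger0_norm//; have /andP[] := bump_bound 1 0 1 x.
    by rewrite -[LHS]fineK ?(integrable_fin_num measurableT (ib _ _ _))// -/(Rintegral mu setT th) -/It I0.
  move=> /(_ measurableT (measurable_int _ (ib _ _ _))) /= h.
  have [N [mN N0 sN]] := ae_null h.
  have : (mu `]0%R, 1%R[%classic <= mu N)%E.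
    apply: le_measure; rewrite ?inE// => x /= x01; apply: contrapT => /sN /(_ I) [] e.
    by have := @bump_gt0 R 0 1 x x01; rewrite -/th e ltxx.
  by rewrite N0 lebesgue_measure_itv/= lte_fin ltr01 sube0 lee_fin ler10.
pose c := (\int[mu]_x (d x * th x)) / It.
have key n a b : \int[mu]_x ((d x - c) * bump n a b x) = 0.
  set psi := bump n a b; pose k := (\int[mu]_x psi x) / It.
  (* Subtracting a multiple of the fixed bump [th] makes the integral zero, so the primitive [phi]
     of [w] vanishes on both sides of the support and is a test function. *)
  pose w x := psi x - k * th x.
  have tpsi := test_function_bump n a b; have tth := test_function_bump 1 0 (1 : R).
  have [A1 A10 sA1] := test_function_support tpsi.
  have [A2 A20 sA2] := test_function_support tth.
  pose A := A1 + A2; have A0 : 0 < A by rewrite addr_gt0.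
  have wA x : A <= `|x| -> w x = 0.
    by move=> Ax; rewrite /w /psi /th sA1 ?sA2 ?mulr0 ?subrr//; apply: le_trans Ax; rewrite ?lerDl ?lerDr ltW.
  have sw j : smooth_upto j w.
    apply: smoothD; first exact: smooth_bump.
    have := smoothM (smooth_cst j (- k)) (smooth_bump j 1 0 (1 : R)).
    by congr smooth_upto; apply/funext => x; rewrite mulNr.
  have cw : continuous w by exact: (smooth_continuous (sw 1%N)).
  have lw := continuous_outside_L2 cw wA.
  have iw0 : \int[mu]_x w x = 0.
    rewrite RintegralB//; [|exact: ib|by apply: itgZ; exact: ib].
    by rewrite RintegralZl ?divfK ?subrr//; exact: ib.
  have [G pG] := primitive_exists (fun a b => L2_seg_itg a b lw).
  pose phi x := G x - G (- A).
  have dphi x : is_derive x (1 : R) phi (w x).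
    rewrite -[w x]subr0; apply: (@is_derive_add _ G (fun=> - G (- A)) x (w x) (- 0)).
    exact: derive_of_primitive.
  have AA : - A <= A by apply: (@le_trans _ _ 0); rewrite ?oppr_le0 ltW.
  have phiA x : A <= `|x| -> phi x = 0.
    rewrite /phi; case: (ler0P x) => x0 Ax.
      have xA : x <= - A by lra.
      have := pG _ _ xA; rewrite (_ : \int[mu]_(y in _) _ = 0); first by lra.
      rewrite -(Rintegral_set0 mu w) Rintegral_mkcond [RHS]Rintegral_mkcond; apply: eq_Rintegral => y _.
      rewrite !patchE in_set0; case: ifPn => //; rewrite inE/= in_itv/= => /andP[_ yA].
      by apply: wA; rewrite ler0_norm; lra.
    have xA : - A <= x by lra.
    rewrite (pG _ _ xA) -[RHS]iw0 Rintegral_mkcond; apply: eq_Rintegral => y _.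
    rewrite patchE; case: ifPn => //; rewrite notin_setE/= in_itv/= => /negP.
    rewrite negb_and -!ltNge => /orP[h|h]; apply/esym/wA; first by rewrite ler0_norm; lra.
    by rewrite ger0_norm; lra.
  have tphi : test_function phi.
    by apply: (@test_function_of_smooth _ phi A) => // -[//|j]; exists w.
  have dE : phi^`()%classic = w by apply/funext => x; exact: is_derive_derive1.
  have := wg _ tphi; have := primitive_weak hg pF tphi; rewrite dE => e1 e2.
  have ifw : itg (fun x => f x * w x) by exact: L2_mul.
  have idw m u v : itg (fun x => d x * bump m u v x) by exact: seg_itg_mul_bump.
  have dw : \int[mu]_x (d x * w x) = 0.
    have iFw : itg (fun x => F x * w x).
      have h : itg (fun x => f x * w x - (d x * psi x - k * (d x * th x))).
        by apply: itgB => //; apply: itgB; [exact: idw|apply: itgZ; exact: idw].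
      by move: h; apply: eq_integrable => // x _; rewrite /= /w /d; congr EFin; ring.
    rewrite (_ : \int[mu]_x _ = \int[mu]_x (f x * w x - F x * w x)); last first.
      by apply: eq_Rintegral => x _; rewrite /d mulrBl.
    by rewrite RintegralB// e1 e2 subrr.
  have E1 : \int[mu]_x (d x * psi x) = k * \int[mu]_x (d x * th x).
    apply/eqP; rewrite -subr_eq0 -RintegralZl//; last exact: idw.
    rewrite -RintegralB//; [|exact: idw|by apply: itgZ; exact: idw].
    by apply/eqP; rewrite -[RHS]dw; apply: eq_Rintegral => x _; rewrite /w; ring.
  rewrite (_ : \int[mu]_x _ = \int[mu]_x (d x * psi x - c * psi x)); last first.
    by apply: eq_Rintegral => x _; rewrite mulrBl.
  rewrite RintegralB//; [|exact: idw|by apply: itgZ; exact: ib].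
  rewrite RintegralZl//; last exact: ib.
  by rewrite E1 /c /k; field.
have idc a b : mu.-integrable `[a, b] (EFin \o (fun x => d x - c)).
  by apply: seg_itgB => //; apply: continuous_seg_itg => z; exact: cvg_cst.
have ff : f = (fun x => F x + c) %[ae mu].
  apply: aeS (seg_integral0_ae0 idc (bump_integral0 idc key)) => x e _.
  by move: e; rewrite /d; lra.
exists (fun x => F x + c), g; split => //; split => //.
  apply: L2_ae_eq ff hf; apply: measurable_funD; last exact: measurable_cst.
  exact: continuous_measurable_fun.
by move=> a b ab; rewrite -(pF _ _ ab); ring.
Qed.

Lemma ac_pair_H1 f f0 g : measurable_fun setT f -> ac_pair f0 g -> f = f0 %[ae mu] ->
  H1 f /\ wderiv f = g %[ae mu].
Proof.
move=> mf [hf0 hg pf0] ff0.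
have hf : L2 f.
  apply: L2_ae_eq mf _ hf0; by apply: aeS ff0 => x h /h ->.
have wg : weak_derivative f g.
  move=> phi tp; rewrite -(primitive_weak hg pf0 tp); apply: Rintegral_ae_eq.
  - by apply: measurable_funM => //; have [_ /L2_measurable] := test_function_L2 tp.
  - by apply: measurable_funM; [exact: L2_measurable|have [_ /L2_measurable] := test_function_L2 tp].
  - by apply: aeS ff0 => x h _; rewrite h.
split; first by split => //; exists g.
have [h1 h2] : L2 (wderiv f) /\ weak_derivative f (wderiv f).
  by rewrite /wderiv; apply: (@xgetPex _ (cst 0) [set g | L2 g /\ weak_derivative f g]); exists g.
exact: weak_derivative_unique h2 wg.
Qed.

Lemma L2norm_wderiv f f0 g : measurable_fun setT f -> ac_pair f0 g -> f = f0 %[ae mu] ->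
  L2norm (wderiv f) = N2 g.
Proof.
move=> mf pf ff0; have [[_ [g' hg' wg']] wg] := ac_pair_H1 mf pf ff0; have [_ hg _] := pf.
have [hw _] : L2 (wderiv f) /\ weak_derivative f (wderiv f).
  by rewrite /wderiv; apply: (@xgetPex _ (cst 0) [set g | L2 g /\ weak_derivative f g]); exists g'.
by rewrite L2_normE// (ip_norm2_ae_eq (L2_measurable hw) (L2_measurable hg) wg).
Qed.

Lemma H1norm_ac_pair f f0 g : measurable_fun setT f -> ac_pair f0 g -> f = f0 %[ae mu] ->
  H1norm f = Num.sqrt (N2 f0 ^+ 2 + N2 g ^+ 2).
Proof.
move=> mf pf ff0; have [[hf _] _] := ac_pair_H1 mf pf ff0; have [hf0 _ _] := pf.
by rewrite /H1norm (L2norm_wderiv mf pf ff0) L2_normE// (ip_norm2_ae_eq mf (L2_measurable hf0) ff0).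
Qed.

End WeakDerivatives.

(** * The Hilbert transform *)

Section Kernels.
Context {R : realType}.
Local Notation mu := (@lebesgue_measure R).
Local Notation itg f := (lebesgue_integrable f).
Implicit Types (f F : R -> R) (a b c s t x z : R).

Lemma Rintegral_seg_cvg f : itg f ->
  \int[mu]_(x in `[- n%:R, n%:R]) f x @[n --> \oo] --> \int[mu]_x f x.
Proof.
move=> hf; have mf := itg_measurable hf.
have E n : \int[mu]_(x in `[- n%:R, n%:R]) f x = \int[mu]_x (f x * \1_`[- n%:R, n%:R] x).
  rewrite Rintegral_mkcond; apply: eq_Rintegral => x _.
  by rewrite patchE indicE; case: (x \in _); rewrite ?mulr1 ?mulr0.
under eq_fun do rewrite E.
apply: (proj2 (Rintegral_dominated _ mf _ (itg_norm hf) _)).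
- by move=> n; apply: measurable_funM => //; exact: measurable_indic.
- apply: aeW => x; have /truncn_itv/andP[_ xb] : 0 <= `|x| by [].
  apply: (@cvg_trans _ (f x @[n --> \oo])); last exact: cvg_cst.
  apply: near_eq_cvg; near=> n; rewrite indicE mem_set ?mulr1//= in_itv/= -ler_norml.
  apply: le_trans (ltW xb) _; rewrite ler_nat; near: n; exact: nbhs_infty_ge.
- by move=> n x; rewrite indicE; case: (_ \in _); rewrite ?mulr1// mulr0 normr0.
Unshelve. all: by end_near. Qed.

Lemma eq_cvgn (u v : nat -> R) (l l' : R) : (forall n, u n = v n) -> l = l' ->
  v n @[n --> \oo] --> l' -> u n @[n --> \oo] --> l.
Proof. by move=> /funext -> ->. Qed.

Lemma cvgn_add (u v : nat -> R) (l m : R) : u n @[n --> \oo] --> l ->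
  v n @[n --> \oo] --> m -> u n + v n @[n --> \oo] --> l + m.
Proof. by move=> hu hv; exact: cvgD. Qed.

Lemma cvgn_sub (u v : nat -> R) (l m : R) : u n @[n --> \oo] --> l ->
  v n @[n --> \oo] --> m -> u n - v n @[n --> \oo] --> l - m.
Proof. by move=> hu hv; exact: cvgB. Qed.

Lemma cvgn_scale (k : R) (u : nat -> R) (l : R) : u n @[n --> \oo] --> l ->
  k * u n @[n --> \oo] --> k * l.
Proof. by move=> hu; apply: cvgM => //; exact: cvg_cst. Qed.

Lemma Rintegral_improper f F l : itg f -> continuous f ->
  (forall x, is_derive x (1 : R) F (f x)) ->
  F n%:R - F (- n%:R) @[n --> \oo] --> l -> \int[mu]_x f x = l.
Proof.
move=> hf cf dF Fl; have c1 := Rintegral_seg_cvg hf.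
have E n : \int[mu]_(x in `[- n%:R, n%:R]) f x = F n%:R - F (- n%:R).
  by rewrite (primitive_of_derive dF cf)// (@le_trans _ _ 0)// ?oppr_le0 ler0n.
have {}c1 : F n%:R - F (- n%:R) @[n --> \oo] --> \int[mu]_x f x.
  by under eq_fun do rewrite -E.
by rewrite -(cvg_lim _ c1)// -(cvg_lim _ Fl).
Qed.

(** Monotone convergence in disguise: [L2_fatou] is applied to truncations of the square root of
    [f]. *)
Lemma ge0_itg_bounded f B : measurable_fun setT f -> (forall x, 0 <= f x) ->
  (forall n, seg_itg f (- n%:R) n%:R) ->
  (forall n, \int[mu]_(x in `[- n%:R, n%:R]) f x <= B) -> itg f.
Proof.
move=> mf f0 fi fB.
have mF : measurable_fun setT (fun x => Num.sqrt (f x)).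
  by apply: measurableT_comp => //; apply: continuous_measurable_fun; exact: sqrt_continuous.
have E n : (fun x => (Num.sqrt (f x) * \1_`[- n%:R, n%:R] x) ^+ 2) = f \_ `[- n%:R, n%:R].
  apply/funext => x; rewrite patchE indicE; case: (x \in _).
    by rewrite mulr1 sqr_sqrtr.
  by rewrite mulr0 expr0n.
have [] := @L2_fatou _ (fun n x => Num.sqrt (f x) * \1_`[- n%:R, n%:R] x)
  (fun x => Num.sqrt (f x)) (Num.sqrt B) mF.
- move=> n; apply/L2P; split; first by apply: measurable_funM => //; exact: measurable_indic.
  by rewrite E; exact: seg_itg_patch.
- apply: aeW => x; have /truncn_itv/andP[_ xb] : 0 <= `|x| by [].
  apply: (@cvg_trans _ (Num.sqrt (f x) @[n --> \oo])); last exact: cvg_cst.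
  apply: near_eq_cvg; near=> n; rewrite indicE mem_set ?mulr1//= in_itv/= -ler_norml.
  apply: le_trans (ltW xb) _; rewrite ler_nat; near: n; exact: nbhs_infty_ge.
- move=> n; rewrite /ip_norm ler_wsqrtr// /ip2; under eq_Rintegral do rewrite -expr2.
  apply: le_trans (fB n); rewrite [X in _ <= X]Rintegral_mkcond.
  by rewrite -(E n).
by move=> /L2P[_ h] _; move: h; apply: eq_integrable => // x _ /=; rewrite sqr_sqrtr.
Unshelve. all: by end_near. Qed.

(** The conjugate Poisson kernel and the Poisson kernel of the half-plane without the customary
    factor [1/pi]; accordingly [poisson c] has integral [pi]. *)
Definition conj_poisson a z := z / (z ^+ 2 + a ^+ 2).
Definition poisson c z := c / (z ^+ 2 + c ^+ 2).
Local Notation q := conj_poisson.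
Local Notation p := poisson.

Lemma sqrD_gt0 z a : 0 < a -> 0 < z ^+ 2 + a ^+ 2.
Proof. by move=> a0; rewrite ltr_wpDl ?sqr_ge0// exprn_gt0. Qed.

Lemma is_derive_shift s x : is_derive x (1 : R) (fun y => y - s) 1.
Proof.
have := is_derive_affine 1 (- s) x.
by rewrite (_ : (fun y => 1 * y + - s) = (fun y => y - s))//; apply/funext => y; rewrite mul1r.
Qed.

Lemma is_derive_scale k f x (l : R) : is_derive x (1 : R) f l ->
  is_derive x (1 : R) (fun y => k * f y) (k * l).
Proof. by move=> h; have := is_derive_mul (is_derive_const k x) h; rewrite mul0r add0r. Qed.

Lemma is_derive_sqrD s a x : is_derive x (1 : R) (fun y => (y - s) ^+ 2 + a ^+ 2) (2 * (x - s)).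
Proof.
have := is_derive_add (is_derive_exp 2 (is_derive_shift s x)) (is_derive_const (a ^+ 2) x).
by rewrite addr0 mulr1 expr1.
Qed.

Lemma is_derive_atan_kernel a s x : 0 < a ->
  is_derive x (1 : R) (fun y => atan ((y - s) / a)) (p a (x - s)).
Proof.
move=> a0.
have d1 : is_derive x (1 : R) (fun y => (y - s) / a) a^-1.
  have := is_derive_mul (is_derive_shift s x) (is_derive_const a^-1 x).
  by rewrite mul1r mulr0 addr0.
have := @is_derive1_comp _ atan (fun y => (y - s) / a) x _ _ (is_derive1_atan _) d1.
move=> h; apply: is_derive_eq h _; rewrite /p; field.
by rewrite gt_eqF ?sqrD_gt0//= (gt_eqF a0).
Qed.

Lemma is_derive_ln_kernel a s x : 0 < a ->
  is_derive x (1 : R) (fun y => ln ((y - s) ^+ 2 + a ^+ 2)) (2 * q a (x - s)).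
Proof.
move=> a0.
have := @is_derive1_comp _ (@ln R) (fun y => (y - s) ^+ 2 + a ^+ 2) x _ _
  (is_derive1_ln (sqrD_gt0 (x - s) a0)) (is_derive_sqrD s a x).
by move=> h; apply: is_derive_eq h _; rewrite /q mulrC mulrA.
Qed.

Lemma continuous_poisson c s : 0 < c -> continuous (fun x => p c (x - s)).
Proof.
move=> c0 x; apply: cvgM; first exact: cvg_cst.
apply: cvgV; first by rewrite gt_eqF// sqrD_gt0.
exact: is_derive_continuous (is_derive_sqrD s c x).
Qed.

Lemma continuous_conj_poisson a s : 0 < a -> continuous (fun x => q a (x - s)).
Proof.
move=> a0 x; apply: cvgM.
  exact: is_derive_continuous (is_derive_shift s x).
apply: cvgV; first by rewrite gt_eqF// sqrD_gt0.
exact: is_derive_continuous (is_derive_sqrD s a x).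
Qed.

Lemma poisson_ge0 c z : 0 < c -> 0 <= p c z.
Proof. by move=> c0; rewrite divr_ge0 ?(ltW c0)// ltW// sqrD_gt0. Qed.

Lemma cvg_atan_kernel a s : 0 < a ->
  atan ((n%:R - s) / a) - atan ((- n%:R - s) / a) @[n --> \oo] --> (pi : R).
Proof.
move=> a0; have H s' : atan ((n%:R - s') / a) @[n --> \oo] --> (pi / 2 : R).
  apply: (cvg_comp _ _ _ (@cvgy_atan R)).
  apply/cvgryPge => A; near=> n; rewrite ler_pdivlMr// lerBrDr.
  by near: n; exact: nbhs_infty_ger.
rewrite [X in _ --> X](_ : _ = pi / 2 + pi / 2); last by rewrite -splitr.
apply: cvgD; first exact: H.
have := H (- s); apply: cvg_trans; apply: near_eq_cvg; apply: nearW => n.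
by rewrite -atanN; congr atan; rewrite -mulNr opprD !opprK.
Unshelve. all: by end_near. Qed.

Lemma poisson_itg c s : 0 < c -> itg (fun x => p c (x - s)) /\ \int[mu]_x p c (x - s) = pi.
Proof.
move=> c0; have cp := continuous_poisson (s := s) c0.
have pr := primitive_of_derive (fun x => is_derive_atan_kernel s x c0) cp.
have ip : itg (fun x => p c (x - s)).
  apply: (@ge0_itg_bounded _ pi).
  - exact: continuous_measurable_fun.
  - by move=> x; exact: poisson_ge0.
  - by move=> n; exact: continuous_seg_itg.
  - move=> n; rewrite -pr; last by rewrite (@le_trans _ _ 0)// ?oppr_le0 ler0n.
    have := @atan_ltpi2 R ((n%:R - s) / c); have := @atan_gtNpi2 R ((- n%:R - s) / c); lra.
split => //; apply: (Rintegral_improper ip cp (fun x => is_derive_atan_kernel s x c0)).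
exact: cvg_atan_kernel.
Qed.

Lemma poissonC c z : p c (- z) = p c z. Proof. by rewrite /p sqrrN. Qed.

Lemma conj_poisson_sqr_le a z : 0 < a -> q a z ^+ 2 <= a^-1 * p a z.
Proof.
move=> a0; have h := sqrD_gt0 z a0.
rewrite /q /p mulrA mulVf ?gt_eqF// exprMn exprVn.
rewrite ler_pdivrMr ?exprn_gt0// div1r [X in _ <= _ * X]expr2 mulKf ?gt_eqF//.
by rewrite lerDl sqr_ge0.
Qed.

Lemma conj_poisson_L2 a s : 0 < a -> L2 (fun x => q a (x - s)).
Proof.
move=> a0; apply/L2P; have m := continuous_measurable_fun (continuous_conj_poisson (s := s) a0).
split => //; have [ip _] := poisson_itg s a0.
apply: (itg_le _ (itgZ a^-1 ip)); first exact: measurable_funX.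
by move=> x; rewrite ger0_norm ?sqr_ge0//; exact: conj_poisson_sqr_le.
Qed.

Lemma conj_poisson_bound a z : 0 < a -> `|q a z| <= (2 * a)^-1.
Proof.
move=> a0; have h := sqrD_gt0 z a0.
rewrite /q normrM normfV (gtr0_norm h) ler_pdivrMr// ler_pdivlMl ?mulr_gt0//.
rewrite -subr_ge0 -(real_normK (num_real z)).
by rewrite (_ : _ - _ = (`|z| - a) ^+ 2) ?sqr_ge0//; ring.
Qed.

Lemma cvg_ln_kernel a b s t : 0 < a -> 0 < b ->
  ln ((n%:R - s) ^+ 2 + a ^+ 2) - ln ((n%:R - t) ^+ 2 + b ^+ 2) @[n --> \oo] --> (0 : R).
Proof.
move=> a0 b0.
have hn : (n.+1%:R : R)^-1 @[n --> \oo] --> (0 : R) by exact: cvg_harmonic.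
have hs s' a' : (1 - s' * (n.+1%:R)^-1) ^+ 2 + (a' * (n.+1%:R)^-1) ^+ 2 @[n --> \oo] --> (1 : R).
  rewrite [X in _ --> X](_ : _ = (1 - s' * 0) * (1 - s' * 0) + (a' * 0) * (a' * 0)); last by ring.
  under eq_fun do rewrite !expr2.
  have e1 : 1 - s' * (n.+1%:R)^-1 @[n --> \oo] --> 1 - s' * 0.
    by apply: cvgB; [exact: cvg_cst|apply: cvgM; [exact: cvg_cst|exact: hn]].
  have e2 : a' * (n.+1%:R)^-1 @[n --> \oo] --> a' * 0.
    by apply: cvgM; [exact: cvg_cst|exact: hn].
  by apply: cvgD; apply: cvgM.
rewrite -(cvg_shiftS (fun n => ln ((n%:R - s) ^+ 2 + a ^+ 2) - ln ((n%:R - t) ^+ 2 + b ^+ 2))).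
(* Both logarithms contain the same divergent term, the logarithm of the squared index, and what is
   left tends to [ln 1]. *)
have E n s' a' : 0 < a' -> ln ((n.+1%:R - s') ^+ 2 + a' ^+ 2) =
    ln (n.+1%:R ^+ 2) + ln ((1 - s' * (n.+1%:R)^-1) ^+ 2 + (a' * (n.+1%:R)^-1) ^+ 2) :> R.
  move=> a'0; have n0 : 0 < n.+1%:R :> R by rewrite ltr0n.
  rewrite -lnM ?posrE ?exprn_gt0//.
    by congr ln; field; rewrite gt_eqF.
  by rewrite ltr_wpDl ?sqr_ge0// exprn_gt0// mulr_gt0// invr_gt0.
have cl s' a' : 0 < a' ->
    ln ((1 - s' * (n.+1%:R)^-1) ^+ 2 + (a' * (n.+1%:R)^-1) ^+ 2) @[n --> \oo] --> (0 : R).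
  move=> a'0; rewrite -[0]ln1; apply: continuous_cvg; last exact: hs.
  exact: is_derive_continuous (is_derive1_ln ltr01).
apply: (@eq_cvgn _ _ _ (0 - 0) _ _ (cvgn_sub (cl s a a0) (cl t b b0))); last by rewrite subrr.
by move=> n /=; rewrite (E n s a a0) (E n t b b0); ring.
Qed.

Lemma cvg_ln_kernelN a b s t : 0 < a -> 0 < b ->
  ln ((- n%:R - s) ^+ 2 + a ^+ 2) - ln ((- n%:R - t) ^+ 2 + b ^+ 2) @[n --> \oo] --> (0 : R).
Proof.
move=> a0 b0; have := cvg_ln_kernel (- s) (- t) a0 b0.
have E n (u : R) : (- n%:R - u) ^+ 2 = (n%:R - - u) ^+ 2 by rewrite -sqrrN opprD !opprK.
by under eq_fun do rewrite -!E.
Qed.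

(* By partial fractions; the two quadratics coincide when [a = b] and [s = t]. *)
Lemma conj_poisson_conv a b s t : 0 < a -> 0 < b ->
  \int[mu]_x (q a (x - s) * q b (x - t)) = pi * p (a + b) (s - t).
Proof.
move=> a0 b0.
have iq : itg (fun x => q a (x - s) * q b (x - t)) by apply: L2_mul; exact: conj_poisson_L2.
have cq : continuous (fun x => q a (x - s) * q b (x - t)).
  by move=> x; apply: cvgM; exact: continuous_conj_poisson.
pose d := t - s.
(* [De] is the resultant of the two denominators; as [a + b > 0], only its second factor can vanish,
   and then [s = t] and [a = b]. *)
pose De := (d ^+ 2 + (a + b) ^+ 2) * (d ^+ 2 + (a - b) ^+ 2).
have ab0 : 0 < a + b by rewrite addr_gt0.
have [De0|De0] := eqVneq De 0.
  have : d ^+ 2 + (a - b) ^+ 2 == 0 by move/eqP: De0; rewrite mulf_eq0 gt_eqF// sqrD_gt0.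
  rewrite paddr_eq0 ?sqr_ge0// !sqrf_eq0 !subr_eq0 => /andP[/eqP ts /eqP ab].
  subst t b; pose F x := 2^-1 * (a^-1 * atan ((x - s) / a) - q a (x - s)).
  apply: (Rintegral_improper (F := F) iq cq).
    move=> x; have hx := sqrD_gt0 (x - s) a0.
    have dq : is_derive x (1 : R) (fun y => q a (y - s)) ((a ^+ 2 - (x - s) ^+ 2) / ((x - s) ^+ 2 + a ^+ 2) ^+ 2).
      have hV := @is_deriveV _ (fun y => (y - s) ^+ 2 + a ^+ 2) x _ 1 (lt0r_neq0 hx) (is_derive_sqrD s a x).
      apply: is_derive_eq (is_derive_mul (is_derive_shift s x) hV) _.
      by rewrite /GRing.scale/=; field; rewrite gt_eqF.
    have := is_derive_scale 2^-1 (is_derive_add (is_derive_scale a^-1 (is_derive_atan_kernel s x a0))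
      (is_derive_scale (-1) dq)).
    move=> h; have {}h := is_derive_eq h _.
    rewrite /F (_ : (fun x => _) = (fun y => 2^-1 * (a^-1 * atan ((y - s) / a) + -1 * q a (y - s)))); last first.
      by apply/funext => y; rewrite mulN1r.
    apply: h; rewrite /q /p; field.
    by rewrite (gt_eqF a0) (gt_eqF hx).
  rewrite subrr /p expr0n/= add0r.
  have qn s' : q a (n%:R - s') @[n --> \oo] --> (0 : R).
    apply/cvgr0Pnorm_lt => e e0.
    near=> n.
    have : e^-1 < n%:R - s'.
      rewrite -subr_gt0 -addrA -opprD subr_gt0.
      by near: n; exact: nbhs_infty_gtr.
    set z := n%:R - s' => z1; have z0 : 0 < z by apply: lt_trans z1; rewrite invr_gt0.
    rewrite /q ger0_norm; last by rewrite divr_ge0 ?(ltW z0)// ltW// sqrD_gt0.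
    rewrite ltr_pdivrMr ?sqrD_gt0// mulrDr ltr_wpDr//.
      by rewrite mulr_ge0 ?sqr_ge0// ltW.
    by rewrite expr2 mulrA ltr_pMl// mulrC -ltr_pdivrMr// div1r.
  have h := cvgn_scale (k := 2^-1) (cvgn_sub (cvgn_scale (k := a^-1) (cvg_atan_kernel s a0))
    (cvgn_add (qn s) (qn (- s)))).
  refine (@eq_cvgn _ _ _ _ _ _ h); last by rewrite -mulr2n; field; rewrite gt_eqF.
  move=> n /=; rewrite /F.
  have -> : q a (- n%:R - s) = - q a (n%:R - - s).
    by rewrite /q (_ : - n%:R - s = - (n%:R - - s)) ?sqrrN ?mulNr// opprB addrC.
  by ring.
(* Coefficients of the partial fractions [(A * (x - s) + B) / ((x - s) ^+ 2 + a ^+ 2)] and [(C - A *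
   (x - t)) / ((x - t) ^+ 2 + b ^+ 2)]. The two logarithms carry opposite coefficients, so they
   cancel at infinity; the arctangents give the value. *)
pose A := - d * (d ^+ 2 + a ^+ 2 + b ^+ 2) / De.
pose B := a ^+ 2 * (d ^+ 2 + a ^+ 2 - b ^+ 2) / De.
pose C := b ^+ 2 * (d ^+ 2 + b ^+ 2 - a ^+ 2) / De.
pose F x := A / 2 * (ln ((x - s) ^+ 2 + a ^+ 2) - ln ((x - t) ^+ 2 + b ^+ 2))
   + (B / a * a^-1 * a * atan ((x - s) / a) + C / b * atan ((x - t) / b)).
apply: (Rintegral_improper (F := F) iq cq).
  move=> x; have hs := sqrD_gt0 (x - s) a0; have ht := sqrD_gt0 (x - t) b0.
  have := is_derive_add (is_derive_scale (A / 2) (is_derive_add (is_derive_ln_kernel s x a0)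
      (is_derive_scale (-1) (is_derive_ln_kernel t x b0))))
    (is_derive_add (is_derive_scale (B / a * a^-1 * a) (is_derive_atan_kernel s x a0))
      (is_derive_scale (C / b) (is_derive_atan_kernel t x b0))).
  move=> h; have {}h := is_derive_eq h _.
  rewrite /F (_ : (fun x => _) = (fun y => A / 2 * (ln ((y - s) ^+ 2 + a ^+ 2) + -1 * ln ((y - t) ^+ 2 + b ^+ 2))
   + (B / a * a^-1 * a * atan ((y - s) / a) + C / b * atan ((y - t) / b)))); last first.
    by apply/funext => y; rewrite mulN1r.
  apply: h; rewrite /q /p /A /B /C.
  move: De0 hs ht; rewrite /De /d => De0 hs ht; field.
  move: De0; rewrite mulf_eq0 negb_or => /andP[-> ->].
  by rewrite (gt_eqF a0) (gt_eqF b0) (gt_eqF hs) (gt_eqF ht).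
apply: (@eq_cvgn _ _ _ (A / 2 * (0 - 0) + (B / a * a^-1 * a * pi + C / b * pi)) _ _
  (cvgn_add (cvgn_scale (k := A / 2) (cvgn_sub (cvg_ln_kernel (s) (t) a0 b0) (cvg_ln_kernelN (s) (t) a0 b0)))
  (cvgn_add (cvgn_scale (k := B / a * a^-1 * a) (cvg_atan_kernel s a0))
        (cvgn_scale (k := C / b) (cvg_atan_kernel t b0))))).
  by move=> n /=; rewrite /F; ring.
rewrite /p /B /C (_ : s - t = - d) ?sqrrN; last by rewrite opprB.
move: De0; rewrite /De mulf_eq0 negb_or => /andP[h1 h2]; field.
by rewrite (gt_eqF a0) (gt_eqF b0) h1 h2.
Unshelve. all: by end_near. Qed.

End Kernels.

(** * Regularisation of the transform by the conjugate Poisson kernel *)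

Section RegularizedHilbert.
Context {R : realType}.
Local Notation mu := (@lebesgue_measure R).
Local Notation itg f := (lebesgue_integrable f).
Local Notation N2 := (ip_norm ip2).
Local Notation q := conj_poisson.
Local Notation p := poisson.
Implicit Types (f g h F W : R -> R) (a b c s t x z : R).

(** By Tonelli it is enough to dominate the inner absolute integral in one of the two orders. *)
Lemma Rintegral_fubini (K : R -> R -> R) h :
  measurable_fun setT (fun z : R * R => K z.1 z.2) ->
  (forall x, itg (K x)) -> (forall s, itg (K^~ s)) -> itg h ->
  (forall s, \int[mu]_x `|K x s| <= h s) ->
  [/\ itg (fun x => \int[mu]_s K x s), itg (fun s => \int[mu]_x K x s) &
      \int[mu]_x \int[mu]_s K x s = \int[mu]_s \int[mu]_x K x s].
Proof.
move=> mK iK iK' ih Kh.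
pose f (z : R * R) := (K z.1 z.2)%:E.
have mf : measurable_fun setT f by exact/measurable_EFinP.
have E1 x : (\int[mu]_s f (x, s))%E = (\int[mu]_s K x s)%:E.
  by rewrite fineK//; exact: (integrable_fin_num measurableT (iK x)).
have E2 s : (\int[mu]_x f (x, s))%E = (\int[mu]_x K x s)%:E.
  by rewrite fineK//; exact: (integrable_fin_num measurableT (iK' s)).
have If : (mu \x mu)%E.-integrable setT f.
  apply/(integrable21ltyP mu mu mf).
  apply: (@le_lt_trans _ _ (\int[mu]_s `|(h s)%:E|)%E); last by case/integrableP: ih.
  apply: ge0_le_integral => //.
  - by move=> s _; apply: integral_ge0 => x _; exact: abse_ge0.
  - have maf : measurable_fun setT (abse \o f) by exact: measurableT_comp.
    exact: (@measurable_fun_fubini_tonelli_G _ _ _ _ _ mu (abse \o f) maf (fun=> abse_ge0 _)).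
  - by apply: measurableT_comp => //; apply/measurable_EFinP; exact: itg_measurable ih.
  - move=> s _; rewrite (_ : (\int[mu]_x `|f (x, s)|)%E = (\int[mu]_x `|K x s|)%:E).
      by rewrite lee_fin; apply: le_trans (Kh s) (ler_norm _).
    by rewrite fineK//; exact: (integrable_fin_num measurableT (itg_norm (iK' s))).
have e1 : (fun x => (\int[mu]_s f (x, s))%E) = EFin \o (fun x => \int[mu]_s K x s).
  by apply/funext => x /=; rewrite E1.
have e2 : (fun s => (\int[mu]_x f (x, s))%E) = EFin \o (fun s => \int[mu]_x K x s).
  by apply/funext => s /=; rewrite E2.
split.
- by have := integrable_fubini_F If; rewrite /fubini_F e1.
- have mG : measurable_fun setT (fun s => \int[mu]_x K x s).
    by have := measurable_fubini_G If; rewrite /fubini_G e2 => /measurable_EFinP.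
  apply: (itg_le mG ih) => s.
  exact: le_trans (le_normr_Rintegral measurableT (iK' s)) (Kh s).
- by rewrite {1 3}/Rintegral; congr fine; have := Fubini If; rewrite e1 e2.
Qed.

(** Testing against bumps dilated by [n + 1]: their derivatives are of order [1 / (n + 1)], so the
    pairing with [F] tends to zero, while the pairing with [W] tends to [B 0] times the integral. *)
Lemma ac_pair_integral0 F W : ac_pair F W -> itg F -> itg W -> \int[mu]_x W x = 0.
Proof.
move=> [_ hW pF] iF iW.
pose B := bump 1 (-1) (1 : R).
have B0 : B 0 != 0 by rewrite gt_eqF// bump_gt0// in_itv/= ltrN10 ltr01.
have tB := test_function_bump 1 (-1) (1 : R).
have [A [A0 pA dA]] := test_function_support2 tB.
have [M HM] := continuous_seg_bounded (- A) A (test_function_derive_continuous tB).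
have {}HM x : `|B^`()%classic x| <= Num.max M 0.
  rewrite le_max; case: (leP A `|x|) => xA; first by rewrite dA// normr0 lexx orbT.
  by rewrite HM// in_itv/= -ler_norml ltW.
set M' := Num.max M 0 in HM.
pose k n : R := (n.+1%:R)^-1.
have k0 n : 0 < k n by rewrite invr_gt0 ltr0n.
pose X n x := B (k n * x + 0).
have sX n j : smooth_upto j (X n) by apply: smooth_affine; exact: smooth_bump.
have tX n : test_function (X n).
  apply: (@test_function_of_smooth _ _ (A / k n)); first by move=> j; exact: sX.
  move=> x xA; apply: pA; rewrite addr0 normrM (gtr0_norm (k0 n)) mulrC.
  by rewrite -ler_pdivrMr.
have dX n x : (X n)^`()%classic x = B^`()%classic (k n * x + 0) * k n.
  apply: is_derive_derive1; apply: (@is_derive1_comp _ B (fun x => k n * x + 0)).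
    exact: test_function_derive.
  exact: is_derive_affine.
have E n : \int[mu]_x (W x * X n x) = - \int[mu]_x (F x * (X n)^`()%classic x).
  by rewrite (primitive_weak hW pF (tX n)) opprK.
have kc : k n @[n --> \oo] --> (0 : R) by exact: cvg_harmonic.
have cX n : measurable_fun setT (X n).
  by apply: continuous_measurable_fun; exact: smooth_continuous (sX n 1%N).
have c1 : \int[mu]_x (W x * X n x) @[n --> \oo] --> \int[mu]_x (W x * B 0).
  apply: (proj2 (Rintegral_dominated _ _ _ (itg_norm iW) _)).
  - by move=> n; apply: measurable_funM => //; exact: itg_measurable.
  - by apply: measurable_funM => //; exact: itg_measurable.
  - apply: aeW => x; apply: cvgM; first exact: cvg_cst.
    apply: continuous_cvg; first exact: continuous_bump.
    rewrite [X in _ --> X](_ : _ = 0 * x + 0); last by rewrite mul0r addr0.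
    by apply: cvgD; [apply: cvgM => //; exact: cvg_cst|exact: cvg_cst].
  - move=> n x; rewrite normrM ler_piMr//.
    by have /andP[b0 b1] := bump_bound 1 (-1) 1 (k n * x + 0); rewrite /X ger0_norm.
have c2 : \int[mu]_x (W x * X n x) @[n --> \oo] --> (0 : R).
  apply/norm_cvg0P; apply: (@squeeze_cvgr _ _ _ _ (fun=> 0) (fun n => k n * (M' * \int[mu]_x `|F x|))).
  - apply: nearW => n; rewrite normr_ge0/= E normrN.
    have iFX : itg (fun x => F x * (X n)^`()%classic x).
      apply: (itg_le _ (itgZ (M' * k n) (itg_norm iF))).
        apply: measurable_funM; first exact: itg_measurable.
        by apply: continuous_measurable_fun; exact: test_function_derive_continuous.
      move=> x; rewrite normrM mulrC dX normrM (gtr0_norm (k0 n)) ler_wpM2r// ler_pM2r//.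
    apply: le_trans (le_normr_Rintegral measurableT iFX) _.
    rewrite mulrA -RintegralZl//; last exact: itg_norm.
    apply: le_Rintegral => //; [exact: itg_norm|by apply: itgZ; exact: itg_norm|].
    move=> x _; rewrite normrM mulrC dX normrM (gtr0_norm (k0 n)) ler_wpM2r// mulrC ler_pM2l//.
  - exact: cvg_cst.
  - by rewrite -(mul0r (M' * \int[mu]_x `|F x|)); apply: cvgM => //; exact: cvg_cst.
have : \int[mu]_x (W x * B 0) = 0 by rewrite -(cvg_lim _ c1)//; exact/cvg_lim.
rewrite RintegralZr// => /eqP.
by rewrite mulf_eq0 (negbTE B0) orbF => /eqP.
Qed.

Definition conj_poisson_derive a z := (a ^+ 2 - z ^+ 2) / (z ^+ 2 + a ^+ 2) ^+ 2.
Local Notation dq := conj_poisson_derive.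

Lemma is_derive_conj_poisson a s x : 0 < a ->
  is_derive x (1 : R) (fun y => q a (y - s)) (dq a (x - s)).
Proof.
move=> a0; have hx := sqrD_gt0 (x - s) a0.
have hV := @is_deriveV _ (fun y => (y - s) ^+ 2 + a ^+ 2) x _ 1 (lt0r_neq0 hx) (is_derive_sqrD s a x).
apply: is_derive_eq (is_derive_mul (is_derive_shift s x) hV) _.
by rewrite /GRing.scale/= /dq; field; rewrite gt_eqF.
Qed.

Lemma conj_poissonN a z : q a (- z) = - q a z. Proof. by rewrite /q sqrrN mulNr. Qed.

Lemma continuous_conj_poisson_derive a s : 0 < a -> continuous (fun x => dq a (x - s)).
Proof.
move=> a0 x; apply: cvgM.
  apply: cvgB; first exact: cvg_cst.
  exact: is_derive_continuous (is_derive_exp 2 (is_derive_shift s x)).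
apply: cvgV; first by rewrite gt_eqF// exprn_gt0// sqrD_gt0.
exact: is_derive_continuous (is_derive_exp 2 (is_derive_sqrD s a x)).
Qed.

Lemma conj_poisson_derive_le a z : 0 < a -> `|dq a z| <= a^-1 * p a z.
Proof.
move=> a0; have h := sqrD_gt0 z a0; have h2 : 0 < (z ^+ 2 + a ^+ 2) ^+ 2 by rewrite exprn_gt0.
rewrite /dq /p mulrA mulVf ?gt_eqF// normrM normfV (gtr0_norm h2).
rewrite ler_pdivrMr// div1r [X in _ <= _ * X]expr2 mulKf ?gt_eqF//.
by rewrite ler_norml; apply/andP; split; have := sqr_ge0 z; have := sqr_ge0 a; lra.
Qed.

Lemma poisson_bound c z : 0 < c -> p c z <= c^-1.
Proof.
move=> c0; rewrite /p ler_pdivrMr ?sqrD_gt0// ler_pdivlMl//.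
by rewrite -expr2 lerDr sqr_ge0.
Qed.

Lemma conj_poisson_derive_bound a z : 0 < a -> `|dq a z| <= a^-1 * a^-1.
Proof.
move=> a0; apply: le_trans (conj_poisson_derive_le z a0) _.
by rewrite ler_pM2l ?invr_gt0//; exact: poisson_bound.
Qed.

Lemma conj_poisson_derive_L2 a s : 0 < a -> L2 (fun x => dq a (x - s)).
Proof.
move=> a0; have m : measurable_fun setT (fun x => dq a (x - s)).
  by apply: continuous_measurable_fun; exact: continuous_conj_poisson_derive.
apply/L2P; split=> //; have [ip _] := poisson_itg s a0.
apply: (itg_le _ (itgZ (a^-1 * a^-1 * a^-1) ip)); first exact: measurable_funX.
move=> x; rewrite normrX expr2 -(mulrA (a^-1 * a^-1)); apply: ler_pM => //.
  exact: conj_poisson_derive_bound.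
exact: conj_poisson_derive_le.
Qed.

Lemma conj_poisson_ac_pair a x : 0 < a ->
  ac_pair (fun s => q a (x - s)) (fun s => - dq a (x - s)).
Proof.
move=> a0.
have E : (fun s => q a (x - s)) = (-1) *: (fun s => q a (s - x)).
  by apply/funext => s; rewrite -opprB conj_poissonN; exact/esym/mulN1r.
have E' : (fun s => - dq a (x - s)) = (-1) *: (fun s => dq a (s - x)).
  by apply/funext => s; rewrite -opprB /dq sqrrN; exact/esym/mulN1r.
rewrite E E'; apply: ac_pairZ; split.
- exact: conj_poisson_L2.
- exact: conj_poisson_derive_L2.
- apply: primitive_of_derive; first by move=> s; exact: is_derive_conj_poisson.
  exact: continuous_conj_poisson_derive.
Qed.

Lemma measurable_kernel (k : R -> R) : measurable_fun setT k ->
  measurable_fun setT (fun z : R * R => k (z.1 - z.2)).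
Proof.
move=> mk; apply: (@measurableT_comp _ _ _ _ _ _ k) => //.
exact: measurable_funB.
Qed.

Lemma measurable_conj_poisson a : 0 < a -> measurable_fun setT (q a : R -> R).
Proof.
move=> a0; have := continuous_measurable_fun (continuous_conj_poisson (s := 0) a0).
by under eq_fun do rewrite subr0.
Qed.

Lemma measurable_conj_poisson_derive a : 0 < a -> measurable_fun setT (dq a : R -> R).
Proof.
move=> a0; have := continuous_measurable_fun (continuous_conj_poisson_derive (s := 0) a0).
by under eq_fun do rewrite subr0.
Qed.

Lemma measurable_poisson c : 0 < c -> measurable_fun setT (p c : R -> R).
Proof.
move=> a0; have := continuous_measurable_fun (continuous_poisson (s := 0) a0).
by under eq_fun do rewrite subr0.
Qed.

Lemma itg_bounded_mul (k : R -> R) M g : measurable_fun setT k -> (forall x, `|k x| <= M) ->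
  itg g -> itg (fun x => k x * g x).
Proof.
move=> mk kM ig; apply: (itg_le _ (itgZ M (itg_norm ig))).
  by apply: measurable_funM => //; exact: itg_measurable.
by move=> x; rewrite normrM ler_wpM2r.
Qed.

Lemma measurable_sub_l x (k : R -> R) : measurable_fun setT k -> measurable_fun setT (fun s => k (x - s)).
Proof.
move=> mk; apply: (@measurableT_comp _ _ _ _ _ _ k) => //; exact: measurable_funB.
Qed.

Lemma measurable_sub_r x (k : R -> R) : measurable_fun setT k -> measurable_fun setT (fun s => k (s - x)).
Proof.
move=> mk; apply: (@measurableT_comp _ _ _ _ _ _ k) => //; exact: measurable_funB.
Qed.

Definition regHilbert a g x := \int[mu]_s (q a (x - s) * g s).
Local Notation Q := regHilbert.

Lemma regHilbert_itg a g x : 0 < a -> itg g -> itg (fun s => q a (x - s) * g s).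
Proof.
move=> a0; apply: (@itg_bounded_mul _ ((2 * a)^-1)).
  by apply: measurable_sub_l; exact: measurable_conj_poisson.
by move=> s; exact: conj_poisson_bound.
Qed.

Lemma regHilbert_continuous a g : 0 < a -> itg g -> continuous (Q a g).
Proof.
move=> a0 ig x.
suff E y : `|Q a g x - Q a g y| <= `|x - y| * (a^-1 * a^-1 * \int[mu]_s `|g s|).
  apply/cvgrPdist_lt => e e0.
  have G0 : 0 <= a^-1 * a^-1 * \int[mu]_s `|g s|.
    by rewrite !mulr_ge0 ?invr_ge0 ?(ltW a0)// Rintegral_ge0.
  set G := a^-1 * a^-1 * \int[mu]_s `|g s| in G0 E.
  have G1 : 0 < G + 1 by rewrite ltr_wpDl.
  near=> y; apply: le_lt_trans (E y) _.
  apply: (@le_lt_trans _ _ (`|x - y| * (G + 1))); first by rewrite ler_wpM2l// lerDl.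
  rewrite -ltr_pdivlMr//; near: y; apply: cvgr_dist_lt; first exact: cvg_id.
  by rewrite divr_gt0.
rewrite -RintegralB//; try exact: regHilbert_itg.
have iB : itg (fun s => q a (x - s) * g s - q a (y - s) * g s).
  by apply: itgB; exact: regHilbert_itg.
apply: le_trans (le_normr_Rintegral measurableT iB) _.
rewrite mulrA -RintegralZl//; last exact: itg_norm.
apply: le_Rintegral => //; [exact: itg_norm|by apply: itgZ; exact: itg_norm|].
move=> s _; rewrite -mulrBl normrM ler_wpM2r// /q.
set z := x - s; set w := y - s; have -> : x - y = z - w by rewrite /z /w; ring.
have hz := sqrD_gt0 z a0; have hw := sqrD_gt0 w a0.
(* This exhibits the difference quotient of [q a]; the rest shows that it is at most [a^-1 * a^-1]
   in modulus. *)
have -> : z / (z ^+ 2 + a ^+ 2) - w / (w ^+ 2 + a ^+ 2) =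
    (z - w) * ((a ^+ 2 - z * w) / ((z ^+ 2 + a ^+ 2) * (w ^+ 2 + a ^+ 2))).
  by field; rewrite (gt_eqF hz) (gt_eqF hw).
rewrite normrM ler_wpM2l// normrM normfV (gtr0_norm (mulr_gt0 hz hw)).
rewrite ler_pdivrMr ?mulr_gt0//.
have aa : a ^+ 2 != 0 by rewrite gt_eqF// exprn_gt0.
rewrite -invfM -expr2 -(ler_pM2l (exprn_gt0 2 a0)) mulrA mulfV// mul1r.
rewrite -[X in X * _]ger0_norm ?sqr_ge0// -normrM ler_norml; apply/andP; split.
  have := sqr_ge0 (z - w); have := sqr_ge0 (z * w); have := sqr_ge0 a.
  have := mulr_ge0 (sqr_ge0 a) (sqr_ge0 (z - w)); have := mulr_ge0 (sqr_ge0 a) (sqr_ge0 z).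
  have := mulr_ge0 (sqr_ge0 a) (sqr_ge0 w); have := sqr_ge0 (a ^+ 2).
  by move=> h1 h2 h3 h4 h5 h6 h7; nra.
have := sqr_ge0 (z + w); have := sqr_ge0 (z * w); have := sqr_ge0 a.
have := mulr_ge0 (sqr_ge0 a) (sqr_ge0 (z + w)); have := mulr_ge0 (sqr_ge0 a) (sqr_ge0 z).
have := mulr_ge0 (sqr_ge0 a) (sqr_ge0 w); have := sqr_ge0 (a ^+ 2).
by move=> h1 h2 h3 h4 h5 h6 h7; nra.
Unshelve. all: by end_near. Qed.

Lemma conj_poisson_sqr_integral a s : 0 < a ->
  \int[mu]_x (q a (x - s) ^+ 2) = pi * p (a + a) 0.
Proof. by move=> a0; rewrite -(subrr s) -conj_poisson_conv. Qed.

Lemma N2_conj_poisson a s : 0 < a -> N2 (fun x => q a (x - s)) = Num.sqrt (pi * p (a + a) 0).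
Proof.
move=> a0; rewrite /ip_norm /ip2; congr Num.sqrt.
by rewrite -(conj_poisson_sqr_integral s a0); apply: eq_Rintegral => x _; rewrite expr2.
Qed.

(** Young's inequality for an integrable [g] and a square-integrable kernel: Cauchy-Schwarz with the
    weight [|g|] bounds [Q a g x ^+ 2] by the mass of [|g|] times the integral of
    [q a (x - s) ^+ 2 * |g s|] over [s], which is integrable in [x] by Fubini. *)
Lemma regHilbert_L2 a g : 0 < a -> itg g -> L2 (Q a g).
Proof.
move=> a0 ig; have mQ := continuous_measurable_fun (regHilbert_continuous a0 ig).
apply/L2P; split=> //; have mg := itg_measurable ig.
have mq := measurable_conj_poisson a0.
have b2 z : `|q a z ^+ 2| <= ((2 * a)^-1) ^+ 2.
  by rewrite normrX ler_pXn2r ?nnegrE//; [exact: conj_poisson_bound|rewrite invr_ge0 mulr_ge0// ltW].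
have iqs s : itg (fun x => q a (x - s) ^+ 2) by have /L2P[] := conj_poisson_L2 s a0.
case: (@Rintegral_fubini (fun x s => q a (x - s) ^+ 2 * `|g s|)
    (fun s => pi * p (a + a) 0 * `|g s|)) => [| | | | |iK _ _].
- apply: measurable_funM.
    by apply: (@measurable_kernel (fun z => q a z ^+ 2)); exact: measurable_funX.
  by apply: measurableT_comp => //; exact: measurableT_comp.
- move=> x; apply: itg_bounded_mul (itg_norm ig); last by move=> s; exact: b2.
  exact: (@measurable_sub_l x (fun z => q a z ^+ 2) (measurable_funX 2 mq)).
- by move=> s; have := itgZ `|g s| (iqs s); apply: eq_integrable => // x _ /=; rewrite mulrC.
- by apply: itgZ; exact: itg_norm.
- move=> s; rewrite (_ : Rintegral _ _ _ = \int[mu]_x (`|g s| * (q a (x - s) ^+ 2))).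
    by rewrite RintegralZl// conj_poisson_sqr_integral// mulrC.
  by apply: eq_Rintegral => x _; rewrite normrM normr_id mulrC (ger0_norm (sqr_ge0 _)).
- apply: (itg_le _ (itgZ (\int[mu]_s `|g s|) iK)); first exact: measurable_funX.
  move=> x; rewrite ger0_norm ?sqr_ge0//.
  have iqg := itg_bounded_mul (measurable_sub_l x (measurable_funX 2 mq)) (fun s => b2 (x - s)) (itg_norm ig).
  have sg : L2 (fun s => Num.sqrt `|g s|).
    apply/L2P; split.
      apply: measurableT_comp; last exact: measurableT_comp.
      by apply: continuous_measurable_fun; exact: sqrt_continuous.
    by have := itg_norm ig; apply: eq_integrable => // s _ /=; rewrite sqr_sqrtr.
  have sq : L2 (fun s => `|q a (x - s)| * Num.sqrt `|g s|).
    apply/L2P; split; first by apply: measurable_funM; [apply: measurableT_comp => //; exact: measurable_sub_l|exact: L2_measurable].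
    by move: iqg; apply: eq_integrable => // s _ /=; rewrite [(_ * Num.sqrt _) ^+ 2]exprMn sqr_sqrtr// real_normK ?num_real.
  have cs := ip_cauchy_schwarz ip2P sq sg.
  have : `|Q a g x| <= N2 (fun s => `|q a (x - s)| * Num.sqrt `|g s|) * N2 (fun s => Num.sqrt `|g s|).
    apply: le_trans cs; apply: le_trans (le_normr_Rintegral measurableT (regHilbert_itg x a0 ig)) _.
    rewrite ger0_norm; last by apply: Rintegral_ge0 => s _; rewrite !mulr_ge0 ?sqrtr_ge0.
    rewrite /ip2 (_ : Rintegral _ _ _ = \int[mu]_s (`|q a (x - s)| * Num.sqrt `|g s| * Num.sqrt `|g s|))//.
    by apply: eq_Rintegral => s _; rewrite -mulrA -expr2 sqr_sqrtr// normrM.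
  rewrite -(@ler_pXn2r _ 2)// ?nnegrE ?mulr_ge0 ?ip_norm_ge0// exprMn !(ip_normE ip2P)// real_normK ?num_real//.
  move=> h; apply: le_trans h _; rewrite mulrC le_eqVlt; apply/orP; left; apply/eqP.
  congr (_ * _); apply: eq_Rintegral => s _; first by rewrite -expr2 sqr_sqrtr.
  by rewrite -expr2 [(_ * Num.sqrt _) ^+ 2]exprMn sqr_sqrtr// real_normK ?num_real.
Qed.

End RegularizedHilbert.

(** * Square-integrable limit of the regularisations *)

Section RegularizedHilbertLimit.
Context {R : realType}.
Local Notation mu := (@lebesgue_measure R).
Local Notation itg f := (lebesgue_integrable f).
Local Notation N2 := (ip_norm ip2).
Local Notation q := conj_poisson.
Local Notation p := poisson.
Local Notation Q := regHilbert.
Implicit Types (f g h F W : R -> R) (a b c s t x z : R).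

Lemma RintegralZ c f : itg f -> \int[mu]_x (c * f x) = c * \int[mu]_x f x.
Proof. by move=> jf; exact: RintegralZl. Qed.

Lemma Rintegral_norm_mul_le f g : L2 f -> L2 g ->
  \int[mu]_x `|f x * g x| <= N2 f * N2 g.
Proof.
move=> hf hg; rewrite -(N2_norm_fun f) -(N2_norm_fun g).
apply: le_trans (ip_cauchy_schwarz ip2P (L2_norm_fun hf) (L2_norm_fun hg)).
apply: le_trans (ler_norm _); rewrite /ip2.
by under eq_Rintegral do rewrite normrM.
Qed.

Lemma regHilbert_conj_poisson a b g t : 0 < a -> 0 < b -> itg g ->
  \int[mu]_x (Q a g x * q b (x - t)) = pi * \int[mu]_s (p (a + b) (s - t) * g s).
Proof.
move=> a0 b0 ig; have ab0 : 0 < a + b by rewrite addr_gt0.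
have mg := itg_measurable ig.
have mqa := measurable_conj_poisson a0; have mqb := measurable_conj_poisson b0.
have La s := conj_poisson_L2 s a0; have Lb := conj_poisson_L2 t b0.
case: (@Rintegral_fubini _ (fun x s => q b (x - t) * (q a (x - s) * g s))
   (fun s => N2 (fun x => q b (x - t)) * Num.sqrt (pi * p (a + a) 0) * `|g s|)) => [| | | | |_ _ E].
- apply: measurable_funM.
    by apply: (@measurableT_comp _ _ _ _ _ _ (q b)) => //; exact: measurable_funB.
  by apply: measurable_funM; [exact: measurable_kernel|exact: measurableT_comp].
- by move=> x; apply: itgZ; exact: regHilbert_itg.
- move=> s; have := itgZ (g s) (L2_mul Lb (La s)).
  by apply: eq_integrable => // x _ /=; congr EFin; ring.
- by apply: itgZ; exact: itg_norm.
- move=> s; rewrite (_ : Rintegral _ _ _ = \int[mu]_x (`|g s| * `|q b (x - t) * q a (x - s)|)); last first.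
    by apply: eq_Rintegral => x _; rewrite -normrM; congr (`|_|); ring.
  rewrite RintegralZ//; last by apply: itg_norm; exact: L2_mul.
  by rewrite mulrC ler_wpM2r// -(N2_conj_poisson s a0); exact: Rintegral_norm_mul_le.
transitivity (\int[mu]_x \int[mu]_s (q b (x - t) * (q a (x - s) * g s))).
  apply: eq_Rintegral => x _.
  by rewrite RintegralZ; [exact: mulrC|exact: regHilbert_itg].
have jpg : itg (fun s => p (a + b) (s - t) * g s).
  apply: (@itg_bounded_mul _ _ ((a + b)^-1)) ig.
    by apply: measurable_sub_r; exact: measurable_poisson.
  by move=> s; rewrite ger0_norm ?poisson_ge0//; exact: poisson_bound.
rewrite E; apply: etrans (RintegralZ pi jpg); apply: eq_Rintegral => s _.
transitivity (g s * (pi * p (a + b) (s - t))); last by ring.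
rewrite -(conj_poisson_conv s t a0 b0) -(RintegralZ (g s) (L2_mul (La s) Lb)).
by apply: eq_Rintegral => x _; ring.
Qed.

Definition poissonForm c g := \int[mu]_t ((\int[mu]_s (p c (s - t) * g s)) * g t).

(** Two exchanges of integrals, one for each argument, reduce the scalar product to
    [conj_poisson_conv]; only [a + b] survives. *)
Lemma regHilbert_form a b g : 0 < a -> 0 < b -> itg g ->
  ip2 (Q a g) (Q b g) = pi * poissonForm (a + b) g.
Proof.
move=> a0 b0 ig; have mg := itg_measurable ig.
have ab0 : 0 < a + b by rewrite addr_gt0.
have LQ := regHilbert_L2 a0 ig; have mQ := L2_measurable LQ.
have mqb := measurable_conj_poisson b0.
case: (@Rintegral_fubini _ (fun x t => Q a g x * (q b (x - t) * g t))
   (fun t => N2 (Q a g) * Num.sqrt (pi * p (b + b) 0) * `|g t|)) => [| | | | |_ It E].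
- apply: measurable_funM; first exact: measurableT_comp.
  by apply: measurable_funM; [exact: measurable_kernel|exact: measurableT_comp].
- by move=> x; apply: itgZ; exact: regHilbert_itg.
- move=> t; have := itgZ (g t) (L2_mul LQ (conj_poisson_L2 t b0)).
  by apply: eq_integrable => // x _ /=; congr EFin; ring.
- by apply: itgZ; exact: itg_norm.
- move=> t; have Lb := conj_poisson_L2 t b0.
  rewrite (_ : Rintegral _ _ _ = \int[mu]_x (`|g t| * `|Q a g x * q b (x - t)|)); last first.
    by apply: eq_Rintegral => x _; rewrite -normrM; congr (`|_|); ring.
  rewrite RintegralZ//; last by apply: itg_norm; exact: L2_mul.
  by rewrite mulrC ler_wpM2r// -(N2_conj_poisson t b0); exact: Rintegral_norm_mul_le.
transitivity (\int[mu]_x \int[mu]_t (Q a g x * (q b (x - t) * g t))).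
  apply: eq_Rintegral => x _.
  by rewrite RintegralZ; [|exact: regHilbert_itg].
have H t : \int[mu]_x (Q a g x * (q b (x - t) * g t)) =
   pi * ((\int[mu]_s (p (a + b) (s - t) * g s)) * g t).
  transitivity (g t * (pi * \int[mu]_s (p (a + b) (s - t) * g s))); last by ring.
  rewrite -(regHilbert_conj_poisson t a0 b0 ig) -(RintegralZ (g t) (L2_mul LQ (conj_poisson_L2 t b0))).
  by apply: eq_Rintegral => x _; ring.
have pi0 : pi != 0 :> R by rewrite gt_eqF// pi_gt0.
have jP : itg (fun t => (\int[mu]_s (p (a + b) (s - t) * g s)) * g t).
  have := itgZ pi^-1 It; congr (mu.-integrable _ (EFin \o _)).
  by apply/funext => t; rewrite H mulKf.
rewrite E; apply: etrans (RintegralZ pi jP).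
by apply: eq_Rintegral => t _; exact: H.
Qed.

Lemma poisson_average c g : 0 < c -> itg g ->
  itg (fun t => \int[mu]_s (p c (s - t) * g s)) /\
  \int[mu]_t \int[mu]_s (p c (s - t) * g s) = pi * \int[mu]_s g s.
Proof.
move=> c0 ig; have mp := measurable_poisson c0; have mg := itg_measurable ig.
have ip s : itg (fun t => p c (s - t)).
  by have [h _] := poisson_itg s c0; move: h; apply: eq_integrable => // t _ /=; rewrite -poissonC opprB.
have Ip s : \int[mu]_t p c (s - t) = pi.
  by have [_ <-] := poisson_itg s c0; apply: eq_Rintegral => t _; rewrite -poissonC opprB.
case: (@Rintegral_fubini _ (fun t s => p c (s - t) * g s) (fun s => pi * `|g s|)) => [| | | | |h1 _ E].
- apply: measurable_funM; last exact: measurableT_comp.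
  by apply: (@measurableT_comp _ _ _ _ _ _ (p c)) => //; exact: measurable_funB.
- move=> t; apply: (@itg_bounded_mul _ _ (c^-1)) ig; first exact: measurable_sub_r.
  by move=> s; rewrite ger0_norm ?poisson_ge0//; exact: poisson_bound.
- by move=> s; have := itgZ (g s) (ip s); apply: eq_integrable => // t _ /=; rewrite mulrC.
- by apply: itgZ; exact: itg_norm.
- move=> s; rewrite (_ : Rintegral _ _ _ = \int[mu]_t (`|g s| * p c (s - t))).
    by rewrite RintegralZ// Ip mulrC.
  by apply: eq_Rintegral => t _; rewrite normrM mulrC (ger0_norm (poisson_ge0 _ c0)).
split => //; rewrite E; apply: etrans (RintegralZ pi ig); apply: eq_Rintegral => s _.
rewrite mulrC -(Ip s) -(RintegralZ (g s) (ip s)).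
by apply: eq_Rintegral => t _; exact: mulrC.
Qed.

(** Schur's test: [g s * g t] is at most half the sum of the squares, and the kernel has mass [pi]
    in either variable. *)
Lemma poissonForm_le c g : 0 < c -> itg g -> L2 g -> poissonForm c g <= pi * ip2 g g.
Proof.
move=> c0 ig lg; have mp := measurable_poisson c0; have mg := itg_measurable ig.
have [iP _] := poisson_average c0 ig.
have [_ ig2] := proj1 (L2P g) lg.
have [iP2 EP2] := poisson_average c0 ig2.
have pb t s : `|p c (s - t)| <= c^-1 by rewrite ger0_norm ?poisson_ge0//; exact: poisson_bound.
have ipg t : itg (fun s => p c (s - t) * g s).
  by apply: itg_bounded_mul (pb t) ig; exact: measurable_sub_r.
have ipg2 t : itg (fun s => p c (s - t) * g s ^+ 2).
  by apply: itg_bounded_mul (pb t) ig2; exact: measurable_sub_r.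
have ipt t : itg (fun s => p c (s - t)) by have [] := poisson_itg t c0.
have iPg : itg (fun t => (\int[mu]_s (p c (s - t) * g s)) * g t).
  apply: (itg_bounded_mul (itg_measurable iP) _ ig) => t.
  apply: le_trans (le_normr_Rintegral measurableT (ipg t)) _.
  instantiate (1 := c^-1 * \int[mu]_s `|g s|).
  rewrite -RintegralZ//; last exact: itg_norm.
  apply: le_Rintegral => //; [exact: itg_norm|by apply: itgZ; exact: itg_norm|].
  by move=> s _; rewrite normrM ler_wpM2r.
have iR : itg (fun t => 2^-1 * \int[mu]_s (p c (s - t) * g s ^+ 2) + 2^-1 * pi * g t ^+ 2).
  by apply: itgD; exact: itgZ.
apply: (@le_trans _ _ (\int[mu]_t (2^-1 * \int[mu]_s (p c (s - t) * g s ^+ 2) + 2^-1 * pi * g t ^+ 2))).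
  apply: le_Rintegral => // t _.
  have [_ Ep] := poisson_itg t c0.
  rewrite mulrC -RintegralZ//.
  have -> : 2^-1 * \int[mu]_s (p c (s - t) * g s ^+ 2) + 2^-1 * pi * g t ^+ 2 =
      \int[mu]_s (2^-1 * (p c (s - t) * g s ^+ 2) + 2^-1 * g t ^+ 2 * p c (s - t)).
    have i1 : itg (fun s => 2^-1 * (p c (s - t) * g s ^+ 2)) by exact: itgZ.
    have i2 : itg (fun s => 2^-1 * g t ^+ 2 * p c (s - t)) by exact: itgZ.
    rewrite [RHS]RintegralD//; congr (_ + _); first by rewrite [RHS]RintegralZ.
    by rewrite [RHS]RintegralZ// Ep; ring.
  apply: le_Rintegral => //; [exact: itgZ|by apply: itgD; exact: itgZ|].
  move=> s _; have := mulr_ge0 (poisson_ge0 (s - t) c0) (sqr_ge0 (g s - g t)).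
  by rewrite sqrrB; lra.
rewrite RintegralD//; [|exact: itgZ|exact: itgZ].
rewrite !RintegralZ// EP2 /ip2.
rewrite (_ : \int[mu]_x (g x * g x) = \int[mu]_x (g x ^+ 2)); first lra.
by apply: eq_Rintegral => x _; rewrite expr2.
Qed.

Lemma regHilbert_N2_le a g : 0 < a -> itg g -> L2 g -> N2 (Q a g) <= pi * N2 g.
Proof.
move=> a0 ig lg; rewrite -(@ler_pXn2r _ 2)// ?nnegrE ?mulr_ge0 ?ip_norm_ge0 ?pi_ge0//.
rewrite exprMn !(ip_normE ip2P)//; last exact: regHilbert_L2.
rewrite regHilbert_form// expr2 -mulrA ler_pM2l ?pi_gt0//.
by apply: poissonForm_le => //; rewrite addr_gt0.
Qed.

(* A bounded midpoint-convex function on the positive half-line is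
   nonincreasing, hence has a limit at 0. *)
Lemma midpoint_convex_cauchy (phi : R -> R) B :
  (forall a b, 0 < a -> 0 < b -> 0 <= phi (a + a) + phi (b + b) - 2 * phi (a + b)) ->
  (forall c, 0 < c -> phi c <= B) ->
  exists y : nat -> R, (forall n, 0 < y n <= 2^-1 ^+ n) /\
    forall n, phi (y n + y n) + phi (y n.+1 + y n.+1) - 2 * phi (y n + y n.+1) <= (2^-1 ^+ n) ^+ 2.
Proof.
move=> cvx phiB.
have mono x k : 0 < x -> 0 < k -> phi (x + k) <= phi x.
  move=> x0 k0; rewrite leNgt; apply/negP => lt; set D := phi (x + k) - phi x.
  have D0 : 0 < D by rewrite subr_gt0.
  (* Midpoint convexity makes the increments over consecutive steps of length [k] nondecreasing, so
     one increase [D > 0] forces linear growth against the bound [B]. *)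
  have inc n : D <= phi (x + n.+1%:R * k) - phi (x + n%:R * k).
    elim: n => [|n IH]; first by rewrite mul1r mul0r addr0.
    have nk0 m : 0 <= m%:R * k by rewrite mulr_ge0 ?ler0n ?ltW.
    have := cvx (2^-1 * (x + n%:R * k)) (2^-1 * (x + n.+2%:R * k)).
    have e1 : 2^-1 * (x + n%:R * k) + 2^-1 * (x + n%:R * k) = x + n%:R * k by lra.
    have e2 : 2^-1 * (x + n.+2%:R * k) + 2^-1 * (x + n.+2%:R * k) = x + n.+2%:R * k by lra.
    have e3 : 2^-1 * (x + n%:R * k) + 2^-1 * (x + n.+2%:R * k) = x + n.+1%:R * k.
      by rewrite -!natr1; field.
    rewrite e1 e2 e3 => /(_ _ _) h.
    have {}h := h _ _.
    have p1 : 0 < 2^-1 * (x + n%:R * k) by rewrite mulr_gt0// ltr_pwDl.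
    have p2 : 0 < 2^-1 * (x + n.+2%:R * k) by rewrite mulr_gt0// ltr_pwDl.
    by have := h p1 p2; lra.
  have lin n : phi x + n%:R * D <= phi (x + n%:R * k).
    elim: n => [|n IH]; first by rewrite !mul0r !addr0.
    by have := inc n; rewrite -natr1 mulrDl mul1r; lra.
  have Bx : 0 <= (B - phi x) / D by rewrite divr_ge0 ?(ltW D0)// subr_ge0 phiB.
  have /truncn_itv/andP[_] := Bx; rewrite ltr_pdivrMr//.
  set m := (Num.truncn _).+1 => h.
  have := lin m; have := phiB (x + m%:R * k).
  rewrite ltr_pwDl ?mulr_ge0 ?ler0n ?(ltW k0)// => /(_ isT); lra.
have {}mono x z : 0 < x -> x <= z -> phi z <= phi x.
  move=> x0; rewrite le_eqVlt => /predU1P[->//|xz].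
  by have := mono x (z - x) x0; rewrite subr_gt0 addrC subrK; exact.
pose S := [set phi c | c in [set c : R | 0 < c]].
have hS : has_sup S.
  split; first by exists (phi 1), 1 => //=.
  by exists B => _ [c c0 <-]; exact: phiB.
pose L := sup S.
have phiL c : 0 < c -> phi c <= L.
  by move=> c0; apply: (ub_le_sup hS.2); exists c.
(* Each [y n] is chosen so that [phi (y n + y n)] is within half of [4^-n] of the supremum; by
   monotonicity so is the mixed value, and the second difference is at most [4^-n]. *)
have /choice[y hy] : forall n, exists y : R, (0 < y <= 2^-1 ^+ n) /\ L - 2^-1 * (2^-1 ^+ n) ^+ 2 <= phi (y + y).
  move=> n; have e0 : 0 < 2^-1 * (2^-1 ^+ n) ^+ 2 :> R by rewrite mulr_gt0// exprn_gt0// half_expn_gt0.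
  have [_ [c /= c0 <-] Lc] := sup_adherent e0 hS.
  have hn := @half_expn_gt0 R n.
  exists (Num.min (2^-1 * c) (2^-1 ^+ n)); split.
    by rewrite lt_min hn mulr_gt0//= ge_min lexx orbT.
  apply: le_trans (ltW Lc) _; apply: mono; first by rewrite addr_gt0// lt_min hn mulr_gt0.
  have : Num.min (2^-1 * c) (2^-1 ^+ n) <= 2^-1 * c by rewrite ge_min lexx.
  by lra.
exists y; split => [n|n]; first by have [] := hy n.
have [/andP[y1 _] h1] := hy n; have [/andP[y2 _] h2] := hy n.+1.
have := phiL _ (addr_gt0 y1 y1); have := phiL _ (addr_gt0 y2 y2) => l1 l2.
have e2 : (2^-1 ^+ n.+1) ^+ 2 <= (2^-1 ^+ n) ^+ 2 :> R.
  by rewrite ler_pXn2r ?nnegrE ?(ltW (half_expn_gt0 _))// exprS ler_piMl ?(ltW (half_expn_gt0 _))// invf_le1// ler1n.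
suff : L - 2^-1 * (2^-1 ^+ n) ^+ 2 <= phi (y n + y n.+1) by lra.
case: (leP (y n) (y n.+1)) => yy.
  apply: le_trans (mono _ (y n.+1 + y n.+1) (addr_gt0 y1 y2) _); last by rewrite lerD2r.
  by apply: le_trans h2; lra.
apply: le_trans (mono _ (y n + y n) (addr_gt0 y1 y2) _); last by rewrite lerD2l ltW.
exact: h1.
Qed.

(** [k] is a limit in [L^2] and is not compared with the principal value of [g]. It serves as a
    derivative: [hilbert_ac_pair] applies the lemma to the derivative of a function whose own
    transform is known pointwise. *)
Lemma regHilbert_limit g : itg g -> L2 g -> exists (y : nat -> R) k,
  [/\ forall n, 0 < y n, y n @[n --> \oo] --> (0 : R), L2 k, N2 k <= pi * N2 g &
      forall n, N2 (Q (y n) g - k) <= 2 * Num.sqrt pi * 2^-1 ^+ n].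
Proof.
move=> ig lg; have pi0 := @pi_gt0 R.
have D a b : 0 < a -> 0 < b -> N2 (Q a g - Q b g) ^+ 2 =
    pi * (poissonForm (a + a) g + poissonForm (b + b) g - 2 * poissonForm (a + b) g).
  move=> a0 b0; have La := regHilbert_L2 a0 ig; have Lb := regHilbert_L2 b0 ig.
  rewrite (ip_normE ip2P); last exact: L2B.
  rewrite (ip_subl ip2P)//; last exact: L2B.
  rewrite !(ip_subr ip2P)// (ip_sym ip2P Lb La).
  rewrite (regHilbert_form a0 a0 ig) (regHilbert_form a0 b0 ig) (regHilbert_form b0 b0 ig).
  by move: (poissonForm _ g) (poissonForm _ g) (poissonForm _ g) => u v w; lra.
have cvx a b : 0 < a -> 0 < b ->
    0 <= poissonForm (a + a) g + poissonForm (b + b) g - 2 * poissonForm (a + b) g.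
  by move=> a0 b0; rewrite -(pmulr_rge0 _ pi0) -D// sqr_ge0.
have le c : 0 < c -> poissonForm c g <= pi * ip2 g g by move=> c0; exact: poissonForm_le.
have [y [y0 yC]] := midpoint_convex_cauchy cvx le.
have yp n : 0 < y n by have /andP[] := y0 n.
have C n : N2 (Q (y n.+1) g - Q (y n) g) <= Num.sqrt pi * 2^-1 ^+ n.
  have s0 := ltW (@half_expn_gt0 R n).
  rewrite (ip_normBC ip2P); [|exact: regHilbert_L2|exact: regHilbert_L2].
  rewrite -(@ler_pXn2r _ 2)// ?nnegrE ?mulr_ge0 ?ip_norm_ge0 ?sqrtr_ge0//.
  by rewrite D// exprMn sqr_sqrtr ?(ltW pi0)// ler_pM2l.
have [k [Lk Ck aek]] := L2_complete_ae (fun n => regHilbert_L2 (yp n) ig) C.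
exists y, k; split => //.
- apply/cvgr0Pnorm_lt => e e0; have : (2^-1 : R) ^+ n @[n --> \oo] --> (0 : R).
    by apply: cvg_expr; rewrite ger0_norm// invf_lt1// ltr1n.
  move=> /cvgr0Pnorm_lt/(_ e e0); apply: filterS => n; apply: le_lt_trans.
  have /andP[h1 h2] := y0 n; have s0 := ltW (@half_expn_gt0 R n).
  by rewrite (ger0_norm (ltW h1)) (ger0_norm s0).
- have [] := L2_fatou (L2_measurable Lk) (fun n => regHilbert_L2 (yp n) ig) aek
    (fun n => regHilbert_N2_le (yp n) ig lg).
  by [].
Qed.

End RegularizedHilbertLimit.

(** * The principal value and its bounds *)

Section HilbertTransform.
Context {R : realType}.
Local Notation mu := (@lebesgue_measure R).
Local Notation itg f := (lebesgue_integrable f).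
Local Notation N2 := (ip_norm ip2).
Local Notation q := conj_poisson.
Local Notation p := poisson.
Local Notation Q := regHilbert.
Local Notation dq := conj_poisson_derive.
Implicit Types (f g h F W k : R -> R) (a b c e r s t x z : R).

(** Integration by parts over the whole line; [ac_pair_integral0] accounts for the boundary
    terms. *)
Lemma regHilbert_derive a f g x : 0 < a -> ac_pair f g -> itg f -> itg g ->
  Q a g x = \int[mu]_s (dq a (x - s) * f s).
Proof.
move=> a0 fg jf jg; have pp := ac_pair_product (conj_poisson_ac_pair x a0) fg.
have i1 := regHilbert_itg x a0 jf; have i2 := regHilbert_itg x a0 jg.
have i3 : itg (fun s => dq a (x - s) * f s).
  apply: (@itg_bounded_mul _ _ (a^-1 * a^-1)) jf.
    by apply: measurable_sub_l; exact: measurable_conj_poisson_derive.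
  by move=> s; exact: conj_poisson_derive_bound.
have E : (fun s => q a (x - s) * g s + - dq a (x - s) * f s) =
    (fun s => q a (x - s) * g s - dq a (x - s) * f s).
  by apply/funext => s; rewrite mulNr.
move: pp; rewrite E => pp.
have := ac_pair_integral0 pp i1 (itgB i2 i3).
by rewrite RintegralB// => /eqP; rewrite subr_eq0 => /eqP.
Qed.

(** Integrating [dq a] over [[b, c]] under the integral sign, by Fubini, replaces differentiation
    under it. *)
Lemma regHilbert_primitive a f g : 0 < a -> ac_pair f g -> itg f -> itg g ->
  primitive (Q a g) (Q a f).
Proof.
move=> a0 fg jf jg b c bc; have mf := itg_measurable jf.
have mdq := measurable_conj_poisson_derive a0.
have i3 x : itg (fun s => dq a (x - s) * f s).
  apply: (@itg_bounded_mul _ _ (a^-1 * a^-1)) jf; first exact: measurable_sub_l.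
  by move=> s; exact: conj_poisson_derive_bound.
case: (@Rintegral_fubini _ (fun x s => \1_`[b, c] x * (dq a (x - s) * f s))
   (fun s => (c - b) * (a^-1 * a^-1) * `|f s|)) => [| | | | |_ _ E].
- apply: measurable_funM.
    by apply: (@measurableT_comp _ _ _ _ _ _ (\1_`[b, c] : R -> R)) => //; exact: measurable_indic.
  by apply: measurable_funM; [exact: measurable_kernel|exact: measurableT_comp].
- by move=> x; exact: itgZ.
- move=> s; have := itgZ (f s) (L2_mul (L2_indic b c) (conj_poisson_derive_L2 s a0)).
  by apply: eq_integrable => // x _ /=; congr EFin; ring.
- by apply: itgZ; exact: itg_norm.
- move=> s; have i4 := itgZ (a^-1 * a^-1 * `|f s|) (L2_mul (L2_indic b c) (L2_indic b c)).
  apply: (@le_trans _ _ (\int[mu]_x (a^-1 * a^-1 * `|f s| * (\1_`[b, c] x * \1_`[b, c] x)))).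
    apply: le_Rintegral => //.
      apply: itg_norm; have := itgZ (f s) (L2_mul (L2_indic b c) (conj_poisson_derive_L2 s a0)).
      by apply: eq_integrable => // x _ /=; congr EFin; ring.
    move=> x _; rewrite indicE; case: (_ \in _); rewrite ?mul0r ?normr0 ?mulr0// !mul1r mulr1 normrM.
    by rewrite ler_wpM2r//; exact: conj_poisson_derive_bound.
  rewrite RintegralZl//; last by apply: L2_mul; exact: L2_indic.
  rewrite -[Rintegral _ _ _]/(ip2 (\1_`[b, c]) (\1_`[b, c])) ip2_indic//.
  by rewrite le_eqVlt; apply/orP; left; apply/eqP; ring.
have E1 : \int[mu]_(x in `[b, c]) Q a g x =
    \int[mu]_x \int[mu]_s (\1_`[b, c] x * (dq a (x - s) * f s)).
  rewrite Rintegral_segE; apply: eq_Rintegral => x _.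
  by rewrite (regHilbert_derive x a0 fg jf jg) RintegralZl.
have i1 := regHilbert_itg c a0 jf; have i2 := regHilbert_itg b a0 jf.
have E2 : Q a f c - Q a f b = \int[mu]_s (q a (c - s) * f s - q a (b - s) * f s) by rewrite RintegralB.
rewrite E1 E E2; apply: eq_Rintegral => s _.
have pq : primitive (fun x => dq a (x - s)) (fun x => q a (x - s)).
  apply: primitive_of_derive; first by move=> x; exact: is_derive_conj_poisson.
  exact: continuous_conj_poisson_derive.
rewrite -mulrBl (pq _ _ bc) Rintegral_segE mulrC.
have i4 := L2_mul (L2_indic b c) (conj_poisson_derive_L2 s a0).
by apply: etrans (esym (RintegralZ (f s) i4)) _; apply: eq_Rintegral => x _; ring.
Qed.

(** A primitive of an odd function is even. *)
Lemma odd_integral0 k x r : continuous k -> (forall z, k (- z) = - k z) -> 0 <= r ->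
  \int[mu]_(s in `[x - r, x + r]) k (x - s) = 0.
Proof.
move=> ck odd r0; have [K pK] := primitive_exists (fun a b => continuous_seg_itg a b ck).
have dK := derive_of_primitive ck pK.
have dN c z : is_derive z (1 : R) (fun y => K (c - y)) (- k (c - z)).
  have := @is_derive1_comp _ K (fun y => -1 * y + c) z (k (-1 * z + c)) (-1).
  rewrite (_ : K \o _ = (fun y => K (c - y))); last by apply/funext => y /=; congr K; ring.
  move=> /(_ (dK _) (is_derive_affine _ _ _)) h; apply: is_derive_eq h _.
  by rewrite mulrN1; congr (- k _); ring.
have even z : K z = K (- z).
  have := @is_derive_0_is_cst _ (fun y => K y - K (0 - y)) z 0.
  rewrite !subrr sub0r => h; suff /h/eqP : forall y, is_derive y (1 : R) (fun y => K y - K (0 - y)) 0.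
    by rewrite subr_eq0 => /eqP.
  move=> y; have := is_derive_add (dK y) (is_derive_scale (-1) (dN 0 y)).
  rewrite mulN1r opprK sub0r odd subrr.
  by congr is_derive; apply/funext => t; rewrite mulN1r.
have pr : primitive (fun s => k (x - s)) (fun s => - K (x - s)).
  apply: primitive_of_derive.
    move=> s; have := is_derive_scale (-1) (dN x s); rewrite mulN1r opprK.
    by congr is_derive; apply/funext => t; rewrite mulN1r.
  move=> s; apply: continuous_comp; last exact: ck.
  by apply: cvgB; [exact: cvg_cst|exact: cvg_id].
rewrite -pr; last by rewrite lerD2l; lra.
by rewrite opprD addrA subrr sub0r subKr -even subrr.
Qed.

Lemma indic_itg f a b : continuous f -> itg (fun x => \1_`[a, b] x * f x).
Proof.
move=> cf; have := seg_itg_patch (continuous_seg_itg a b cf).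
apply: eq_integrable => // x _ /=; rewrite patchE indicE.
by case: (_ \in _); rewrite ?mul1r ?mul0r.
Qed.

(* [(z^2 + c^2)^(-1/4)] is at most twice the derivative of the bounded function
   [z (z^2 + c^2)^(-1/4)], uniformly in [c]. *)
Lemma sqrt_kernel_le c x : 0 < c ->
  \int[mu]_s (\1_`[x - 1, x + 1] s * expR (- 4^-1 * ln ((s - x) ^+ 2 + c ^+ 2))) <= 4.
Proof.
move=> c0; pose w s := expR (- 4^-1 * ln ((s - x) ^+ 2 + c ^+ 2)).
have dw s : is_derive s (1 : R) w (w s * (- 4^-1 * (2 * q c (s - x)))).
  exact: (@is_derive1_comp _ expR _ s _ _ (is_derive_expR _)
     (is_derive_scale (- 4^-1) (is_derive_ln_kernel x s c0))).
have cw : continuous w by move=> s; exact: is_derive_continuous (dw s).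
have dG s := is_derive_mul (is_derive_shift x s) (dw s).
have cq := continuous_conj_poisson (s := x) c0.
have cs : continuous (fun s => s - x) by move=> s; exact: is_derive_continuous (is_derive_shift x s).
have cG : continuous (fun s => 1 * w s + (s - x) * (w s * (- 4^-1 * (2 * q c (s - x))))).
  move=> s; apply: cvgD; first by apply: cvgM; [exact: cvg_cst|exact: cw].
  apply: cvgM; first exact: cs.
  apply: cvgM; first exact: cw.
  apply: cvgM; first exact: cvg_cst.
  by apply: cvgM; [exact: cvg_cst|exact: cq].
have pG := primitive_of_derive dG cG.
have w1 s : (s - x) ^+ 2 = 1 -> w s <= 1.
  move=> E; rewrite /w E -expR0 ler_expR mulNr oppr_le0 mulr_ge0 ?invr_ge0//.
  by rewrite expR0 ln_ge0// lerDl sqr_ge0.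
rewrite -[Rintegral _ _ _]/(ip2 _ _) -Rintegral_segE.
apply: (@le_trans _ _ (\int[mu]_(s in `[x - 1, x + 1]) (2 * (1 * w s + (s - x) * (w s * (- 4^-1 * (2 * q c (s - x)))))))).
  apply: le_Rintegral => //; [exact: continuous_seg_itg|by apply: seg_itgZ; exact: continuous_seg_itg|].
  move=> s _; rewrite -/(w s).
  have w0 : 0 < w s := expR_gt0 _.
  have q0 : (s - x) * q c (s - x) <= 1.
    rewrite /q mulrA ler_pdivrMr ?sqrD_gt0// mul1r -expr2 lerDl sqr_ge0//.
  have := ler_wpM2l (ltW w0) q0; lra.
rewrite RintegralZl//; last exact: continuous_seg_itg.
rewrite -pG; last lra.
have := w1 (x + 1); have := w1 (x - 1).
have -> : x - 1 - x = -1 by ring.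
have -> : x + 1 - x = 1 by ring.
rewrite sqrrN expr1n => /(_ erefl) h1 /(_ erefl) h2; lra.
Qed.

(** The kernel is [|s - x|] to the power [-1/2], which is what Hoelder continuity of exponent 1/2
    leaves of the singularity [1/z]. Its square root, with the exponent [- 8^-1], is a pointwise
    limit of regularisations bounded in [L^2] by [sqrt_kernel_le]. *)
Lemma sqrt_kernel_itg x : itg (fun s => \1_`[x - 1, x + 1] s * expR (- 4^-1 * ln ((s - x) ^+ 2))).
Proof.
pose u c s := expR (- 8^-1 * ln ((s - x) ^+ 2 + c)).
have u2 c s : u c s ^+ 2 = expR (- 4^-1 * ln ((s - x) ^+ 2 + c)).
  by rewrite expr2 -expRD; congr expR; lra.
pose f n s := \1_`[x - 1, x + 1] s * u ((n.+1%:R^-1) ^+ 2) s.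
have c0 n : 0 < n.+1%:R^-1 :> R by rewrite invr_gt0 ltr0n.
have i2 s : (\1_`[x - 1, x + 1] s : R) ^+ 2 = \1_`[x - 1, x + 1] s.
  by rewrite indicE; case: (_ \in _); rewrite ?expr1n ?expr0n.
have f2 n s : f n s ^+ 2 = \1_`[x - 1, x + 1] s * expR (- 4^-1 * ln ((s - x) ^+ 2 + (n.+1%:R^-1) ^+ 2)).
  by rewrite /f [LHS]exprMn u2 i2.
have cu a n : continuous (fun s => expR (a * ln ((s - x) ^+ 2 + (n.+1%:R^-1) ^+ 2))).
  move=> s; apply: continuous_comp; last exact: continuous_expR.
  exact: is_derive_continuous (is_derive_scale a (is_derive_ln_kernel x s (c0 n))).
have Lf n : L2 (f n).
  apply/L2P; split.
    by apply: measurable_funM; [exact: measurable_indic|apply: continuous_measurable_fun; exact: cu].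
  by under eq_fun do rewrite f2; apply: indic_itg; exact: cu.
have Bf n : N2 (f n) <= 2.
  rewrite -(@ler_pXn2r _ 2)// ?nnegrE ?ip_norm_ge0// (ip_normE ip2P)// /ip2.
  under eq_Rintegral do rewrite -expr2 f2.
  by apply: le_trans (sqrt_kernel_le x (c0 n)) _; lra.
have mg : measurable_fun setT (fun s => \1_`[x - 1, x + 1] s * u 0 s).
  apply: measurable_funM; first exact: measurable_indic.
  apply: measurableT_comp; first exact: measurable_expR.
  apply: measurable_funM => //; apply: measurableT_comp; first exact: measurable_ln.
  by apply: measurable_funD => //; apply: measurable_funX; exact: measurable_funB.
have cvf : {ae mu, forall s, f n s @[n --> \oo] --> \1_`[x - 1, x + 1] s * u 0 s}.
  (* At [s = x] the logarithm of 0 takes a default value; the point is negligible. *)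
  apply: (@ae_off_null _ [set x]) => //; first exact: lebesgue_measure_set1.
  move=> s sx; apply: cvgM; first exact: cvg_cst.
  have sx0 : 0 < (s - x) ^+ 2.
    by rewrite exprn_even_gt0//= subr_eq0; apply/eqP.
  apply: (continuous_cvg _ (@continuous_expR R _)).
  apply: cvgM; first exact: cvg_cst.
  apply: continuous_cvg; first by rewrite addr0; exact: continuous_ln.
  apply: cvgD; first exact: cvg_cst.
  rewrite -[X in _ --> X](expr0n R 2); rewrite expr0n/=.
  apply: (eq_cvgn (v := fun n => n.+1%:R^-1 * n.+1%:R^-1) _ (esym (mulr0 0))) => [n|].
    by rewrite expr2.
  by apply: cvgM; exact: cvg_harmonic.
have [/L2P[_ + _]] := L2_fatou mg Lf cvf Bf.
by apply: eq_integrable => // s _ /=; rewrite [(_ * _) ^+ 2]exprMn u2 i2 addr0.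
Qed.

(** The heart of the pointwise theory, for any approximation of [1/z] whose integral over
    [[x - 1, x + 1]] vanishes. On this segment [f x] may be subtracted, and
    [|f s - f x| <= sqrt |s - x| * N2 g] turns the singularity into an integrable one; outside it,
    [|k n| <= 1]. The bounds [M n] may grow with [n]: they make each single integral converge. *)
Lemma odd_kernel_cvg f g x (k : nat -> R -> R) (M : nat -> R) : ac_pair f g -> itg f ->
  (forall n, measurable_fun setT (k n)) -> (forall n z, `|k n z| <= M n) ->
  (forall n z, `|k n z| <= `|z|^-1) -> (forall z, k n z @[n --> \oo] --> z^-1) ->
  (forall n, \int[mu]_(s in `[x - 1, x + 1]) k n (x - s) = 0) ->
  \int[mu]_s (k n (x - s) * f s) @[n --> \oo] -->
    \int[mu]_s ((x - s)^-1 * (f s - f x * \1_`[x - 1, x + 1] s)).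
Proof.
move=> fg jf mk kM k1 kcv k0; have mf := itg_measurable jf; have [_ Lg pf] := fg.
have j1 : itg (fun s => f x * \1_`[x - 1, x + 1] s).
  by apply: itgZ; exact: integrable_indic_itv.
have m1 := itg_measurable j1.
have ik n h : itg h -> itg (fun s => k n (x - s) * h s).
  by apply: itg_bounded_mul; [exact: measurable_sub_l|move=> s; exact: kM].
have E n : \int[mu]_s (k n (x - s) * f s) =
    \int[mu]_s (k n (x - s) * (f s - f x * \1_`[x - 1, x + 1] s)).
  transitivity (\int[mu]_s (k n (x - s) * f s - k n (x - s) * (f x * \1_`[x - 1, x + 1] s))).
    rewrite RintegralB//; [|exact: ik|exact: ik].
    suff -> : \int[mu]_s (k n (x - s) * (f x * \1_`[x - 1, x + 1] s)) = 0 by rewrite subr0.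
    rewrite -[RHS](mulr0 (f x)) -(k0 n) Rintegral_segE /ip2 -RintegralZl//.
      by apply: eq_Rintegral => s _; ring.
    have := ik n _ (integrable_indic_itv (x - 1) (x + 1) true false).
    by apply: eq_integrable => // s _ /=; rewrite mulrC.
  by apply: eq_Rintegral => s _; rewrite mulrBr.
apply: eq_cvgn E erefl _.
have minv : measurable_fun setT (fun s => (x - s)^-1).
  apply: (@measurable_fun_cvg _ _ _ setT (fun n s => k n (x - s))); last by move=> s _; exact: kcv.
  by move=> n; exact: measurable_sub_l.
have jw := itgD (itgZ (N2 g) (sqrt_kernel_itg x)) (itg_norm jf).
apply: (proj2 (Rintegral_dominated _ _ _ jw _)).
- move=> n; apply: measurable_funM; first exact: measurable_sub_l.
  exact: measurable_funB.
- exact: measurable_funM minv (measurable_funB mf m1).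
- by apply: aeW => s; apply: cvgM; [exact: kcv|exact: cvg_cst].
- move=> n s; rewrite normrM indicE.
  case: (boolP (s \in _)) => [_|]; last first.
    rewrite notin_setE/= in_itv/= => sx; rewrite mulr0 subr0 mul0r mulr0 add0r.
    apply: ler_piMl => //; apply: le_trans (k1 _ _) _; rewrite invf_le1.
      by rewrite leNgt; apply/negP; rewrite ltr_norml => /andP[h1 h2]; apply: sx; apply/andP; split; lra.
    rewrite normr_gt0; apply/eqP => h; apply: sx; apply/andP; split; lra.
  rewrite mulr1 mul1r; have [->|sx] := eqVneq s x.
    by rewrite (subrr (f x)) normr0 mulr0 addr_ge0// mulr_ge0 ?ip_norm_ge0 ?expR_ge0.
  apply: (@le_trans _ _ (N2 g * expR (- 4^-1 * ln ((s - x) ^+ 2)))); last by rewrite lerDl.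
  have hz : 0 < `|x - s| by rewrite normr_gt0 subr_eq0 eq_sym.
  apply: (@le_trans _ _ (`|x - s|^-1 * (Num.sqrt `|s - x| * N2 g))).
    by apply: ler_pM => //; exact: primitive_hoelder.
  rewrite mulrA mulrC ler_wpM2l ?ip_norm_ge0//.
  (* Fourth powers remove both roots and turn the comparison into an identity. *)
  rewrite -(@ler_pXn2r _ 4)// ?nnegrE ?expR_ge0 ?mulr_ge0 ?invr_ge0 ?sqrtr_ge0//.
  rewrite -expRM_natl mulrA (_ : 4%:R * - 4^-1 = -1); last lra.
  rewrite mulN1r expRN lnK ?posrE ?exprn_even_gt0 ?subr_eq0//= exprMn.
  have E4 t : 0 <= t -> Num.sqrt t ^+ 4 = t ^+ 2.
    by move=> t0; rewrite -[4%N]/(2 * 2)%N exprM sqr_sqrtr.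
  rewrite E4// -(real_normK (num_real (s - x))) (distrC s x).
  by rewrite le_eqVlt; apply/orP; left; apply/eqP; field; rewrite gt_eqF.
Qed.

Lemma conj_poisson_cvg (y : nat -> R) z : y n @[n --> \oo] --> (0 : R) ->
  q (y n) z @[n --> \oo] --> z^-1.
Proof.
move=> y0; have [->|z0] := eqVneq z 0.
  by apply: (eq_cvgn (v := fun=> 0) _ (invr0 _)) (cvg_cst _) => n; rewrite /q mul0r.
have -> : z^-1 = z / (z ^+ 2 + 0 * 0) by rewrite mulr0 addr0; field.
apply: cvgM; first exact: cvg_cst.
apply: cvgV; first by rewrite mulr0 addr0 expf_neq0.
apply: cvgD; first exact: cvg_cst.
exact: cvgM.
Qed.

Lemma conj_poisson_le_inv a z : 0 < a -> `|q a z| <= `|z|^-1.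
Proof.
move=> a0; have [->|z0] := eqVneq z 0; first by rewrite /q mul0r normr0 invr0.
rewrite /q normrM normfV (gtr0_norm (sqrD_gt0 z a0)).
have z1 : 0 < `|z| by rewrite normr_gt0.
rewrite ler_pdivrMr ?sqrD_gt0// ler_pdivlMl// -expr2 real_normK ?num_real//.
by rewrite lerDl sqr_ge0.
Qed.

(** [1/z] cut off at [|z| <= e], written as the continuous odd function [z / max(z^2, e^2)] minus
    its linear part on [[-e, e]], so that measurability and vanishing integrals reduce to the
    continuous case. *)
Definition truncated_inverse e z : R :=
  z * (Num.max (z ^+ 2) (e ^+ 2))^-1 - e^-1 ^+ 2 * (z * \1_`[- e, e] z).

Lemma truncated_inverseE e z : 0 < e ->
  truncated_inverse e z = if e < `|z| then z^-1 else 0.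
Proof.
move=> e0; rewrite /truncated_inverse indicE.
have E : (z \in `[- e, e]%classic) = (`|z| <= e) by rewrite mem_setE in_itv/= ler_norml.
have E2 : (e < `|z|) = (e ^+ 2 < z ^+ 2).
  by rewrite -(real_normK (num_real z)) ltr_pXn2r// nnegrE ltW.
rewrite E leNgt; case: (ltP e `|z|) => ez.
  have z0 : z != 0 by rewrite -normr_gt0 (lt_trans e0).
  by rewrite mulr0 mulr0 subr0 max_l; [field|rewrite ltW// -E2].
have h : z ^+ 2 <= e ^+ 2 by rewrite leNgt -E2 -leNgt.
by rewrite max_r// mulr1 exprVn mulrC subrr.
Qed.

Lemma truncated_inverse_integral0 e x : 0 < e ->
  \int[mu]_(s in `[x - 1, x + 1]) truncated_inverse e (x - s) = 0.
Proof.
move=> e0; pose k z := z * (Num.max (z ^+ 2) (e ^+ 2))^-1.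
have ck : continuous k.
  move=> z; apply: cvgM; first exact: cvg_id.
  apply: cvgV; first by rewrite gt_eqF// lt_max orbC exprn_gt0.
  apply: (@continuous_max _ R^o (fun z => z ^+ 2) (fun=> e ^+ 2) z); last exact: cst_continuous.
  exact: exprn_continuous.
have ck' : continuous (fun s => k (x - s)).
  move=> s; apply: (@continuous_comp R R R (fun s => x - s) k); last exact: ck.
  by apply: cvgB; [exact: cvg_cst|exact: cvg_id].
have ci : continuous (fun s : R => x - s).
  by move=> s; apply: cvgB; [exact: cvg_cst|exact: cvg_id].
have j1 := continuous_seg_itg (x - 1) (x + 1) ck'.
(* The windows [|x - s| <= 1] and [|x - s| <= e] meet in a window again centred at [x], so the
   subtracted linear piece also integrates to zero by oddness. *)
pose r := Num.min 1 e.
have r0 : 0 <= r by rewrite le_min ler01 ltW.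
have Er s : \1_`[x - 1, x + 1] s * \1_`[- e, e] (x - s) = \1_`[x - r, x + r] s :> R.
  rewrite !indicE !mem_setE !in_itv/= -natrM mulnb; congr (_%:R); congr nat_of_bool.
  by rewrite /r; case: (leP 1 e) => h; apply/idP/idP => [/andP[/andP[h1 h2] /andP[h3 h4]]|/andP[h1 h2]]; repeat (apply/andP; split); lra.
have j2 : seg_itg (fun s => (x - s) * \1_`[- e, e] (x - s)) (x - 1) (x + 1).
  apply: itg_seg; have := @indic_itg _ (x - e) (x + e) ci.
  apply: eq_integrable => // s _ /=; rewrite mulrC !indicE !mem_setE !in_itv/=; congr (EFin (_ * (_%:R))).
  by congr nat_of_bool; apply/idP/idP => /andP[h1 h2]; apply/andP; split; lra.
rewrite RintegralB//; last exact: seg_itgZ.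
rewrite (@odd_integral0 k)//; last by move=> z; rewrite /k sqrrN mulNr.
rewrite RintegralZl// Rintegral_segE /ip2.
have -> : \int[mu]_s (\1_`[x - 1, x + 1] s * ((x - s) * \1_`[- e, e] (x - s))) =
    \int[mu]_(s in `[x - r, x + r]) (x - s).
  by rewrite Rintegral_segE; apply: eq_Rintegral => s _; rewrite -Er; ring.
by rewrite (@odd_integral0 id)// ?mulr0 ?subrr// => z; exact: cvg_id.
Qed.

Lemma measurable_truncated_inverse e : 0 < e -> measurable_fun setT (truncated_inverse e).
Proof.
move=> e0; have mi := @measurable_indic _ R R setT `[- e, e]%classic.
apply: measurable_funB; last first.
  by apply: measurable_funM => //; apply: measurable_funM => //; exact: measurable_indic.
apply: continuous_measurable_fun => z; apply: cvgM; first exact: cvg_id.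
apply: cvgV; first by rewrite gt_eqF// lt_max orbC exprn_gt0.
apply: (@continuous_max _ R^o (fun z => z ^+ 2) (fun=> e ^+ 2) z); last exact: cst_continuous.
exact: exprn_continuous.
Qed.

(** The principal value and the regularisations are both instances of [odd_kernel_cvg], with the
    common limit [T]. *)
Lemma hilbert_cvg f g x (y : nat -> R) : ac_pair f g -> itg f ->
  (forall n, 0 < y n) -> y n @[n --> \oo] --> (0 : R) ->
  pi^-1 * Q (y n) f x @[n --> \oo] --> hilbert f x.
Proof.
move=> fg jf y0 ycv; pose T := \int[mu]_s ((x - s)^-1 * (f s - f x * \1_`[x - 1, x + 1] s)).
suff -> : hilbert f x = pi^-1 * T.
  apply: cvgn_scale; apply: (odd_kernel_cvg (k := fun n => q (y n)) (M := fun n => (2 * y n)^-1) fg jf).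
  - by move=> n; exact: measurable_conj_poisson.
  - by move=> n z; exact: conj_poisson_bound.
  - by move=> n z; exact: conj_poisson_le_inv.
  - by move=> z; exact: conj_poisson_cvg.
  - move=> n; apply: odd_integral0 => // [z|z].
      by have := continuous_conj_poisson (s := 0) (y0 n) (x := z); under eq_fun do rewrite subr0.
    by rewrite /q sqrrN mulNr.
rewrite /hilbert; congr (_ * _); apply: cvg_lim => //.
apply/cvg_at_rightP => e [e0 ecv].
have E n : \int[mu]_(s in [set s | e n < `|x - s|]) (f s / (x - s)) =
    \int[mu]_s (truncated_inverse (e n) (x - s) * f s).
  rewrite Rintegral_mkcond; apply: eq_Rintegral => s _.
  rewrite truncated_inverseE// patchE; case: ifPn => [/set_mem/= ->|]; first exact: mulrC.
  by rewrite notin_setE/= => /negP/negbTE ->; rewrite mul0r.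
apply: eq_cvgn E erefl _.
apply: (odd_kernel_cvg (k := fun n => truncated_inverse (e n)) (M := fun n => (e n)^-1) fg jf).
- by move=> n; exact: measurable_truncated_inverse.
- move=> n z; rewrite truncated_inverseE//; case: ifP => h; last by rewrite normr0 invr_ge0 ltW.
  by rewrite normfV lef_pV2 ?posrE// ?(ltW h)// (lt_trans (e0 n)).
- by move=> n z; rewrite truncated_inverseE//; case: ifP => h; rewrite ?normr0 ?normfV.
- move=> z; have [->|z0] := eqVneq z 0.
    apply: (eq_cvgn (v := fun=> 0) _ (invr0 _)) (cvg_cst _) => n.
    by rewrite truncated_inverseE// normr0 ltNge (ltW (e0 n)).
  apply: cvg_near_cst; have z1 : 0 < `|z| by rewrite normr_gt0.
  have /cvgr0Pnorm_lt/(_ _ z1) := ecv; apply: filterS => n.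
  by rewrite (gtr0_norm (e0 n)) truncated_inverseE// => ->.
- by move=> n; exact: truncated_inverse_integral0.
Qed.

Lemma harmonic_gt0 n : 0 < n.+1%:R^-1 :> R. Proof. by rewrite invr_gt0 ltr0n. Qed.

(** [hilbert] is a [lim], so its additivity is obtained from the regularisations, which converge to
    it. *)
Lemma hilbertB f1 g1 f2 g2 x : ac_pair f1 g1 -> itg f1 -> ac_pair f2 g2 -> itg f2 ->
  hilbert (f1 - f2) x = hilbert f1 x - hilbert f2 x.
Proof.
move=> p1 j1 p2 j2.
have p3 : ac_pair (f1 - f2) (g1 - g2).
  by rewrite -(scaleN1r f2) -(scaleN1r g2); apply: ac_pairD => //; exact: ac_pairZ.
have h : (n.+1%:R^-1 : R) @[n --> \oo] --> (0 : R) := @cvg_harmonic R.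
have c1 := hilbert_cvg (x := x) p1 j1 harmonic_gt0 h.
have c2 := hilbert_cvg (x := x) p2 j2 harmonic_gt0 h.
have c3 := hilbert_cvg (x := x) p3 (itgB j1 j2) harmonic_gt0 h.
rewrite -(cvg_lim _ c3)//; apply: cvg_lim => //.
apply: eq_cvgn _ erefl (cvgn_sub c1 c2) => n.
rewrite -mulrBr; congr (_ * _); rewrite /Q -RintegralB//; [|exact: regHilbert_itg|exact: regHilbert_itg].
by apply: eq_Rintegral => s _; rewrite mulrBr.
Qed.

(** Increments of [Q (y n) f] are integrals of [Q (y n) g]. The increments converge pointwise and
    the integrals by [L^2] convergence to [k], so the derivative of the transform is [pi^-1 *: k].
    The factor [pi^-1] cancels the operator bound [pi] of the regularisations. *)
Lemma hilbert_ac_pair f g : ac_pair f g -> itg f -> itg g -> exists k,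
  [/\ ac_pair (hilbert f) k, N2 (hilbert f) <= N2 f & N2 k <= N2 g].
Proof.
move=> fg jf jg; have [Lf Lg _] := fg; have pi0 := @pi_gt0 R.
have [y [k [y0 ycv Lk Nk Ck]]] := regHilbert_limit jg Lg.
pose h n := pi^-1 *: Q (y n) f.
have Lh n : L2 (h n) by apply: L2Z; exact: regHilbert_L2.
have hcv x : h n x @[n --> \oo] --> hilbert f x := hilbert_cvg (x := x) fg jf y0 ycv.
have mH : measurable_fun setT (hilbert f).
  apply: (@measurable_fun_cvg _ _ _ setT h) => [n|x _]; last exact: hcv.
  exact: L2_measurable.
have Nh n : N2 (h n) <= N2 f.
  rewrite (ip_normZ ip2P); last exact: regHilbert_L2.
  by rewrite gtr0_norm ?invr_gt0// ler_pdivrMl//; exact: regHilbert_N2_le.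
have aeh : {ae mu, forall x, h n x @[n --> \oo] --> hilbert f x} by exact: aeW.
have [LH NH] := L2_fatou mH Lh aeh Nh.
exists (pi^-1 *: k); split => //; last first.
  by rewrite (ip_normZ ip2P)// gtr0_norm ?invr_gt0// ler_pdivrMl.
split => //; first exact: L2Z.
move=> a b ab; have c1 := cvgn_sub (hcv b) (hcv a).
rewrite -(cvg_lim _ c1)//; apply: cvg_lim => //.
have -> : \int[mu]_(x in `[a, b]) (pi^-1 *: k) x = pi^-1 * \int[mu]_(x in `[a, b]) k x.
  by rewrite -RintegralZl//; exact: L2_seg_itg.
apply: (eq_cvgn (v := fun n => pi^-1 * \int[mu]_(x in `[a, b]) Q (y n) g x) _ erefl).
  move=> n; rewrite -(regHilbert_primitive (y0 n) fg jf jg ab).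
  by rewrite mulrBr.
apply: cvgn_scale; apply/cvgrPdist_le => e e0.
pose B := Num.sqrt (b - a) * (2 * Num.sqrt pi) + 1.
have B0 : 0 < B by rewrite ltr_wpDl// !mulr_ge0 ?sqrtr_ge0.
have : (2^-1 : R) ^+ n @[n --> \oo] --> (0 : R).
  by apply: cvg_expr; rewrite ger0_norm// invf_lt1// ltr1n.
move=> /cvgr0Pnorm_lt/(_ (e / B) (divr_gt0 e0 B0)); apply: filterS => n.
have s0 := ltW (@half_expn_gt0 R n); rewrite (ger0_norm s0) ltr_pdivlMr// => hn.
have LQ := regHilbert_L2 (y0 n) jg.
have E : \int[mu]_(x in `[a, b]) k x - \int[mu]_(x in `[a, b]) Q (y n) g x =
    \int[mu]_(x in `[a, b]) (k - Q (y n) g) x.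
  by rewrite [RHS]RintegralB//; exact: L2_seg_itg.
rewrite E; apply: le_trans (Rintegral_seg_hoelder ab (L2B Lk LQ)) _.
rewrite (ip_normBC ip2P)//; apply: le_trans (ltW hn).
apply: (@le_trans _ _ (Num.sqrt (b - a) * (2 * Num.sqrt pi * 2^-1 ^+ n))).
  by rewrite ler_wpM2l ?sqrtr_ge0.
by rewrite /B mulrDr mulr1; move: (Num.sqrt _) (Num.sqrt _) s0 => u v s0; lra.
Qed.

End HilbertTransform.

(** * The truncated flow on pairs of Sobolev functions *)

Section CompletenessCriterion.
Context {R : realType} {V : lmodType R} {D : set V} {ip : V -> V -> R}.
Hypothesis ipP : inner_product D ip.
Local Notation N := (ip_norm ip).

(** A limit reached at a geometric rate with any constant [B] is reached with the constant [2 * C]: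
    the triangle inequality through [x (n + k)], with [k] going to infinity. *)
Lemma ip_complete_of_limits :
  (forall (x : nat -> V) (C : R), (forall n, D (x n)) ->
    (forall n, N (x n.+1 - x n) <= C * 2^-1 ^+ n) ->
    exists l B, D l /\ forall n, N (x n - l) <= B * 2^-1 ^+ n) -> ip_complete D ip.
Proof.
move=> H x C Dx xC; have [l [B [Dl lB]]] := H x C Dx xC; exists l => // n.
have C0 : 0 <= C by have := le_trans (ip_norm_ge0 _) (xC 0%N); rewrite expr0 mulr1.
have step k : N (x n - x (n + k)%N) <= 2 * C * (2^-1 ^+ n - 2^-1 ^+ (n + k)).
  elim: k => [|k IH]; first by rewrite addn0 !subrr (ip_norm0 ipP) mulr0.
  rewrite addnS; apply: le_trans (ip_norm_triangle ipP (Dx n) (Dx (n + k)%N) (Dx _)) _.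
  rewrite (ip_normBC ipP (Dx (n + k)%N) (Dx _)).
  apply: le_trans (lerD IH (xC (n + k)%N)) _; rewrite exprS; lra.
have le k : N (x n - l) <= 2 * C * 2^-1 ^+ n + `|B| * 2^-1 ^+ k.
  apply: le_trans (ip_norm_triangle ipP (Dx n) (Dx (n + k)%N) Dl) _; apply: lerD.
    apply: le_trans (step k) _; rewrite ler_wpM2l ?mulr_ge0//.
    by rewrite gerBl ltW// half_expn_gt0.
  apply: le_trans (lB _) _; rewrite exprD mulrA ler_wpM2r ?(ltW (half_expn_gt0 _))//.
  apply: le_trans (ler_norm _) _; rewrite normrM ler_piMr// ger0_norm ?(ltW (half_expn_gt0 _))//.
  by rewrite exprn_ile1// invf_le1// ler1n.
have cv : 2 * C * 2^-1 ^+ n + `|B| * 2^-1 ^+ k @[k --> \oo] --> 2 * C * 2^-1 ^+ n + `|B| * 0.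
  apply: cvgn_add; first exact: cvg_cst.
  by apply: cvgn_scale; apply: cvg_expr; rewrite ger0_norm// invf_lt1// ltr1n.
rewrite mulr0 addr0 in cv; rewrite -(cvg_lim _ cv)//; apply: limr_ge.
  by apply/cvg_ex; eexists; exact: cv.
by apply: nearW => k; exact: le.
Qed.

End CompletenessCriterion.

Section ProductSpace.
Context {R : realType} {V W : lmodType R}.
Context {D : set V} {ip : V -> V -> R} {E : set W} {iq : W -> W -> R}.

Definition prod_ip (ip : V -> V -> R) (iq : W -> W -> R) (x y : V * W) : R :=
  ip x.1 y.1 + iq x.2 y.2.

Hypothesis ipP : inner_product D ip.
Hypothesis iqP : inner_product E iq.

Lemma prod_inner_product : inner_product (D `*` E) (prod_ip ip iq).
Proof.
split.
- by split; [exact: ip_mem0 ipP|exact: ip_mem0 iqP].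
- by move=> x y [x1 x2] [y1 y2]; split; [exact: (ip_memD ipP)|exact: (ip_memD iqP)].
- by move=> c x [x1 x2]; split; [exact: (ip_memZ ipP)|exact: (ip_memZ iqP)].
- by move=> x y [x1 x2] [y1 y2]; rewrite /prod_ip (ip_sym ipP)// (ip_sym iqP).
- move=> x y z [x1 x2] [y1 y2] [z1 z2].
  by rewrite /prod_ip (ip_addl ipP)// (ip_addl iqP)//; ring.
- move=> c x y [x1 x2] [y1 y2].
  by rewrite /prod_ip (ip_scalel ipP)// (ip_scalel iqP)//; ring.
- by move=> x [x1 x2]; rewrite addr_ge0 ?(ip_ge0 ipP) ?(ip_ge0 iqP).
Qed.

Lemma prod_ip_norm_sqr x : D x.1 -> E x.2 ->
  ip_norm (prod_ip ip iq) x ^+ 2 = ip_norm ip x.1 ^+ 2 + ip_norm iq x.2 ^+ 2.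
Proof.
move=> x1 x2; have Dx : (D `*` E) x by [].
by rewrite (ip_normE prod_inner_product)// (ip_normE ipP)// (ip_normE iqP).
Qed.

Lemma prod_ip_norm_le x : D x.1 -> E x.2 ->
  ip_norm (prod_ip ip iq) x <= ip_norm ip x.1 + ip_norm iq x.2.
Proof.
move=> x1 x2; have p1 := ip_norm_ge0 (ip := ip) x.1; have p2 := ip_norm_ge0 (ip := iq) x.2.
rewrite -(@ler_pXn2r _ 2)// ?nnegrE ?addr_ge0 ?ip_norm_ge0//.
by rewrite prod_ip_norm_sqr// sqrrD lerD2r lerDl mulrn_wge0// mulr_ge0.
Qed.

Lemma prod_ip_norm1 x : D x.1 -> E x.2 -> ip_norm ip x.1 <= ip_norm (prod_ip ip iq) x.
Proof.
move=> x1 x2; rewrite -(@ler_pXn2r _ 2)// ?nnegrE ?ip_norm_ge0//.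
by rewrite prod_ip_norm_sqr// lerDl sqr_ge0.
Qed.

Lemma prod_ip_norm2 x : D x.1 -> E x.2 -> ip_norm iq x.2 <= ip_norm (prod_ip ip iq) x.
Proof.
move=> x1 x2; rewrite -(@ler_pXn2r _ 2)// ?nnegrE ?ip_norm_ge0//.
by rewrite prod_ip_norm_sqr// lerDr sqr_ge0.
Qed.

Lemma prod_ip_complete : ip_complete D ip -> ip_complete E iq ->
  ip_complete (D `*` E) (prod_ip ip iq).
Proof.
move=> c1 c2; apply: (ip_complete_of_limits prod_inner_product) => x C Dx xC.
have D1 n : D (x n).1 by have [] := Dx n.
have D2 n : E (x n).2 by have [] := Dx n.
have [n|l Dl hl] := c1 (fun n => (x n).1) C D1.
  apply: le_trans (xC n); apply: (@prod_ip_norm1 (x n.+1 - x n)); [exact: (ip_memB ipP)|exact: (ip_memB iqP)].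
have [n|m Em hm] := c2 (fun n => (x n).2) C D2.
  apply: le_trans (xC n); apply: (@prod_ip_norm2 (x n.+1 - x n)); [exact: (ip_memB ipP)|exact: (ip_memB iqP)].
exists (l, m), (4 * C); split => // n.
apply: le_trans (@prod_ip_norm_le (x n - (l, m)) _ _) _.
- exact: (ip_memB ipP).
- exact: (ip_memB iqP).
- by apply: le_trans (lerD (hl n) (hm n)) _; lra.
Qed.

End ProductSpace.

(** * Flow of a quadratic field frozen outside a ball *)

Section QuadraticFlow.
Context {R : realType} {V : lmodType R} {D : set V} {ip : V -> V -> R}.
Hypothesis ipP : inner_product D ip.
Local Notation N := (ip_norm ip).

(** The map is the radial retraction onto the ball of radius [M]. The factor 2 is the sum of two
    unit contributions, from the difference of the vectors and from that of the scaling factors. *)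
Lemma radial_lipschitz M x y : 0 < M -> D x -> D y ->
  N ((M / Num.max M (N x)) *: x - (M / Num.max M (N y)) *: y) <= 2 * N (x - y).
Proof.
move=> M0 Dx Dy; set a := Num.max M (N x); set b := Num.max M (N y).
have a0 : 0 < a by rewrite lt_max M0.
have b0 : 0 < b by rewrite lt_max M0.
have E : (M / a) *: x - (M / b) *: y = (M / a) *: (x - y) + (M / a - M / b) *: y.
  by rewrite scalerBr (scalerBl (M / a)) addrA subrK.
have ab : `|b - a| <= N (x - y).
  apply: le_trans (ip_norm_dist ipP Dx Dy).
  have := ip_norm_ge0 (ip := ip) x; have := ip_norm_ge0 (ip := ip) y.
  rewrite /a /b; move: (N x) (N y) => u v u0 v0; rewrite distrC.
  have a1 := ler_norm (u - v); have a2 := ler_norm (v - u); have a3 := normr_ge0 (u - v).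
  rewrite distrC in a2; rewrite ler_norml; apply/andP.
  by case: (leP M u); case: (leP M v) => *; split; lra.
have h1 : M / a <= 1 by rewrite ler_pdivrMr// mul1r le_max lexx.
have h2 : N y / b <= 1 by rewrite ler_pdivrMr// mul1r le_max lexx orbT.
have Dxy := ip_memB ipP Dx Dy.
rewrite E; apply: le_trans (ip_normD ipP _ _) _; [exact: (ip_memZ ipP)|exact: (ip_memZ ipP)|].
rewrite !(ip_normZ ipP)// (ger0_norm (x := M / a)); last by rewrite divr_ge0// ltW.
have -> : M / a - M / b = (M / a) * ((b - a) / b) by field; rewrite !gt_eqF.
have ha : 0 <= M / a by rewrite divr_ge0// ltW.
have -> : `|M / a * ((b - a) / b)| = M / a * (`|b - a| / b).
  by rewrite normrM (ger0_norm ha) normrM normfV (gtr0_norm b0).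
have k1 : M / a * N (x - y) <= N (x - y) by rewrite ler_piMl ?ip_norm_ge0.
have k2 : M / a * (`|b - a| / b) * N y <= N (x - y).
  have -> : M / a * (`|b - a| / b) * N y = (M / a) * (N y / b) * `|b - a| by ring.
  apply: le_trans ab; rewrite ler_piMl//; apply: mulr_ile1 => //; rewrite divr_ge0 ?ip_norm_ge0// ltW//.
by lra.
Qed.

Lemma radial_bound M x : 0 < M -> D x -> N ((M / Num.max M (N x)) *: x) <= M.
Proof.
move=> M0 Dx; have a0 : 0 < Num.max M (N x) by rewrite lt_max M0.
rewrite (ip_normZ ipP)// ger0_norm; last by rewrite divr_ge0 ?ltW.
rewrite mulrAC ler_pdivrMr// ler_wpM2l ?(ltW M0)//.
by rewrite le_max lexx orbT.
Qed.

(* The solution leaves the ball of radius [M] only if the a priori bounds fail,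
   so it is constructed for the vector field frozen outside that ball. *)
Lemma quadratic_flow (F : V -> V) A M x0 : 0 <= A -> 0 < M -> D x0 ->
  (forall x, D x -> D (F x)) ->
  (forall x, D x -> N (F x) <= A * N x ^+ 2) ->
  (forall x y, D x -> D y -> N (F x - F y) <= A * (N x + N y) * N (x - y)) ->
  ip_complete D ip ->
  exists X : R -> V, exists G : V -> V, exists K : R, [/\ 0 <= K, X 0 = x0,
    forall t, 0 <= t -> D (X t),
    forall x, D x -> N x <= M -> G x = F x &
    forall s t, 0 <= s -> s <= t -> 
      N (X t - X s - (t - s) *: G (X s)) <= K * (t - s) ^+ 2 /\
      (t - s <= 1 -> N (X t - X s) <= K * (t - s))].
Proof.
move=> A0 M0 D0 DF FN FL cpl.
pose rad x := (M / Num.max M (N x)) *: x.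
have Dr x : D x -> D (rad x) by move=> Dx; exact: (ip_memZ ipP).
pose K1 := A * M ^+ 2; pose L1 := 4 * A * M.
have K10 : 0 <= K1 by rewrite mulr_ge0// sqr_ge0.
have L10 : 0 <= L1 by rewrite !mulr_ge0// ltW.
have GK x : D x -> N (F (rad x)) <= K1.
  move=> Dx; apply: le_trans (FN _ (Dr _ Dx)) _; rewrite ler_wpM2l//.
  by rewrite ler_pXn2r ?nnegrE ?ip_norm_ge0 ?(ltW M0)//; exact: radial_bound.
have GL x y : D x -> D y -> N (F (rad x) - F (rad y)) <= L1 * N (x - y).
  move=> Dx Dy; apply: le_trans (FL _ _ (Dr _ Dx) (Dr _ Dy)) _.
  have -> : L1 * N (x - y) = A * (M + M) * (2 * N (x - y)) by rewrite /L1; ring.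
  apply: ler_pM; rewrite ?ip_norm_ge0 ?mulr_ge0 ?addr_ge0 ?ip_norm_ge0//; last exact: radial_lipschitz.
  by rewrite ler_wpM2l// lerD//; exact: radial_bound.
have [X [X0 DX XE]] := euler_exists ipP D0 (fun x Dx => DF _ (Dr _ Dx)) GK GL L10 cpl.
exists X, (fun x => F (rad x)), (L1 * K1 + K1); split => //.
- by rewrite addr_ge0// mulr_ge0.
- move=> x Dx xM; rewrite /rad max_l// divff ?gt_eqF// scale1r //.
- move=> s t s0 st; have h := XE s t s0 st; have ts : 0 <= t - s by rewrite subr_ge0.
  have LK : 0 <= L1 * K1 by rewrite mulr_ge0.
  split; first by apply: le_trans h _; rewrite ler_wpM2r ?sqr_ge0// lerDl.
  move=> ts1; have t0 := le_trans s0 st; have DFX := DF _ (Dr _ (DX _ s0)).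
  have -> : X t - X s = (X t - X s - (t - s) *: F (rad (X s))) + (t - s) *: F (rad (X s)).
    by rewrite subrK.
  have D1 := ip_memB ipP (DX _ t0) (DX _ s0); have D2 := ip_memZ ipP (t - s) DFX.
  apply: le_trans (ip_normD ipP (ip_memB ipP D1 D2) D2) _.
  rewrite (ip_normZ ipP)// (ger0_norm ts).
  have := GK _ (DX _ s0) => g; have g2 := ler_wpM2l ts g.
  have e2 : (t - s) ^+ 2 <= t - s by rewrite expr2 ler_piMr.
  have := ler_wpM2l LK e2; lra.
Qed.

End QuadraticFlow.

(* An element of [H^1] is represented by its continuous representative together
   with a representative of its derivative. *)
Definition ac_space {R : realType} : set ((R -> R) * (R -> R)) := [set p | ac_pair p.1 p.2].

Definition ac_ip {R : realType} := @prod_ip R _ _ (@ip2 R) (@ip2 R).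

Definition ac_mul {R : realType} (p r : (R -> R) * (R -> R)) : (R -> R) * (R -> R) :=
  ((fun x => p.1 x * r.1 x), (fun x => p.1 x * r.2 x + p.2 x * r.1 x)).

(** The derivative of the transform is known only to exist, hence the choice; any two candidates
    agree almost everywhere. *)
Definition ac_hilbert {R : realType} (p : (R -> R) * (R -> R)) : (R -> R) * (R -> R) :=
  (hilbert p.1, xget 0 [set k | ac_pair (hilbert p.1) k]).

Section AcSpace.
Context {R : realType}.
Local Notation mu := (@lebesgue_measure R).
Local Notation itg f := (lebesgue_integrable f).
Local Notation N2 := (ip_norm ip2).
Local Notation N := (ip_norm ac_ip).
Local Notation AC := (@ac_space R).
Implicit Types (p r w : (R -> R) * (R -> R)).

Lemma ac_space_L2 p : AC p -> L2 p.1 /\ L2 p.2. Proof. by case. Qed.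

Let pP := prod_inner_product (@ip2P R) (@ip2P R).

Lemma ac_ipP : inner_product AC ac_ip.
Proof.
have [_ _ _ s al sl g0] := pP.
have L p : AC p -> (L2 `*` L2) p by case.
split.
- exact: ac_pair0.
- by move=> p r; exact: ac_pairD.
- by move=> c p; exact: ac_pairZ.
- by move=> p r /L ? /L ?; exact: s.
- by move=> p r w /L ? /L ? /L ?; exact: al.
- by move=> c p r /L ? /L ?; exact: sl.
- by move=> p /L ?; exact: g0.
Qed.

Lemma ac_norm_sqr p : AC p -> N p ^+ 2 = N2 p.1 ^+ 2 + N2 p.2 ^+ 2.
Proof. by move=> [? ? _]; apply: (prod_ip_norm_sqr ip2P ip2P). Qed.

Lemma ac_norm_le p : AC p -> N p <= N2 p.1 + N2 p.2.
Proof. by move=> [? ? _]; apply: (prod_ip_norm_le ip2P ip2P). Qed.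

Lemma ac_norm1 p : AC p -> N2 p.1 <= N p.
Proof. by move=> [? ? _]; apply: (prod_ip_norm1 ip2P ip2P). Qed.

Lemma ac_norm2 p : AC p -> N2 p.2 <= N p.
Proof. by move=> [? ? _]; apply: (prod_ip_norm2 ip2P ip2P). Qed.

(** Sobolev's inequality with constant 1, from [2 * a * b <= a ^+ 2 + b ^+ 2] in [ac_pair_sup]. *)
Lemma ac_norm_sup p x : AC p -> `|p.1 x| <= N p.
Proof.
move=> hp; rewrite -(@ler_pXn2r _ 2)// ?nnegrE ?ip_norm_ge0// real_normK ?num_real//.
apply: le_trans (ac_pair_sup x hp) _; rewrite ac_norm_sqr// -subr_ge0.
by have := sqr_ge0 (N2 p.1 - N2 p.2); rewrite sqrrB; lra.
Qed.

(** Both components converge in [L^2] separately. The limit of the first has to be replaced by the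
    primitive [h] of the limit of the second, since membership asks for the fundamental theorem at
    every point and not almost everywhere. *)
Lemma ac_complete : ip_complete AC ac_ip.
Proof.
apply: (ip_complete_of_limits ac_ipP) => x C Dx xC.
have DB n : AC (x n.+1 - x n) by exact: (ip_memB ac_ipP).
have L1 n : L2 (x n).1 by have [] := Dx n.
have L2' n : L2 (x n).2 by have [] := Dx n.
have [f [Lf fC aef]] : exists l, [/\ L2 l, forall n, N2 ((x n).1 - l) <= 2 * C * 2^-1 ^+ n
    & {ae mu, forall z, (x n).1 z @[n --> \oo] --> l z}].
  by apply: L2_complete_ae => // n; exact: le_trans (ac_norm1 (DB n)) (xC n).
have [g Lg gC] : exists2 l, L2 l & forall n, N2 ((x n).2 - l) <= 2 * C * 2^-1 ^+ n.
  by apply: L2_complete => // n; exact: le_trans (ac_norm2 (DB n)) (xC n).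
have h0 : (2^-1 : R) ^+ n @[n --> \oo] --> (0 : R).
  by apply: cvg_expr; rewrite ger0_norm// invf_lt1// ltr1n.
have seg a b : a <= b -> (x n).1 b - (x n).1 a @[n --> \oo] --> \int[mu]_(z in `[a, b]) g z.
  move=> ab; apply/cvgrPdist_le => e e0.
  pose B := Num.sqrt (b - a) * (2 * `|C|) + 1.
  have B0 : 0 < B by rewrite ltr_wpDl// !mulr_ge0 ?sqrtr_ge0.
  move/cvgr0Pnorm_lt/(_ (e / B) (divr_gt0 e0 B0)) : h0; apply: filterS => n.
  have s0 := ltW (@half_expn_gt0 R n); rewrite (ger0_norm s0) ltr_pdivlMr// => hn.
  have [_ _ ->//] := Dx n.
  have E : \int[mu]_(z in `[a, b]) g z - \int[mu]_(z in `[a, b]) (x n).2 z =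
      \int[mu]_(z in `[a, b]) (g - (x n).2) z.
    by rewrite [RHS]RintegralB//; exact: L2_seg_itg.
  rewrite E; apply: le_trans (Rintegral_seg_hoelder ab (L2B Lg (L2' n))) _.
  rewrite (ip_normBC ip2P)//; apply: le_trans (ltW hn).
  apply: (@le_trans _ _ (Num.sqrt (b - a) * (2 * `|C| * 2^-1 ^+ n))).
    rewrite ler_wpM2l ?sqrtr_ge0//; apply: le_trans (gC n) _.
    by rewrite ler_wpM2r// ler_wpM2l// ler_norm.
  by rewrite /B mulrDr mulr1; move: (Num.sqrt _) (`|C|) s0 => u v s0; lra.
(* the pointwise limit exists everywhere because it exists somewhere *)
have [z0 cz0] : exists z0, (x n).1 z0 @[n --> \oo] --> f z0.
  have [Z [mZ Z0 hZ]] := ae_null aef; apply: contrapT => nex.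
  have ZT : Z = setT.
    by apply/seteqP; split => // z _; apply: contrapT => /hZ ?; apply: nex; exists z.
  have : (mu `[0%R, 1%R]%classic <= mu Z)%E by apply: le_measure => //; rewrite ?inE// ZT.
  by rewrite Z0 lebesgue_measure_itv/= lte_fin ltr01 leNgt/= oppr0 addr0 lte_fin ltr01.
have [f0 pf0] := primitive_exists (fun a b => L2_seg_itg a b Lg).
pose h z := f0 z - f0 z0 + f z0.
have ch z : (x n).1 z @[n --> \oo] --> h z.
  case: (leP z0 z) => zz.
    apply: (eq_cvgn (v := fun n => ((x n).1 z - (x n).1 z0) + (x n).1 z0) _ erefl).
      by move=> n; rewrite subrK.
    by apply: cvgn_add => //; rewrite pf0//; exact: seg.
  apply: (eq_cvgn (v := fun n => (x n).1 z0 - ((x n).1 z0 - (x n).1 z)) (l' := f z0 - (f0 z0 - f0 z))).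
  - by move=> n; rewrite subKr.
  - by rewrite /h; ring.
  - by apply: cvgn_sub => //; rewrite pf0 ?ltW//; apply: seg; exact: ltW.
have mh : measurable_fun setT h.
  apply: (@measurable_fun_cvg _ _ _ setT (fun n => (x n).1)) => [n|z _]; last exact: ch.
  exact: L2_measurable.
have fh : f = h %[ae mu].
  by apply: aeS aef => z fz _; rewrite -(cvg_lim _ fz)//; apply: cvg_lim => //; exact: ch.
have Lh := L2_ae_eq mh fh Lf.
have hC n : N2 ((x n).1 - h) <= 2 * C * 2^-1 ^+ n.
  rewrite -(_ : N2 ((x n).1 - f) = N2 ((x n).1 - h))//; apply: ip_norm2_ae_eq.
  - by apply: L2_measurable; exact: L2B.
  - by apply: L2_measurable; exact: L2B.
  - by apply: aeS fh => z /= e _; rewrite -[LHS]/((x n).1 z - f z) e.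
have Dl : AC (h, g).
  split => //= a b ab; rewrite -pf0// /h; ring.
exists (h, g), (4 * C); split => // n.
apply: le_trans (ac_norm_le (ip_memB ac_ipP (Dx n) Dl)) _.
by apply: le_trans (lerD (hC n) (gC n)) _; lra.
Qed.

Lemma ac_mul_space p r : AC p -> AC r -> AC (ac_mul p r).
Proof. exact: ac_pair_product. Qed.

(** The constant 3 counts the products [p r], [p r'] and [p' r], each bounded by a supremum times an
    [L^2] norm. *)
Lemma ac_norm_mul p r : AC p -> AC r -> N (ac_mul p r) <= 3 * (N p * N r).
Proof.
move=> hp hr; have [Lp1 Lp2] := ac_space_L2 hp; have [Lr1 Lr2] := ac_space_L2 hr.
have mp := L2_measurable Lp1; have mr := L2_measurable Lr1.
have sp x := ac_norm_sup x hp; have sr x := ac_norm_sup x hr.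
have [La Na] := L2_bounded_mul mp sp Lr1.
have [Lb Nb] := L2_bounded_mul mp sp Lr2.
have [Lc Nc] := L2_bounded_mul mr sr Lp2.
have E : (ac_mul p r).2 = (fun x => p.1 x * r.2 x) + (fun x => r.1 x * p.2 x).
  by apply/funext => x; rewrite /= [p.2 x * _]mulrC.
apply: le_trans (ac_norm_le (ac_mul_space hp hr)) _.
rewrite E; apply: le_trans (lerD Na (ip_normD ip2P Lb Lc)) _.
have p0 := ip_norm_ge0 (ip := ac_ip) p; have r0 := ip_norm_ge0 (ip := ac_ip) r.
have := ler_wpM2l p0 (ac_norm1 hr); have := ler_wpM2l p0 (ac_norm2 hr).
by have := ler_wpM2l r0 (ac_norm2 hp); lra.
Qed.

Lemma ac_mulBl p r w : ac_mul (p - r) w = ac_mul p w - ac_mul r w.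
Proof.
apply/pair_equal_spec; split; apply/funext => x.
  by rewrite /= -[LHS]/((p.1 x - r.1 x) * w.1 x) mulrBl.
rewrite /= -[LHS]/((p.1 x - r.1 x) * w.2 x + (p.2 x - r.2 x) * w.1 x).
by rewrite -[RHS]/(p.1 x * w.2 x + p.2 x * w.1 x - (r.1 x * w.2 x + r.2 x * w.1 x)); ring.
Qed.

Lemma ac_mulBr p r w : ac_mul w (p - r) = ac_mul w p - ac_mul w r.
Proof.
apply/pair_equal_spec; split; apply/funext => x.
  by rewrite /= -[LHS]/(w.1 x * (p.1 x - r.1 x)) mulrBr.
rewrite /= -[LHS]/(w.1 x * (p.2 x - r.2 x) + w.2 x * (p.1 x - r.1 x)).
by rewrite -[RHS]/(w.1 x * p.2 x + w.2 x * p.1 x - (w.1 x * r.2 x + w.2 x * r.1 x)); ring.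
Qed.

Definition ac_integrable p := itg p.1 /\ itg p.2.

Lemma ac_mul_integrable p r : AC p -> AC r -> ac_integrable (ac_mul p r).
Proof.
move=> [p1 p2 _] [r1 r2 _]; split; first exact: L2_mul.
by apply: itgD; exact: L2_mul.
Qed.

Lemma ac_hilbert_space p : AC p -> ac_integrable p -> AC (ac_hilbert p).
Proof.
move=> hp [i1 i2]; have [k [hk _ _]] := hilbert_ac_pair hp i1 i2.
by rewrite /ac_space/= ; apply: (xgetPex 0); exists k.
Qed.

Lemma ac_hilbert_norms p k : AC p -> ac_integrable p -> ac_pair (hilbert p.1) k ->
  N2 (hilbert p.1) <= N2 p.1 /\ N2 k <= N2 p.2.
Proof.
move=> hp [i1 i2] [_ Lk pk]; have [l [[_ Ll pl] ? lN]] := hilbert_ac_pair hp i1 i2.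
split => //; rewrite (_ : N2 k = N2 l)//; apply: ip_norm2_ae_eq.
- exact: L2_measurable.
- exact: L2_measurable.
- by apply: (primitive_unique Lk Ll pk pl); apply: aeW.
Qed.

Let sqr_le (a b : R) : 0 <= a -> a <= b -> a ^+ 2 <= b ^+ 2.
Proof. by move=> a0 ab; rewrite ler_pXn2r ?nnegrE// (le_trans a0). Qed.

(** The derivatives chosen in [ac_hilbert] need not depend linearly on the argument, but their
    difference is a derivative of the transform of the difference, and [ac_hilbert_norms] bounds all
    such derivatives. *)
Lemma ac_hilbert_distance p r : AC p -> ac_integrable p -> AC r -> ac_integrable r ->
  N (ac_hilbert p - ac_hilbert r) <= N (p - r).
Proof.
move=> hp ip hr ir; have [ip1 ip2'] := ip; have [ir1 ir2] := ir.
have hH := ac_hilbert_space hp ip; have hK := ac_hilbert_space hr ir.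
have hB := ip_memB ac_ipP hp hr.
have iB : ac_integrable (p - r) by split; exact: itgB.
have hHK := ip_memB ac_ipP hH hK.
have E : hilbert (p - r).1 = (ac_hilbert p - ac_hilbert r).1.
  by apply/funext => x; rewrite (hilbertB x hp ip1 hr ir1).
have hk : ac_pair (hilbert (p - r).1) (ac_hilbert p - ac_hilbert r).2 by rewrite E.
have [n1 n2] := ac_hilbert_norms hB iB hk.
rewrite -(@ler_pXn2r _ 2)// ?nnegrE ?ip_norm_ge0// !ac_norm_sqr// -E.
exact: lerD (sqr_le (ip_norm_ge0 _) n1) (sqr_le (ip_norm_ge0 _) n2).
Qed.

Lemma ac_hilbert_norm p : AC p -> ac_integrable p -> N (ac_hilbert p) <= N p.
Proof.
move=> hp ip; have hH := ac_hilbert_space hp ip.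
have [n1 n2] := ac_hilbert_norms hp ip hH.
rewrite -(@ler_pXn2r _ 2)// ?nnegrE ?ip_norm_ge0// !ac_norm_sqr//.
exact: lerD (sqr_le (ip_norm_ge0 _) n1) (sqr_le (ip_norm_ge0 _) n2).
Qed.

End AcSpace.

Definition state_space {R : realType} := (@ac_space R `*` @ac_space R)%classic.

Definition state_ip {R : realType} := @prod_ip R _ _ (@ac_ip R) (@ac_ip R).

Definition vector_field {R : realType} (X : ((R -> R) * (R -> R)) * ((R -> R) * (R -> R))) :=
  (2 *: ac_mul X.1 X.2, ac_hilbert (ac_mul X.1 X.1)).

Section StateSpace.
Context {R : realType}.
Local Notation N1 := (ip_norm ac_ip).
Local Notation N := (ip_norm state_ip).
Local Notation E := (@state_space R).
Local Notation F := vector_field.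

Lemma state_ipP : inner_product E state_ip.
Proof. exact: (prod_inner_product ac_ipP ac_ipP). Qed.

Lemma state_complete : ip_complete E state_ip.
Proof. exact: (prod_ip_complete ac_ipP ac_ipP ac_complete ac_complete). Qed.

Lemma state_norm1 X : E X -> N1 X.1 <= N X.
Proof. by move=> [? ?]; apply: (prod_ip_norm1 ac_ipP ac_ipP). Qed.

Lemma state_norm2 X : E X -> N1 X.2 <= N X.
Proof. by move=> [? ?]; apply: (prod_ip_norm2 ac_ipP ac_ipP). Qed.

Lemma state_norm_le X : E X -> N X <= N1 X.1 + N1 X.2.
Proof. by move=> [? ?]; apply: (prod_ip_norm_le ac_ipP ac_ipP). Qed.

Lemma vector_field_space X : E X -> E (F X).
Proof.
move=> [h1 h2]; split; first by apply: (ip_memZ ac_ipP); exact: ac_mul_space.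
by apply: ac_hilbert_space; [exact: ac_mul_space|exact: ac_mul_integrable].
Qed.

(** [9 = 2 * 3 + 3], from the constant of [ac_norm_mul] in the two equations. *)
Lemma vector_field_norm X : E X -> N (F X) <= 9 * N X ^+ 2.
Proof.
move=> hX; have [h1 h2] := hX; apply: le_trans (state_norm_le (vector_field_space hX)) _.
rewrite (ip_normZ ac_ipP); last exact: ac_mul_space.
have m := ac_norm_mul h1 h2; have m' := ac_norm_mul h1 h1.
have k := ac_hilbert_norm (ac_mul_space h1 h1) (ac_mul_integrable h1 h1).
rewrite ger0_norm//=; have n1 := state_norm1 hX; have n2 := state_norm2 hX.
have p1 := ip_norm_ge0 (ip := ac_ip) X.1; have p2 := ip_norm_ge0 (ip := ac_ip) X.2.
have : N1 X.1 * N1 X.2 <= N X ^+ 2 by rewrite expr2 ler_pM.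
have : N1 X.1 * N1 X.1 <= N X ^+ 2 by rewrite expr2 ler_pM.
by lra.
Qed.

Lemma vector_field_lipschitz X Y : E X -> E Y ->
  N (F X - F Y) <= 9 * (N X + N Y) * N (X - Y).
Proof.
move=> hX hY; have [x1 x2] := hX; have [y1 y2] := hY.
have hXY := ip_memB state_ipP hX hY; have [d1 d2] := hXY.
have hF := ip_memB state_ipP (vector_field_space hX) (vector_field_space hY).
apply: le_trans (state_norm_le hF) _.
(* Bilinearity: one factor is changed at a time, here and for the square below. *)
have e1 : (F X - F Y).1 = 2 *: (ac_mul (X.1 - Y.1) X.2 + ac_mul Y.1 (X.2 - Y.2)).
  by rewrite ac_mulBl ac_mulBr addrA subrK scalerBr.
have b1 : N1 (F X - F Y).1 <= 2 * (3 * (N (X - Y) * N X) + 3 * (N Y * N (X - Y))).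
  have s1 := ac_mul_space d1 x2; have s2 := ac_mul_space y1 d2.
  rewrite e1 (ip_normZ ac_ipP); last exact: (ip_memD ac_ipP).
  rewrite ger0_norm// ler_wpM2l//; apply: le_trans (ip_normD ac_ipP s1 s2) _.
  apply: lerD; [apply: le_trans (ac_norm_mul d1 x2) _|apply: le_trans (ac_norm_mul y1 d2) _].
    rewrite ler_wpM2l// ler_pM ?ip_norm_ge0//; [exact: (state_norm1 hXY)|exact: state_norm2].
  rewrite ler_wpM2l// ler_pM ?ip_norm_ge0//; [exact: state_norm1|exact: (state_norm2 hXY)].
have b2 : N1 (F X - F Y).2 <= 3 * (N (X - Y) * N X) + 3 * (N Y * N (X - Y)).
  have sX := ac_mul_space x1 x1; have sY := ac_mul_space y1 y1.
  apply: le_trans (ac_hilbert_distance sX (ac_mul_integrable x1 x1) sY (ac_mul_integrable y1 y1)) _.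
  have -> : ac_mul X.1 X.1 - ac_mul Y.1 Y.1 = ac_mul (X.1 - Y.1) X.1 + ac_mul Y.1 (X.1 - Y.1).
    by rewrite ac_mulBl ac_mulBr addrA subrK.
  apply: le_trans (ip_normD ac_ipP (ac_mul_space d1 x1) (ac_mul_space y1 d1)) _.
  apply: lerD; [apply: le_trans (ac_norm_mul d1 x1) _|apply: le_trans (ac_norm_mul y1 d1) _].
    rewrite ler_wpM2l// ler_pM ?ip_norm_ge0//; [exact: (state_norm1 hXY)|exact: state_norm1].
  rewrite ler_wpM2l// ler_pM ?ip_norm_ge0//; [exact: state_norm1|exact: (state_norm1 hXY)].
by apply: le_trans (lerD b1 b2) _; lra.
Qed.

Lemma state_flow X0 M : E X0 -> 0 < M ->
  exists X, exists G, exists K : R, [/\ 0 <= K, X 0 = X0,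
    forall t, 0 <= t -> E (X t),
    forall x, E x -> N x <= M -> G x = F x &
    forall s t, 0 <= s -> s <= t -> 
      N (X t - X s - (t - s) *: G (X s)) <= K * (t - s) ^+ 2 /\
      (t - s <= 1 -> N (X t - X s) <= K * (t - s))].
Proof.
move=> h0 M0; apply: (quadratic_flow (A := 9) state_ipP) => //.
- exact: vector_field_space.
- exact: vector_field_norm.
- exact: vector_field_lipschitz.
- exact: state_complete.
Qed.

End StateSpace.

(** * A priori bounds *)

Section Increments.
Context {R : realType}.
Implicit Types (psi phi : R -> R) (a s t T C B : R).

(** Over [n + 1] equal pieces the quadratic errors add up to [C * t ^+ 2 / (n + 1)], which tends to
    zero. *)
Lemma quadratic_increments psi T C : 0 <= C ->
  (forall s t, 0 <= s -> s <= t -> t <= T -> psi t <= psi s + C * (t - s) ^+ 2) ->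
  forall t, 0 <= t <= T -> psi t <= psi 0.
Proof.
move=> C0 h t /andP[t0 tT].
have sub n k : (k <= n.+1)%N -> psi (k%:R * (t / n.+1%:R)) <= psi 0 + k%:R * (C * (t / n.+1%:R) ^+ 2).
  have d0 : 0 <= t / n.+1%:R by rewrite divr_ge0.
  elim: k => [|k IH] kn; first by rewrite !mul0r addr0.
  have le1 : k.+1%:R * (t / n.+1%:R) <= T.
    apply: le_trans tT; rewrite mulrCA ler_piMr// ler_pdivrMr ?ltr0n// mul1r ler_nat//.
  have e : k.+1%:R * (t / n.+1%:R) - k%:R * (t / n.+1%:R) = t / n.+1%:R by rewrite -natr1; ring.
  have := h (k%:R * (t / n.+1%:R)) (k.+1%:R * (t / n.+1%:R)).
  rewrite e mulr_ge0// ler_wpM2r ?ler_nat// => /(_ isT isT le1) h1.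
  apply: le_trans h1 _; have := IH (ltnW kn).
  by rewrite -[k.+1%:R]natr1 [(_ + 1) * _]mulrDl mul1r addrA lerD2r.
rewrite leNgt; apply/negP => lt.
have d0 : 0 < psi t - psi 0 by rewrite subr_gt0.
have Q0 : 0 <= C * t ^+ 2 / (psi t - psi 0) by rewrite divr_ge0 ?(ltW d0)// mulr_ge0// sqr_ge0.
have /truncn_itv/andP[_] := Q0; rewrite ltr_pdivrMr//; set n := Num.truncn _ => hn.
have n0 : n.+1%:R != 0 :> R by rewrite pnatr_eq0.
have := sub n n.+1 (leqnn _); rewrite mulrC divfK// => hs.
have e : n.+1%:R * (C * (t / n.+1%:R) ^+ 2) * n.+1%:R = C * t ^+ 2 by field.
have := ler_wpM2r (ler0n R n.+1) hs; rewrite mulrDl e; lra.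
Qed.

(** Multiplication by [expR (- (a * t))] reduces to [quadratic_increments], because
    [(1 + a * x) * expR (- (a * x)) <= 1]. The rate [a] may have either sign, whence [|a|] in the
    error constant. *)
Lemma gronwall_increments phi a T C : 0 <= C -> (forall t, 0 <= t <= T -> 0 <= phi t) ->
  (forall s t, 0 <= s -> s <= t -> t <= T ->
    phi t <= (1 + a * (t - s)) * phi s + C * (t - s) ^+ 2) ->
  forall t, 0 <= t <= T -> phi t <= phi 0 * expR (a * t).
Proof.
move=> C0 p0 h t tT.
have b0 s : 0 <= s -> s <= T -> expR (- (a * s)) <= expR (`|a| * T).
  move=> s0 sT; rewrite ler_expR; apply: (@le_trans _ _ (`|a| * s)); last by rewrite ler_wpM2l.
  by rewrite -mulNr ler_wpM2r// -normrN ler_norm.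
have := @quadratic_increments (fun t => phi t * expR (- (a * t))) T (C * expR (`|a| * T)).
rewrite mulr0 oppr0 expR0 mulr1 => H.
suff : phi t * expR (- (a * t)) <= phi 0 by rewrite expRN ler_pdivrMr ?expR_gt0.
apply: H => //; first by rewrite mulr_ge0// expR_ge0.
move=> s r s0 sr rT; have r0 := le_trans s0 sr.
have e : expR (- (a * r)) = expR (- (a * s)) * expR (- (a * (r - s))) by rewrite -expRD; congr expR; ring.
have k1 : (1 + a * (r - s)) * expR (- (a * (r - s))) <= 1.
  by rewrite expRN ler_pdivrMr ?expR_gt0// mul1r expR_ge1Dx.
have ps : 0 <= phi s by rewrite p0// s0 (le_trans sr).
apply: le_trans (ler_wpM2r (expR_ge0 _) (h s r s0 sr rT)) _; rewrite mulrDl; apply: lerD.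
  have := ler_wpM2l (mulr_ge0 ps (expR_ge0 (- (a * s)))) k1.
  by rewrite mulr1 e; apply: le_trans; rewrite le_eqVlt; apply/orP; left; apply/eqP; ring.
rewrite mulrAC; apply: ler_wpM2r; first exact: sqr_ge0.
by apply: ler_wpM2l => //; exact: b0.
Qed.

Lemma decaying_increments psi T B C : 0 <= B -> 0 <= C ->
  (forall s t, 0 <= s -> s <= t -> t <= T ->
    psi t <= psi s + (t - s) * (B * expR (- 6 * s)) + C * (t - s) ^+ 2) ->
  forall t, 0 <= t <= T -> psi t <= psi 0 + B / 6.
Proof.
move=> B0 C0 h t tT.
(* The added term loses what the source gains, up to second order: [expR (- x) <= 1 - x + x ^+ 2] at
   [x = 6 * (r - s)]. The remainder [B / 6 * 36] gives the [6 * B] of the error constant. *)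
have := @quadratic_increments (fun t => psi t + B / 6 * expR (- 6 * t)) T (C + 6 * B).
rewrite mulr0 expR0 mulr1 => H.
have B6 : 0 <= B / 6 by rewrite divr_ge0.
suff h2 : psi t + B / 6 * expR (- 6 * t) <= psi 0 + B / 6.
  by apply: le_trans h2; rewrite lerDl mulr_ge0// expR_ge0.
apply: H => //; first by rewrite addr_ge0// mulr_ge0.
move=> s r s0 sr rT; have x0 : 0 <= r - s by rewrite subr_ge0.
have e : expR (- 6 * r) = expR (- 6 * s) * expR (- (6 * (r - s))) by rewrite -expRD; congr expR; ring.
have k1 : expR (- (6 * (r - s))) <= 1 - 6 * (r - s) + (6 * (r - s)) ^+ 2.
  rewrite expRN -[leLHS]mul1r ler_pdivrMr ?expR_gt0//.
  set x := 6 * (r - s); have x60 : 0 <= x by rewrite mulr_ge0.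
  have q0 : 0 <= 1 - x + x ^+ 2 by have := sqr_ge0 (x - 2^-1); rewrite sqrrB; lra.
  apply: le_trans (ler_wpM2l q0 (expR_ge1Dx x)).
  have -> : (1 - x + x ^+ 2) * (1 + x) = 1 + x ^+ 3 by ring.
  by rewrite lerDl exprn_ge0.
have E1 : expR (- 6 * s) <= 1 by rewrite -expR0 ler_expR mulNr oppr_le0 mulr_ge0.
have E0 := expR_ge0 (- 6 * s).
have := h s r s0 sr rT; rewrite e.
have := ler_wpM2l (mulr_ge0 B6 E0) k1.
have := ler_wpM2l (mulr_ge0 B0 (sqr_ge0 (r - s))) E1.
by move: (expR (- 6 * s)) (expR _) E0 E1 => u w; lra.
Qed.

End Increments.

(** * Functions supported in an interval of length [dl] *)

Section CompactSupport.
Context {R : realType}.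
Local Notation mu := (@lebesgue_measure R).
Local Notation itg f := (lebesgue_integrable f).
Local Notation N2 := (ip_norm ip2).
Local Notation N := (ip_norm ac_ip).
Local Notation AC := (@ac_space R).
Implicit Types (p r w : (R -> R) * (R -> R)) (f g : R -> R) (a b c d x : R).

(** A value above [c] persists on a nondegenerate subinterval of []a, b[], which has positive
    measure. *)
Lemma continuous_le_closure f c a b : continuous f -> a < b ->
  {ae mu, forall x, x \in `]a, b[ -> f x <= c} -> forall x, x \in `[a, b] -> f x <= c.
Proof.
move=> cf ab /ae_null[Z [mZ Z0 hZ]] x; rewrite in_itv/= => /andP[ax xb].
rewrite leNgt; apply/negP => lt.
have : \forall y \near x, c < f y by have /(_ x)/cvgr_gt := cf; exact.
move=> /nbhs_ballP[e /= e0 he].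
pose l := Num.max a (x - e); pose r := Num.min b (x + e).
have lr : l < r by rewrite lt_min !gt_max ab/=; repeat (apply/andP; split); lra.
have sub : `]l, r[%classic `<=` Z.
  move=> y; rewrite /= in_itv/= gt_max lt_min => /andP[/andP[y1 y2] /andP[y3 y4]].
  apply: contrapT => /hZ; rewrite in_itv/= y1 y3 => /(_ isT); apply/negP; rewrite -ltNge.
  by apply: he; rewrite /ball/= ltr_norml; apply/andP; split; lra.
have : (mu `]l, r[%classic <= mu Z)%E by apply: le_measure => //; rewrite inE.
by rewrite Z0 lebesgue_measure_itv/= lte_fin lr leNgt/= lte_fin subr_gt0 lr.
Qed.

Lemma N2_le f g : L2 f -> L2 g -> (forall x, `|f x| <= `|g x|) -> N2 f <= N2 g.
Proof.
move=> lf lg fg; rewrite ler_sqrt ?(ip_ge0 ip2P)//.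
apply: le_Rintegral => //; [exact: L2_mul|exact: L2_mul|].
move=> x _; rewrite -!expr2 -(real_normK (num_real (f x))) -(real_normK (num_real (g x))).
by rewrite ler_pXn2r// nnegrE.
Qed.

Variables (a dl : R).
Hypothesis dl0 : 0 < dl.
Local Notation b := (a + dl).
Local Notation sd := (Num.sqrt dl).
Let ab : a < b. Proof. by rewrite ltrDl. Qed.
Let sdE : sd * sd = dl. Proof. by rewrite -expr2 sqr_sqrtr// ltW. Qed.
Let sd0 : 0 <= sd. Proof. exact: sqrtr_ge0. Qed.

Definition supported f := forall x, x \notin `[a, b] -> f x = 0.

Lemma supported_end f : continuous f -> supported f -> f a = 0 /\ f b = 0.
Proof.
move=> cf sf.
have H (c : R) : c != 0 -> c * f a <= 0 /\ c * f b <= 0.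
  move=> c0; have ccf : continuous (fun x => c * f x).
    by move=> x; apply: cvgM; [exact: cvg_cst|exact: cf].
  split.
    apply: (@continuous_le_closure _ 0 (a - 1) a ccf); [lra| |by rewrite in_itv/= lexx andbT; lra].
    apply: aeW => x; rewrite in_itv/= => /andP[_ xa]; rewrite sf ?mulr0// in_itv/= negb_and -ltNge xa//.
  apply: (@continuous_le_closure _ 0 b (b + 1) ccf); [lra| |by rewrite in_itv/= lexx/=; lra].
  by apply: aeW => x; rewrite in_itv/= => /andP[xa _]; rewrite sf ?mulr0// in_itv/= negb_and -!ltNge xa orbT.
have [h1 h2] := H 1 (oner_neq0 _); have [|h3 h4] := H (-1); first by rewrite oppr_eq0 oner_neq0.
by split; apply/eqP; rewrite eq_le; apply/andP; split; lra.
Qed.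

(** Since [f] vanishes off [[a, b]] and at its ends, its increment over a segment equals its
    increment over the intersection with [[a, b]]; so the part of [g] off [[a, b]] has zero integral
    over every segment. *)
Lemma supported_derivative f g : ac_pair f g -> supported f ->
  {ae mu, forall x, x \notin `[a, b] -> g x = 0}.
Proof.
move=> fg sf; have [_ Lg pf] := fg; have [fa fb] := supported_end (ac_pair_continuous fg) sf.
have mi : measurable_fun setT (\1_`[a, b] : R -> R) by exact: measurable_indic.
have [L1 _] : L2 (fun x => \1_`[a, b] x * g x) /\ N2 (fun x => \1_`[a, b] x * g x) <= 1 * N2 g.
  by apply: L2_bounded_mul => // x; rewrite indicE; case: (_ \in _); rewrite ?normr1 ?normr0.
pose h x := g x - \1_`[a, b] x * g x.
have Lh : L2 h := L2B Lg L1.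
suff : {ae mu, forall x, h x = 0}.
  apply: aeS => x; rewrite /h indicE mem_setE => hx xab.
  by move: hx; rewrite (negbTE xab) mul0r subr0.
apply: seg_integral0_ae0 => c d; first exact: L2_seg_itg.
case: (ltP d c) => [dc|cd]; first by rewrite set_itv_ge ?Rintegral_set0// bnd_simp -ltNge.
rewrite RintegralB//; [|exact: L2_seg_itg|exact: L2_seg_itg]; rewrite -pf// Rintegral_segE /ip2.
have out x : x < a -> f x = 0 by move=> xa; rewrite sf// in_itv/= negb_and -ltNge xa.
have out' x : b < x -> f x = 0 by move=> xa; rewrite sf// in_itv/= negb_and -!ltNge xa orbT.
pose m := Num.max c a; pose n := Num.min d b.
case: (leP m n) => mn.
  have -> : \int[mu]_x (\1_`[c, d] x * (\1_`[a, b] x * g x)) = \int[mu]_(x in `[m, n]) g x.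
    rewrite Rintegral_segE; apply: eq_Rintegral => x _; rewrite mulrA; congr (_ * _).
    rewrite !indicE !mem_setE !in_itv/= -natrM mulnb; congr (_%:R); congr nat_of_bool.
    rewrite /m /n ge_max le_min.
    by apply/idP/idP => [/andP[/andP[-> ->] /andP[-> ->]]|/andP[/andP[-> ->] /andP[-> ->]]].
  rewrite -pf//; have -> : f m = f c by rewrite /m; case: (leP c a) => //; rewrite le_eqVlt => /predU1P[->|/out->].
  have -> : f n = f d by rewrite /n; case: (leP d b) => // /out' ->.
  by rewrite subrr.
have -> : \int[mu]_x (\1_`[c, d] x * (\1_`[a, b] x * g x)) = 0.
  rewrite (_ : Rintegral _ _ _ = \int[mu]_x 0); first by rewrite Rintegral_cst// mul0r.
  apply: eq_Rintegral => x _; rewrite mulrA !indicE !mem_setE !in_itv/= -natrM mulnb.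
  rewrite (_ : _ && _ = false) ?mul0r//; apply/negP => /andP[/andP[x1 x2] /andP[x3 x4]].
  by move: mn; rewrite ltNge; apply/negP/negPn; rewrite /m /n ge_max !le_min; repeat (apply/andP; split); lra.
have ab' := ab; have [dc|cd'] : d < a \/ b < c.
  by move: mn; rewrite /m /n gt_min !lt_max => /orP[/orP[|]|/orP[|]] *; [left; lra|left|right|left; lra].
- by rewrite !out ?subrr//; exact: le_lt_trans dc.
- by rewrite !out' ?subrr//; exact: lt_le_trans cd.
Qed.

(** The Hoelder estimate is taken from the end point [a], where [f] vanishes. *)
Lemma supported_sup f g x : ac_pair f g -> supported f -> `|f x| <= sd * N2 g.
Proof.
move=> fg sf; have [_ Lg pf] := fg; have [fa _] := supported_end (ac_pair_continuous fg) sf.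
case: (boolP (x \in `[a, b])) => [|/sf ->]; last by rewrite normr0 mulr_ge0// ip_norm_ge0.
rewrite in_itv/= => /andP[ax xb]; have := primitive_hoelder x a Lg pf; rewrite fa subr0.
move=> h; apply: le_trans h _; rewrite ler_wpM2r ?ip_norm_ge0// ler_wsqrtr//.
by rewrite ger0_norm ?subr_ge0//; lra.
Qed.

Lemma supported_N2 f g : ac_pair f g -> supported f -> N2 f <= dl * N2 g.
Proof.
move=> fg sf; have [Lf Lg _] := fg.
have L1 := L2Z (sd * N2 g) (L2_indic a b).
apply: (@le_trans _ _ (N2 ((sd * N2 g) *: \1_`[a, b]))).
  apply: N2_le => // x; rewrite -[X in _ <= `|X|]/(_ * \1_`[a, b] x) indicE mem_setE.
  case: (boolP (x \in _)) => xab; last by rewrite sf// normr0.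
  by rewrite mulr1 [leRHS]ger0_norm ?mulr_ge0 ?ip_norm_ge0//; exact: supported_sup.
rewrite (ip_normZ ip2P); last exact: L2_indic.
rewrite N2_indic ?(ltW ab)// addrAC subrr add0r ger0_norm ?mulr_ge0 ?ip_norm_ge0//.
have -> : sd * N2 g * sd = dl * N2 g by rewrite mulrAC sdE.
exact: lexx.
Qed.

Lemma supported_square p : AC p -> supported p.1 ->
  N2 (ac_mul p p).1 <= dl * sd * N2 p.2 ^+ 2 /\ N2 (ac_mul p p).2 <= 2 * sd * N2 p.2 ^+ 2.
Proof.
move=> hp sp; have [L1 L2' _] := hp; have m1 := L2_measurable L1.
have sup x := supported_sup x hp sp.
have [La Na] := L2_bounded_mul m1 sup L1; have [Lb Nb] := L2_bounded_mul m1 sup L2'.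
have y0 := ip_norm_ge0 (ip := ip2) p.2.
split.
  apply: le_trans Na _.
  have := ler_wpM2l (mulr_ge0 sd0 y0) (supported_N2 hp sp).
  by rewrite expr2; lra.
have -> : (ac_mul p p).2 = (fun x => p.1 x * p.2 x) + (fun x => p.1 x * p.2 x).
  by apply/funext => x; rewrite /= [p.2 x * _]mulrC.
by apply: le_trans (ip_normD ip2P Lb Lb) _; rewrite expr2; lra.
Qed.

(** The transform increases neither norm of the square; the supremum bound is [ac_pair_sup] with
    [2 * (dl * sd) * (2 * sd) = (2 * dl) ^+ 2]. *)
Lemma supported_hilbert p : AC p -> supported p.1 ->
  [/\ forall x, `|(ac_hilbert (ac_mul p p)).1 x| <= 2 * dl * N2 p.2 ^+ 2,
      N2 (ac_hilbert (ac_mul p p)).1 <= dl * sd * N2 p.2 ^+ 2 &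
      N2 (ac_hilbert (ac_mul p p)).2 <= 2 * sd * N2 p.2 ^+ 2].
Proof.
move=> hp sp; have hm := ac_mul_space hp hp; have im := ac_mul_integrable hp hp.
have hH := ac_hilbert_space hm im; have [n1 n2] := ac_hilbert_norms hm im hH.
have [s1 s2] := supported_square hp sp.
have k1 := le_trans n1 s1; have k2 := le_trans n2 s2.
split => // x; have y0 := sqr_ge0 (N2 p.2).
have B0 : 0 <= 2 * dl * N2 p.2 ^+ 2 by apply: mulr_ge0 => //; apply: mulr_ge0 => //; exact: ltW.
rewrite -(@ler_pXn2r _ 2) ?nnegrE// real_normK ?num_real//.
apply: le_trans (ac_pair_sup x hH) _.
have := ler_pM (ip_norm_ge0 _) (ip_norm_ge0 _) k1 k2.
have -> : dl * sd * N2 p.2 ^+ 2 * (2 * sd * N2 p.2 ^+ 2) = 2 * dl * (sd * sd) * (N2 p.2 ^+ 2) ^+ 2 by ring.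
by rewrite sdE; lra.
Qed.

(** The pairing is the integral of [u_x^2 v + u u_x v_x]. The derivative [u_x] vanishes almost
    everywhere off the interval, so only the values of [v] on it matter, and [|u| <= sd * N2 u_x]
    bounds the second term by [sd * N2 v_x * N2 u_x ^+ 2]. *)
Lemma supported_energy p r : AC p -> AC r -> supported p.1 ->
  (forall x, x \in `[a, b] -> r.1 x + sd * N2 r.2 <= - (3 / 2)) ->
  ip2 p.2 (ac_mul p r).2 <= - (3 / 2) * N2 p.2 ^+ 2.
Proof.
move=> hp hr sp hrb; have [L1 L2' _] := hp; have [K1 K2 _] := hr.
have m1 := L2_measurable L1; have m2 := L2_measurable K1.
have sup x := supported_sup x hp sp.
have [La Na] := L2_bounded_mul m1 sup K2.
have rsup x := ac_norm_sup x hr.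
have [Lb _] := L2_bounded_mul m2 rsup L2'.
have E : (ac_mul p r).2 = (fun x => p.1 x * r.2 x) + (fun x => r.1 x * p.2 x).
  by apply/funext => x; rewrite /= [p.2 x * _]mulrC.
rewrite E (ip_addr ip2P)//.
have c1 : ip2 p.2 (fun x => p.1 x * r.2 x) <= sd * N2 r.2 * N2 p.2 ^+ 2.
  apply: le_trans (ler_norm _) _; apply: le_trans (ip_cauchy_schwarz ip2P L2' La) _.
  have := ler_wpM2l (ip_norm_ge0 (ip := ip2) p.2) Na; rewrite expr2; lra.
suff c2 : ip2 p.2 (fun x => r.1 x * p.2 x) <= (- (3 / 2) - sd * N2 r.2) * N2 p.2 ^+ 2 by lra.
pose A x := \1_`[a, b] x * p.2 x.
have mi : measurable_fun setT (\1_`[a, b] : R -> R) by exact: measurable_indic.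
have [LA _] : L2 A /\ N2 A <= 1 * N2 p.2.
  by apply: L2_bounded_mul => // x; rewrite indicE; case: (_ \in _); rewrite ?normr1 ?normr0.
have [LrA _] := L2_bounded_mul m2 rsup LA.
have eA : p.2 = A %[ae mu].
  apply: aeS (supported_derivative hp sp) => x hx _.
  by rewrite /A indicE mem_setE; case: (boolP (x \in _)) => [_|/hx ->]; rewrite ?mul1r ?mulr0.
have erA : (fun x => r.1 x * p.2 x) = (fun x => r.1 x * A x) %[ae mu].
  by apply: aeS eA => x /= -> .
rewrite (ip2_ae_eq L2' Lb LA LrA eA erA) (ip_norm2_ae_eq (L2_measurable L2') (L2_measurable LA) eA).
rewrite (ip_normE ip2P)// /ip2 -RintegralZl//; last exact: L2_mul.
apply: le_Rintegral => //; [exact: L2_mul|by apply: itgZ; exact: L2_mul|].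
move=> x _; rewrite /A indicE mem_setE; case: (boolP (x \in _)) => xab; last by rewrite !mul0r !mulr0.
rewrite !mul1r mulrCA ler_wpM2r -?expr2 ?sqr_ge0//.
by have := hrb x xab; lra.
Qed.

End CompactSupport.

(** * Bounds valid as long as the bootstrap condition holds *)

Section APrioriBounds.
Context {R : realType}.
Local Notation mu := (@lebesgue_measure R).
Local Notation N2 := (ip_norm ip2).
Local Notation N1 := (ip_norm ac_ip).
Local Notation N := (ip_norm state_ip).
Local Notation AC := (@ac_space R).
Local Notation E := (@state_space R).
Local Notation F := vector_field.

Lemma state_components (W : ((R -> R) * (R -> R)) * ((R -> R) * (R -> R))) : E W ->
  [/\ forall x, `|W.1.1 x| <= N W, forall x, `|W.2.1 x| <= N W &
      [/\ N2 W.1.1 <= N W, N2 W.1.2 <= N W, N2 W.2.1 <= N W & N2 W.2.2 <= N W]].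
Proof.
move=> hW; have [h1 h2] := hW; have n1 := state_norm1 hW; have n2 := state_norm2 hW.
split; [| |split].
- by move=> x; apply: le_trans n1; exact: ac_norm_sup.
- by move=> x; apply: le_trans n2; exact: ac_norm_sup.
- by apply: le_trans n1; exact: ac_norm1.
- by apply: le_trans n1; exact: ac_norm2.
- by apply: le_trans n2; exact: ac_norm1.
- by apply: le_trans n2; exact: ac_norm2.
Qed.

Lemma state_norm_sum X : E X -> N X <= N2 X.1.1 + N2 X.1.2 + (N2 X.2.1 + N2 X.2.2).
Proof.
move=> hX; have [h1 h2] := hX; apply: le_trans (state_norm_le hX) _.
exact: lerD (ac_norm_le h1) (ac_norm_le h2).
Qed.

Variables (a dl : R) (X : R -> ((R -> R) * (R -> R)) * ((R -> R) * (R -> R))) (T M K : R).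
Hypothesis dl0 : 0 < dl.
Local Notation b := (a + dl).
Local Notation sd := (Num.sqrt dl).
Local Notation y0 := (N2 (X 0).1.2).
Local Notation z0 := (N2 (X 0).2.2).
Hypothesis K0 : 0 <= K.
Hypothesis hE : forall t, 0 <= t <= T -> E (X t).
Hypothesis hX : forall s t, 0 <= s -> s <= t -> t <= T ->
  N (X t - X s - (t - s) *: F (X s)) <= K * (t - s) ^+ 2.
Hypothesis hM : forall t, 0 <= t <= T -> N (X t) <= M.
Hypothesis sup0 : supported a dl (X 0).1.1.
Hypothesis hb : forall t, 0 <= t <= T ->
  forall x, x \in `[a, b] -> (X t).2.1 x + sd * N2 (X t).2.2 <= - (3 / 2).

Let M0 : 0 <= T -> 0 <= M.
Proof. by move=> T0; apply: le_trans (ip_norm_ge0 (ip := state_ip) (X 0)) _; apply: hM; rewrite lexx. Qed.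

Let step s t : 0 <= s -> s <= t -> t <= T ->
  [/\ E (X s), E (X t), E (F (X s)), E (X t - X s - (t - s) *: F (X s)) &
      N (X t - X s - (t - s) *: F (X s)) <= K * (t - s) ^+ 2].
Proof.
move=> s_ge0 st tT; have Es : E (X s) by apply: hE; rewrite s_ge0 (le_trans st).
have Et : E (X t) by apply: hE; rewrite tT (le_trans s_ge0).
have Fs := vector_field_space Es; split => //; last exact: hX.
by apply: (ip_memB state_ipP); [exact: (ip_memB state_ipP)|exact: (ip_memZ state_ipP)].
Qed.

(** At a fixed point [x] the first equation is linear in [u] with coefficient [2 v], bounded by
    [2 * M]; a zero initial value persists by Gronwall. *)
Lemma solution_supported t : 0 <= t <= T -> supported a dl (X t).1.1.
Proof.
move=> tT x xab; have T0 : 0 <= T by case/andP: tT; exact: le_trans.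
have := @gronwall_increments _ (fun t => `|(X t).1.1 x|) (2 * M) T K K0 _ _ t tT.
rewrite sup0// normr0 mul0r => h; apply/eqP; rewrite -normr_le0; apply: h => // s r s0 sr rT.
have [Es Er Fs EW NW] := step s0 sr rT; have [h1 _ _] := state_components EW.
have [_ h2 _] := state_components Es.
have sM : N (X s) <= M by apply: hM; rewrite s0 (le_trans sr).
have := le_trans (h1 x) NW.
rewrite -[(_ - _ - _).1.1 x]/((X r).1.1 x - (X s).1.1 x - (r - s) * (2 * ((X s).1.1 x * (X s).2.1 x))).
move: (h2 x); move: ((X s).1.1 x) ((X r).1.1 x) ((X s).2.1 x) => us ur vs v1 w1.
have rs0 : 0 <= r - s by rewrite subr_ge0.
have e : ur = (ur - us - (r - s) * (2 * (us * vs))) + (1 + 2 * (r - s) * vs) * us by ring.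
rewrite {1}e; apply: le_trans (ler_normD _ _) _; rewrite addrC lerD// normrM ler_wpM2r//.
apply: le_trans (ler_normD _ _) _; rewrite normr1 lerD2l normrM ger0_norm ?mulr_ge0//.
have := ler_wpM2l rs0 (le_trans v1 sM); lra.
Qed.

Lemma solution_derivative_decay t : 0 <= t <= T -> N2 (X t).1.2 ^+ 2 <= y0 ^+ 2 * expR (- 6 * t).
Proof.
move=> tT; have T0 : 0 <= T by case/andP: tT; exact: le_trans.
(* Coefficients of the squared step [h ^+ 2]: [36 * M ^+ 4] from the square of [2 * h] times a
   product of norm at most [3 * M ^+ 2], then the cross term with the remainder [W], then the square
   of [W], for which [h ^+ 4 <= T ^+ 2 * h ^+ 2]. *)
have m0 := M0 T0; pose B := 36 * M ^+ 4 + 2 * K * (M + 6 * T * M ^+ 2) + K ^+ 2 * T ^+ 2.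
have B0 : 0 <= B by rewrite !addr_ge0// !mulr_ge0// ?exprn_ge0// addr_ge0// !mulr_ge0// exprn_ge0.
apply: (@gronwall_increments _ (fun t => N2 (X t).1.2 ^+ 2) (- 6) T B B0) => // [r _|s r s0 sr rT].
  exact: sqr_ge0.
have [Es Er Fs EW NW] := step s0 sr rT; have [_ _ [_ h1 _ _]] := state_components EW.
have [p1 p2] := Es; have sT : 0 <= s <= T by rewrite s0 (le_trans sr).
have sM := hM sT; have en := supported_energy dl0 p1 p2 (solution_supported sT) (hb sT).
set A := (X s).1.2 in en *; set B' := (ac_mul (X s).1 (X s).2).2 in en.
have LA : L2 A by have [_ []] := p1.
have p12 := ac_mul_space p1 p2; have LB : L2 B' by have [_ []] := p12.
have LW : L2 (X r - X s - (r - s) *: F (X s)).1.2 by have [[_ []]] := EW.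
set W := _.1.2 in h1 LW; set h := r - s in NW h1 *.
have h0 : 0 <= h by rewrite subr_ge0.
have hT : h <= T by rewrite /h; lra.
have e : (X r).1.2 = W + (A + (2 * h) *: B').
  apply/funext => x.
  by rewrite -[RHS]/((X r).1.2 x - A x - h * (2 * B' x) + (A x + 2 * h * B' x)); ring.
have nA : N2 A <= M by apply: le_trans sM; have [_ _ []] := state_components Es.
have nB : N2 B' <= 3 * M ^+ 2.
  apply: le_trans (ac_norm2 p12) _; apply: le_trans (ac_norm_mul p1 p2) _.
  by rewrite expr2 ler_wpM2l// ler_pM ?ip_norm_ge0// (le_trans _ sM)//; [exact: state_norm1|exact: state_norm2].
have LhB := L2Z (2 * h) LB; have LAB := L2D LA LhB.
have nW : N2 W <= K * h ^+ 2 := le_trans h1 NW.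
have a0 := ip_norm_ge0 (ip := ip2) A; have b0 := ip_norm_ge0 (ip := ip2) B'.
have w0 := ip_norm_ge0 (ip := ip2) W; have ab0 := ip_norm_ge0 (ip := ip2) (A + (2 * h) *: B').
have nAB : N2 (A + (2 * h) *: B') <= M + 6 * T * M ^+ 2.
  apply: le_trans (ip_normD ip2P LA LhB) _; rewrite (ip_normZ ip2P)// ger0_norm ?mulr_ge0//.
  rewrite lerD//; apply: le_trans (ler_pM _ b0 (ler_wpM2l _ hT) nB) _ => //; [by rewrite mulr_ge0|lra].
(* The cross term [4 * h * ip2 A B'] meets [supported_energy], and [4 * (3 / 2) = 6] is the decay
   rate. *)
have sqAB : N2 (A + (2 * h) *: B') ^+ 2 <= (1 + - 6 * h) * N2 A ^+ 2 + 36 * M ^+ 4 * h ^+ 2.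
  rewrite (ip_normE ip2P)// (ip_sqD ip2P)// (ip_scaler ip2P)// (ip_scaler ip2P)// (ip_scalel ip2P)//.
  rewrite -!(ip_normE ip2P)//.
  have nB2 : N2 B' ^+ 2 <= 9 * M ^+ 4.
    have -> : 9 * M ^+ 4 = (3 * M ^+ 2) ^+ 2 by ring.
    by rewrite ler_pXn2r ?nnegrE// mulr_ge0// sqr_ge0.
  have := ler_wpM2l h0 en; have := ler_wpM2l (sqr_ge0 h) nB2; lra.
rewrite e; apply: (@le_trans _ _ ((N2 W + N2 (A + (2 * h) *: B')) ^+ 2)).
  by rewrite ler_pXn2r ?nnegrE ?addr_ge0 ?ip_norm_ge0//; exact: (ip_normD ip2P LW LAB).
rewrite sqrrD.
have q1 : N2 W ^+ 2 <= K ^+ 2 * T ^+ 2 * h ^+ 2.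
  have -> : K ^+ 2 * T ^+ 2 * h ^+ 2 = (K * (T * h)) ^+ 2 by ring.
  rewrite ler_pXn2r ?nnegrE ?mulr_ge0//; apply: le_trans nW _.
  by rewrite ler_wpM2l// expr2 ler_wpM2r.
have q2 := ler_pM w0 ab0 nW nAB.
by rewrite /B; move: q1 q2 sqAB; move: (N2 W) (N2 _) => w ab q1 q2 q3; lra.
Qed.

(** The source of each quantity is at most [c * y0 ^+ 2 * expR (- 6 * s)], by [supported_hilbert]
    and the decay of [u_x]. Its integral over all times costs the factor [1/6] and stays bounded
    uniformly in [T]. *)
Lemma solution_velocity_bounds t : 0 <= t <= T ->
  [/\ N2 (X t).2.2 <= z0 + sd * y0 ^+ 2 / 3,
      forall x, (X t).2.1 x <= (X 0).2.1 x + dl * y0 ^+ 2 / 3 &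
      N2 (X t).2.1 <= N2 (X 0).2.1 + dl * sd * y0 ^+ 2 / 6].
Proof.
move=> tT; have T0 : 0 <= T by case/andP: tT; exact: le_trans.
have sd0 : 0 <= sd := sqrtr_ge0 _; have dl0' := ltW dl0; have y20 := sqr_ge0 y0.
have key s r : 0 <= s -> s <= r -> r <= T ->
  [/\ N2 (X r).2.2 <= N2 (X s).2.2 + (r - s) * (2 * sd * y0 ^+ 2 * expR (- 6 * s)) + K * (r - s) ^+ 2,
   forall x, (X r).2.1 x <= (X s).2.1 x + (r - s) * (2 * dl * y0 ^+ 2 * expR (- 6 * s)) + K * (r - s) ^+ 2 &
   N2 (X r).2.1 <= N2 (X s).2.1 + (r - s) * (dl * sd * y0 ^+ 2 * expR (- 6 * s)) + K * (r - s) ^+ 2].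
  move=> s0 sr rT; have [Es Er Fs EW NW] := step s0 sr rT.
  have [_ w2 [_ _ w3 w4]] := state_components EW.
  have sT : 0 <= s <= T by rewrite s0 (le_trans sr).
  have [p1 p2] := Es; have dec := solution_derivative_decay sT.
  have [H1 H2 H3] := supported_hilbert dl0 p1 (solution_supported sT).
  have [_ [Lk1 Lk2 _]] := Fs; have [_ [LW1 LW2 _]] := EW; have [Ls1 Ls2 _] := p2.
  have h0 : 0 <= r - s by rewrite subr_ge0.
  set k := ac_hilbert _ in H1 H2 H3; set h := r - s in NW h0 w2 w3 w4 LW1 LW2 *.
  set W := _ - _ in NW w2 w3 w4 LW1 LW2.
  have up f g w : L2 f -> L2 g -> L2 w -> N2 (w + (f + h *: g)) <= N2 f + h * N2 g + N2 w.
    move=> lf lg lw; have lhg := L2Z h lg; apply: le_trans (ip_normD ip2P lw (L2D lf lhg)) _.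
    by rewrite addrC lerD2r; apply: le_trans (ip_normD ip2P lf lhg) _; rewrite (ip_normZ ip2P)// ger0_norm.
  have fin A B c : 0 <= c -> A <= c * N2 (X s).1.2 ^+ 2 -> B <= N W -> h * A + B <=
      h * (c * y0 ^+ 2 * expR (- 6 * s)) + K * h ^+ 2.
    move=> c0 hA hB; apply: lerD (le_trans hB NW); apply: ler_wpM2l => //.
    by apply: le_trans hA _; rewrite -mulrA ler_wpM2l.
  split.
  - have -> : (X r).2.2 = W.2.2 + ((X s).2.2 + h *: k.2).
      apply/funext => x; rewrite -[RHS]/((X r).2.2 x - (X s).2.2 x - h * k.2 x + ((X s).2.2 x + h * k.2 x)).
      by ring.
    apply: le_trans (up _ _ _ Ls2 Lk2 LW2) _; rewrite -!addrA lerD2l.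
    by apply: fin => //; rewrite mulr_ge0.
  - move=> x; have wx := w2 x; have Wx : W.2.1 x = (X r).2.1 x - (X s).2.1 x - h * k.1 x by [].
    have Bx : W.2.1 x <= N W := le_trans (ler_norm _) wx.
    have := fin (k.1 x) (W.2.1 x) (2 * dl) _ _ Bx.
    rewrite mulr_ge0// => /(_ isT (le_trans (ler_norm _) (H1 x))); rewrite Wx => H.
    by rewrite -addrA -lerBlDl; apply: le_trans H; rewrite [leRHS]addrC subrK.
  - have -> : (X r).2.1 = W.2.1 + ((X s).2.1 + h *: k.1).
      apply/funext => x; rewrite -[RHS]/((X r).2.1 x - (X s).2.1 x - h * k.1 x + ((X s).2.1 x + h * k.1 x)).
      by ring.
    apply: le_trans (up _ _ _ Ls1 Lk1 LW1) _; rewrite -!addrA lerD2l.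
    by apply: fin => //; rewrite mulr_ge0.
split.
- have := @decaying_increments _ (fun t => N2 (X t).2.2) T (2 * sd * y0 ^+ 2) K _ K0 _ t tT.
  have -> : 2 * sd * y0 ^+ 2 / 6 = sd * y0 ^+ 2 / 3 by lra.
  by apply; [by apply: mulr_ge0 => //; rewrite mulr_ge0|move=> s r s0 sr rT; have [] := key s r s0 sr rT].
- move=> x; have := @decaying_increments _ (fun t => (X t).2.1 x) T (2 * dl * y0 ^+ 2) K _ K0 _ t tT.
  have -> : 2 * dl * y0 ^+ 2 / 6 = dl * y0 ^+ 2 / 3 by lra.
  by apply; [by apply: mulr_ge0 => //; rewrite mulr_ge0|move=> s r s0 sr rT; have [] := key s r s0 sr rT].
- have := @decaying_increments _ (fun t => N2 (X t).2.1) T (dl * sd * y0 ^+ 2) K _ K0 _ t tT.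
  by apply; [by apply: mulr_ge0 => //; rewrite mulr_ge0|move=> s r s0 sr rT; have [] := key s r s0 sr rT].
Qed.

End APrioriBounds.

Lemma natural_steps {R : realType} (P : R -> Prop) eta : 0 < eta -> P 0 ->
  (forall T, 0 <= T -> (forall t, 0 <= t <= T -> P t) ->
    forall t, T <= t <= T + eta -> P t) ->
  forall t, 0 <= t -> P t.
Proof.
move=> e0 P0 step t t0.
suff H n : forall t, 0 <= t <= n%:R * eta -> P t.
  have /truncn_itv/andP[_] := divr_ge0 t0 (ltW e0); rewrite ltr_pdivrMr// => /ltW h.
  by apply: (H (Num.truncn (t / eta)).+1); rewrite t0.
elim: n => [|n IH] {t0}t.
  by rewrite mul0r => t0; rewrite (_ : t = 0)//; apply/le_anti; rewrite andbC.
move=> /andP[t0 tn]; case: (leP t (n%:R * eta)) => h; first by apply: IH; rewrite t0.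
have n0 : 0 <= n%:R * eta by rewrite mulr_ge0 ?ler0n// ltW.
by apply: (step _ n0 IH); rewrite (ltW h)/=; move: tn; rewrite -natr1 mulrDl mul1r.
Qed.

(** * Closing the bootstrap *)

Section GlobalSolution.
Context {R : realType}.
Local Notation N2 := (ip_norm ip2).
Local Notation N1 := (ip_norm ac_ip).
Local Notation N := (ip_norm state_ip).
Local Notation E := (@state_space R).
Local Notation F := vector_field.

Lemma global_solution (X0 : ((R -> R) * (R -> R)) * ((R -> R) * (R -> R))) (a dl : R) :
  E X0 -> 0 < dl -> supported a dl X0.1.1 ->
  (forall x, x \in `[a, a + dl] -> X0.2.1 x <= - 3) ->
  Num.sqrt dl * (N2 X0.2.2 + 3^-1 * Num.sqrt dl * N2 X0.1.2 ^+ 2) < 4^-1 ->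
  exists X (K M : R), [/\ X 0 = X0, forall t, 0 <= t -> E (X t), 0 <= K,
    forall s t, 0 <= s -> s <= t ->
      N (X t - X s - (t - s) *: F (X s)) <= K * (t - s) ^+ 2 /\
      (t - s <= 1 -> N (X t - X s) <= K * (t - s)) &
    forall t, 0 <= t -> [/\ N (X t) <= M,
      forall x, `|(X t).1.1 x| <= Num.sqrt dl * N2 X0.1.2 * expR (- 3 * t) &
      N1 (X t).1 <= (dl + 1) * N2 X0.1.2 * expR (- 3 * t)]].
Proof.
move=> EX0 dl0 s0 hv small; set sd := Num.sqrt dl in small *.
have sd0 : 0 <= sd := sqrtr_ge0 _; have sdE : sd * sd = dl by rewrite -expr2 sqr_sqrtr// ltW.
set y0 := N2 X0.1.2 in small *; set z0 := N2 X0.2.2 in small.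
have y00 : 0 <= y0 := ip_norm_ge0 _; have z00 : 0 <= z0 := ip_norm_ge0 _.
have dl0' := ltW dl0; have y20 := sqr_ge0 y0.
(* [M1] is the sum of the bounds which the bootstrap gives for the four component norms; the field
   is frozen outside radius [M1 + 1], which leaves room for one continuation step. *)
pose M1 := (dl + 1) * y0 + (N2 X0.2.1 + dl * sd * y0 ^+ 2 / 6) + (z0 + sd * y0 ^+ 2 / 3).
have M10 : 0 <= M1.
  by rewrite /M1 !addr_ge0 ?ip_norm_ge0// ?divr_ge0// ?mulr_ge0// ?mulr_ge0// addr_ge0.
have M0 : 0 < M1 + 1 by rewrite ltr_pwDr.
have [X [G [K [K0 X0E EX GF XE]]]] := state_flow EX0 M0.
(* [good 1] is the condition assumed on an interval, [good 0] the improved one that [improve]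
   returns. *)
pose good k t := N (X t) <= M1 + k /\ forall x, x \in `[a, a + dl] ->
  (X t).2.1 x + sd * N2 (X t).2.2 <= - (5 / 2) + k.
have improve T : 0 <= T -> (forall t, 0 <= t <= T -> good 1 t) ->
    forall t, 0 <= t <= T -> [/\ good 0 t, supported a dl (X t).1.1 &
      N2 (X t).1.2 ^+ 2 <= y0 ^+ 2 * expR (- 6 * t)].
  move=> T0 gT t tT.
  have hE r : 0 <= r <= T -> E (X r) by case/andP => r0 _; exact: EX.
  have hM r : 0 <= r <= T -> N (X r) <= M1 + 1 by move=> /gT[].
  have hX s r : 0 <= s -> s <= r -> r <= T -> N (X r - X s - (r - s) *: F (X s)) <= K * (r - s) ^+ 2.
    move=> s_ge0 sr rT; have [+ _] := XE s r s_ge0 sr; rewrite GF//; first exact: EX.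
    by apply: hM; rewrite s_ge0 (le_trans sr).
  have sup : supported a dl (X 0).1.1 by rewrite X0E.
  have hb r : 0 <= r <= T -> forall x, x \in `[a, a + dl] ->
      (X r).2.1 x + sd * N2 (X r).2.2 <= - (3 / 2).
    by move=> /gT[_ h] x /h; lra.
  have tsup := solution_supported K0 hE hX hM sup tT.
  have dec := solution_derivative_decay dl0 K0 hE hX hM sup hb tT.
  have [v1 v2 v3] := solution_velocity_bounds dl0 K0 hE hX hM sup hb tT.
  rewrite X0E -/y0 -/z0 -/sd in dec v1 v2 v3; have Et := hE _ tT; have [p1 p2] := Et.
  split => //; split.
    have nu := supported_N2 dl0 p1 tsup.
    have ny : N2 (X t).1.2 <= y0.
      rewrite -(@ler_pXn2r _ 2)// ?nnegrE ?ip_norm_ge0//; apply: le_trans dec _.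
      by rewrite ler_piMr// -expR0 ler_expR mulNr oppr_le0 mulr_ge0//; case/andP: tT.
    apply: le_trans (state_norm_sum Et) _; rewrite addr0 /M1.
    by have := ler_wpM2l dl0' ny; lra.
  (* The sum is at most [-3 + sd * z0 + 2 * dl * y0 ^+ 2 / 3], and what is added to [-3] is at most
     twice the quantity assumed to be below [1/4]. *)
  move=> x xab; have := v2 x; have := hv x xab; have := ler_wpM2l sd0 v1.
  have e1 : sd * (sd * y0 ^+ 2 / 3) = dl * y0 ^+ 2 / 3 by rewrite -sdE; ring.
  have e2 : sd * (z0 + 3^-1 * sd * y0 ^+ 2) = sd * z0 + dl * y0 ^+ 2 / 3 by rewrite -sdE; field.
  by rewrite mulrDr e1; rewrite e2 in small; have := mulr_ge0 sd0 z00; have := mulr_ge0 dl0' y20; lra.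
have good0 : good 1 0.
  rewrite /good X0E; split.
    apply: le_trans (state_norm_sum EX0) _; have [p1 _] := EX0.
    have := supported_N2 dl0 p1 s0; rewrite -/y0 -/z0 /M1.
    have : 0 <= dl * sd * y0 ^+ 2 / 6 by rewrite divr_ge0// !mulr_ge0.
    have : 0 <= sd * y0 ^+ 2 / 3 by rewrite divr_ge0// mulr_ge0.
    by lra.
  move=> x xab; have := hv x xab; rewrite -/z0.
  have : 0 <= sd * (3^-1 * sd * y0 ^+ 2) by rewrite !mulr_ge0.
  by move: small; rewrite mulrDr; lra.
(* In a time [eta] the state moves by at most [1 / (1 + sd)], so neither the norm nor [v + sd * z]
   grows by more than 1. *)
pose eta := Num.min 1 ((K + 1) * (1 + sd))^-1.
have Ks : 0 < (K + 1) * (1 + sd) by apply: mulr_gt0; lra.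
have eta0 : 0 < eta by rewrite lt_min ltr01 invr_gt0.
have all_good t : 0 <= t -> good 1 t.
  apply: (natural_steps eta0 good0) => T T0 gT {}t /andP[Tt tT].
  have TT : 0 <= T <= T by rewrite T0 lexx.
  have [[g1 g2] _ _] := improve T T0 gT T TT.
  have [_ XL] := XE T t T0 Tt; have h0 : 0 <= t - T by rewrite subr_ge0.
  have h1 : t - T <= eta by lra.
  have [h2 h3] : t - T <= 1 /\ (t - T) * ((K + 1) * (1 + sd)) <= 1.
    split; first by apply: le_trans h1 _; rewrite ge_min lexx.
    rewrite -ler_pdivlMr// mul1r; apply: le_trans h1 _; by rewrite ge_min lexx orbT.
  have d := XL h2; have ET := EX T T0; have Et := EX t (le_trans T0 Tt).
  have EW := ip_memB state_ipP Et ET; have [_ w1 [_ _ _ w2]] := state_components EW.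
  have dk : N (X t - X T) * (1 + sd) <= 1.
    apply: le_trans h3; rewrite mulrA ler_wpM2r ?addr_ge0//; apply: le_trans d _.
    by rewrite mulrC ler_wpM2l// lerDl.
  have n0 := ip_norm_ge0 (ip := state_ip) (X t - X T).
  have nx1 : N (X t - X T) <= 1 by apply: le_trans dk; rewrite mulrDr mulr1 lerDl mulr_ge0.
  split.
    have -> : X t = (X t - X T) + X T by rewrite subrK.
    rewrite addr0 in g1; apply: le_trans (ip_normD state_ipP EW ET) _.
    by rewrite addrC lerD.
  move=> x xab; have := g2 x xab.
  have e1 : (X t).2.1 x <= (X T).2.1 x + N (X t - X T).
    by rewrite -lerBlDl; exact: le_trans (ler_norm _) (w1 x).
  have e2 : N2 (X t).2.2 <= N2 (X T).2.2 + N (X t - X T).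
    have [_ [_ LT _]] := ET; have [_ [_ Lt _]] := Et; have [_ [_ LW _]] := EW.
    have -> : (X t).2.2 = (X t - X T).2.2 + (X T).2.2.
      by apply/funext => z; rewrite -[RHS]/((X t).2.2 z - (X T).2.2 z + (X T).2.2 z) subrK.
    by apply: le_trans (ip_normD ip2P LW LT) _; rewrite addrC lerD2l.
  move=> g; apply: le_trans (lerD e1 (ler_wpM2l sd0 e2)) _; rewrite mulrDr addrACA.
  rewrite addr0 in g; apply: lerD g _.
  by apply: le_trans dk; rewrite mulrDr mulr1 [sd * _]mulrC.
have result t : 0 <= t -> [/\ good 0 t, supported a dl (X t).1.1 &
      N2 (X t).1.2 ^+ 2 <= y0 ^+ 2 * expR (- 6 * t)].
  move=> t0; apply: (improve t t0); last by rewrite t0 lexx.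
  by move=> s /andP[s_ge0 _]; exact: all_good.
exists X, K, M1; split => //.
- move=> s t s_ge0 st; have [h1 h2] := XE s t s_ge0 st; split => //.
  by rewrite -GF//; [exact: EX|have [] := all_good s s_ge0].
- move=> t t0; have [[g1 _] sup dec] := result t t0; have [p1 _] := EX t t0.
  have ny : N2 (X t).1.2 <= y0 * expR (- 3 * t).
    rewrite -(@ler_pXn2r _ 2)// ?nnegrE ?ip_norm_ge0 ?mulr_ge0 ?expR_ge0//.
    by rewrite exprMn -expRM_natl mulrA (_ : 2%:R * - 3 = - 6)//; ring.
  split; first by rewrite addr0 in g1.
    move=> x; have h : `|(X t).1.1 x| <= sd * N2 (X t).1.2 by exact: supported_sup p1 sup.
    by apply: le_trans h _; rewrite -mulrA; apply: ler_wpM2l.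
  apply: le_trans (ac_norm_le p1) _; have := supported_N2 dl0 p1 sup.
  have := ler_wpM2l dl0' ny; lra.
Qed.

End GlobalSolution.

(** * Solutions and uniqueness *)

Section Representatives.
Context {R : realType}.
Local Notation mu := (@lebesgue_measure R).
Local Notation N2 := (ip_norm ip2).
Local Notation N1 := (ip_norm ac_ip).
Local Notation N := (ip_norm state_ip).
Local Notation AC := (@ac_space R).
Local Notation E := (@state_space R).
Local Notation F := vector_field.
Implicit Types (p r : (R -> R) * (R -> R)) (f g : R -> R) (T : \bar R).

Lemma H1_measurable f : H1 f -> measurable_fun setT f.
Proof. by move=> [/L2_measurable]. Qed.

Lemma H1_ac f : H1 f -> exists2 p, AC p & f = p.1 %[ae mu].
Proof. by move=> /H1_ac_pair[f0 [g [fg e _]]]; exists (f0, g). Qed.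

Lemma ac_measurable p : AC p -> measurable_fun setT p.1.
Proof. by move=> [/L2_measurable]. Qed.

Lemma ac_H1 p : AC p -> H1 p.1.
Proof. by move=> hp; have [] := ac_pair_H1 (ac_measurable hp) hp (aeW _ (fun x _ => erefl)). Qed.

Lemma H1norm_ac p f : measurable_fun setT f -> AC p -> f = p.1 %[ae mu] -> H1norm f = N1 p.
Proof.
move=> mf hp fp; rewrite (H1norm_ac_pair mf hp fp) -ac_norm_sqr//.
by rewrite sqrtr_sqr ger0_norm ?ip_norm_ge0.
Qed.

Lemma H1norm_ac1 p : AC p -> H1norm p.1 = N1 p.
Proof. by move=> hp; apply: (H1norm_ac (ac_measurable hp) hp); exact: aeW. Qed.

Lemma ac_norm_sub0 p r : AC p -> AC r -> p.1 = r.1 %[ae mu] -> N1 (p - r) = 0.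
Proof.
move=> hp hr e; have hB := ip_memB ac_ipP hp hr.
have [Lp1 Lp2 pp] := hp; have [Lr1 Lr2 pr] := hr.
have H f g : L2 f -> L2 g -> f = g %[ae mu] -> N2 (f - g) = 0.
  move=> lf lg fg; rewrite (@ip_norm2_ae_eq _ (f - g) 0).
  - by rewrite (ip_norm0 ip2P).
  - exact: L2_measurable (L2B lf lg).
  - exact: L2_measurable L20.
  - by apply: aeS fg => x /= h _; rewrite -[LHS]/(f x - g x) h// subrr.
apply/eqP; rewrite -sqrf_eq0 ac_norm_sqr//.
by rewrite (H _ _ Lp1 Lr1 e) (H _ _ Lp2 Lr2 (primitive_unique Lp2 Lr2 pp pr e)) expr0n addr0.
Qed.

(** Equality holds at every point, since a null set does not affect the truncated integrals. *)
Lemma hilbert_ae_eq f g : measurable_fun setT f -> measurable_fun setT g ->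
  f = g %[ae mu] -> hilbert f = hilbert g.
Proof.
move=> mf mg fg; apply/funext => x; rewrite /hilbert.
suff -> : (fun e => \int[mu]_(y in [set y | e < `|x - y|]) (f y / (x - y))) =
    (fun e => \int[mu]_(y in [set y | e < `|x - y|]) (g y / (x - y))) by [].
apply/funext => e; pose k z := if e < `|z| then z^-1 else 0 : R.
have mk : measurable_fun setT (fun y : R => k (x - y)).
  apply: measurable_sub_l; case: (ltP 0 e) => [e0|e0].
    have := measurable_truncated_inverse e0; congr (measurable_fun _ _).
    by apply/funext => z; rewrite truncated_inverseE.
  (* For [e <= 0] nothing but possibly the origin is cut off and [k] is [z^-1], with value 0 at the
     origin; it is a limit of conjugate Poisson kernels, hence measurable. *)
  apply: (@measurable_fun_cvg _ _ _ setT (fun n => conj_poisson n.+1%:R^-1)).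
    by move=> n; apply: measurable_conj_poisson; exact: harmonic_gt0.
  move=> z _; rewrite (_ : k z = z^-1); first exact: conj_poisson_cvg cvg_harmonic.
  rewrite /k; case: ifPn => //; rewrite -leNgt => h; apply/esym/eqP.
  by rewrite invr_eq0 -normr_le0 (le_trans h).
have H h : \int[mu]_(y in [set y | e < `|x - y|]) (h y / (x - y)) =
    \int[mu]_y (k (x - y) * h y).
  rewrite Rintegral_mkcond; apply: eq_Rintegral => y _; rewrite patchE /k.
  case: ifPn => [/set_mem/= ->|]; first exact: mulrC.
  by rewrite notin_setE/= => /negP/negbTE ->; rewrite mul0r.
rewrite !H; apply: Rintegral_ae_eq; [exact: measurable_funM|exact: measurable_funM|].
by apply: aeS fg => y /= h _; rewrite h.
Qed.

Lemma cvg0_within_le (A : set R) (f : R -> R) t B :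
  (forall s, A s -> s != t -> `|s - t| <= 1 -> `|f s| <= B * `|s - t|) ->
  f s @[s --> within A t^'] --> 0.
Proof.
move=> h; apply/cvgr0Pnorm_lt => e e0.
have B0 : 0 < `|B| + 1 by rewrite ltr_wpDl.
have m0 : 0 < Num.min 1 (e / (`|B| + 1)) by rewrite lt_min ltr01 divr_gt0.
rewrite /within/=; apply/nbhs_ballP; exists (Num.min 1 (e / (`|B| + 1))) => //= s.
rewrite /ball/= distrC lt_min ltr_pdivlMr// => /andP[s1 s2] st As.
apply: le_lt_trans (h s As st (ltW s1)) _; apply: le_lt_trans s2.
rewrite mulrC ler_wpM2l//; apply: le_trans (ler_norm B) _; by rewrite lerDl.
Qed.

Lemma cvg0_within_nbhs_le (A : set R) (f : R -> R) t B : f t = 0 ->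
  (forall s, A s -> s != t -> `|s - t| <= 1 -> `|f s| <= B * `|s - t|) ->
  f s @[s --> within A (nbhs t)] --> 0.
Proof.
move=> ft h; apply/cvgr0Pnorm_lt => e e0.
have B0 : 0 < `|B| + 1 by rewrite ltr_wpDl.
have m0 : 0 < Num.min 1 (e / (`|B| + 1)) by rewrite lt_min ltr01 divr_gt0.
rewrite /within/=; apply/nbhs_ballP; exists (Num.min 1 (e / (`|B| + 1))) => //= s.
rewrite /ball/= distrC lt_min ltr_pdivlMr// => /andP[s1 s2] As.
have [->|st] := eqVneq s t; first by rewrite ft normr0.
apply: le_lt_trans (h s As st (ltW s1)) _; apply: le_lt_trans s2.
rewrite mulrC ler_wpM2l//; apply: le_trans (ler_norm B) _; by rewrite lerDl.
Qed.

Lemma cvg0_within_lt (A : set R) (f : R -> R) t e : f s @[s --> within A t^'] --> 0 -> 0 < e ->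
  exists2 d, 0 < d & forall s, A s -> s != t -> `|s - t| < d -> `|f s| < e.
Proof.
move=> /cvgr0Pnorm_lt h e0; have := h e e0; rewrite /within/= => /nbhs_ballP[d /= d0 hd].
by exists d => // s As st sd; apply: hd => //; rewrite /ball/= distrC.
Qed.

Lemma C1_H1_of_ac (W W' : R -> (R -> R) * (R -> R)) B :
  (forall t, 0 <= t -> AC (W t)) -> (forall t, 0 <= t -> AC (W' t)) ->
  (forall s t, 0 <= s -> 0 <= t -> s != t -> `|s - t| <= 1 ->
     N1 ((s - t)^-1 *: (W s - W t) - W' t) <= B * `|s - t|) ->
  (forall s t, 0 <= s -> 0 <= t -> s != t -> `|s - t| <= 1 -> N1 (W' s - W' t) <= B * `|s - t|) ->
  C1_H1 +oo%E (fun t => (W t).1) (fun t => (W' t).1).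
Proof.
move=> hW hW' h1 h2 t [t0 _]; split.
- exact: ac_H1 (hW _ t0).
- exact: ac_H1 (hW' _ t0).
- apply: (@cvg0_within_le _ _ _ B) => s [s0 _] st st1.
  have hA : AC ((s - t)^-1 *: (W s - W t) - W' t).
    apply: (ip_memB ac_ipP); last exact: hW'.
    by apply: (ip_memZ ac_ipP); apply: (ip_memB ac_ipP); exact: hW.
  have -> : (fun x => ((W s).1 x - (W t).1 x) / (s - t) - (W' t).1 x) =
     ((s - t)^-1 *: (W s - W t) - W' t).1.
    by apply/funext => x; rewrite mulrC.
  by rewrite H1norm_ac1// ger0_norm ?ip_norm_ge0//; exact: h1.
- have hA s : 0 <= s -> H1norm (fun x => (W' s).1 x - (W' t).1 x) = N1 (W' s - W' t).
    move=> s0; rewrite -[LHS]/(H1norm (W' s - W' t).1) H1norm_ac1//.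
    by apply: (ip_memB ac_ipP); exact: hW'.
  apply: (@cvg0_within_nbhs_le _ _ _ B); first by rewrite hA// subrr (ip_norm0 ac_ipP).
  by move=> s [s0 _] st st1; rewrite hA// ger0_norm ?ip_norm_ge0//; exact: h2.
Qed.

Lemma flow_solution (X : R -> ((R -> R) * (R -> R)) * ((R -> R) * (R -> R))) K M u0 v0 :
  u0 = (X 0).1.1 %[ae mu] -> v0 = (X 0).2.1 %[ae mu] -> 0 <= K ->
  (forall t, 0 <= t -> E (X t)) -> (forall t, 0 <= t -> N (X t) <= M) ->
  (forall s t, 0 <= s -> s <= t ->
      N (X t - X s - (t - s) *: F (X s)) <= K * (t - s) ^+ 2 /\
      (t - s <= 1 -> N (X t - X s) <= K * (t - s))) ->
  solution u0 v0 +oo%E (fun t => (X t).1.1) (fun t => (X t).2.1).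
Proof.
move=> e1 e2 K0 EX XM XE.
have EF t : 0 <= t -> E (F (X t)) by move=> t0; apply: vector_field_space; exact: EX.
have M0 : 0 <= M := le_trans (ip_norm_ge0 _) (XM 0 (lexx _)).
(* [18 * M * K] is the Lipschitz constant in time of [F (X t)], from [9 * (M + M)] and the speed
   [K]. *)
pose B := K + 18 * M * K.
have B18 : 0 <= 18 * M * K by rewrite !mulr_ge0.
have lip s t : 0 <= s -> 0 <= t -> `|s - t| <= 1 -> N (X s - X t) <= K * `|s - t|.
  move=> s0 t0; case: (leP s t) => st.
    rewrite distrC ger0_norm ?subr_ge0// => st1.
    by rewrite (ip_normBC state_ipP (EX _ s0) (EX _ t0)); have [_] := XE s t s0 st; exact.
  rewrite ger0_norm ?subr_ge0 ?(ltW st)// => st1.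
  by have [_] := XE t s t0 (ltW st); exact.
have lipF s t : 0 <= s -> 0 <= t -> `|s - t| <= 1 -> N (F (X s) - F (X t)) <= 18 * M * K * `|s - t|.
  move=> s0 t0 st; apply: le_trans (vector_field_lipschitz (EX _ s0) (EX _ t0)) _.
  have -> : 18 * M * K * `|s - t| = 9 * (M + M) * (K * `|s - t|) by ring.
  apply: ler_pM; rewrite ?ip_norm_ge0 ?mulr_ge0 ?addr_ge0 ?ip_norm_ge0//; last exact: lip.
  by have := XM s s0; have := XM t t0; lra.
have quo s t : 0 <= s -> 0 <= t -> s != t -> `|s - t| <= 1 ->
    N ((s - t)^-1 *: (X s - X t) - F (X t)) <= B * `|s - t|.
  move=> s0 t0 st st1; have st0 : s - t != 0 by rewrite subr_eq0.
  have Est := ip_memB state_ipP (EX _ s0) (EX _ t0).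
  have nst : 0 < `|s - t| by rewrite normr_gt0.
  case: (ltgtP s t) st => // st _.
    (* For [s < t] the flow estimate is based at [s]; moving the base point to [t] costs
       [F (X s) - F (X t)]. *)
    have E1 : (s - t)^-1 *: (X s - X t) - F (X t) =
       (s - t)^-1 *: - (X t - X s - (t - s) *: F (X s)) + (F (X s) - F (X t)).
      have -> : - (X t - X s - (t - s) *: F (X s)) = (X s - X t) - (s - t) *: F (X s).
        by rewrite opprB opprB addrC; congr (_ + _); rewrite -scaleNr opprB.
      by rewrite [in RHS]scalerBr scalerA mulVf// scale1r addrA subrK.
    have [q1 _] := XE s t s0 (ltW st).
    have D1 : E (X t - X s - (t - s) *: F (X s)).
      apply: (ip_memB state_ipP); first by apply: (ip_memB state_ipP); exact: EX.
      by apply: (ip_memZ state_ipP); exact: EF.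
    have D2 : E (F (X s) - F (X t)) by apply: (ip_memB state_ipP); exact: EF.
    have D3 := ip_memN state_ipP D1.
    rewrite E1; apply: le_trans (ip_normD state_ipP (ip_memZ state_ipP _ D3) D2) _.
    rewrite (ip_normZ state_ipP _ D3) (ip_normN state_ipP D1) normfV /B mulrDl.
    apply: lerD; last exact: lipF.
    rewrite ler_pdivrMl// mulrCA -expr2 real_normK ?num_real//.
    by rewrite -sqrrN opprB.
  have [q1 _] := XE t s t0 (ltW st).
  have D1 : E (X s - X t - (s - t) *: F (X t)).
    by apply: (ip_memB state_ipP) => //; apply: (ip_memZ state_ipP); exact: EF.
  have -> : (s - t)^-1 *: (X s - X t) - F (X t) = (s - t)^-1 *: (X s - X t - (s - t) *: F (X t)).
    by rewrite [in RHS]scalerBr scalerA mulVf// scale1r.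
  rewrite (ip_normZ state_ipP)// normfV ler_pdivrMl//.
  apply: le_trans q1 _; rewrite [leRHS]mulrCA -[X in _ <= _ * X]expr2 real_normK ?num_real//.
  by rewrite ler_wpM2r ?sqr_ge0// /B lerDl.
have lipF' s t : 0 <= s -> 0 <= t -> s != t -> `|s - t| <= 1 -> N (F (X s) - F (X t)) <= B * `|s - t|.
  move=> s0 t0 _ st; apply: le_trans (lipF s t s0 t0 st) _.
  by rewrite ler_wpM2r// /B lerDr.
have EQ s t : 0 <= s -> 0 <= t -> E ((s - t)^-1 *: (X s - X t) - F (X t)).
  move=> s0 t0; apply: (ip_memB state_ipP); last exact: EF.
  by apply: (ip_memZ state_ipP); apply: (ip_memB state_ipP); exact: EX.
have EFB s t : 0 <= s -> 0 <= t -> E (F (X s) - F (X t)).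
  by move=> s0 t0; apply: (ip_memB state_ipP); exact: EF.
split; last first.
  by split; [apply: aeS e1|apply: aeS e2] => x /= h _; rewrite h.
exists (fun t => (F (X t)).1.1), (fun t => (F (X t)).2.1); split.
- apply: (@C1_H1_of_ac (fun t => (X t).1) (fun t => (F (X t)).1) B).
  + by move=> t /EX[].
  + by move=> t /EF[].
  + move=> s t s0 t0 st st1; apply: le_trans (quo s t s0 t0 st st1).
    exact: (state_norm1 (EQ _ _ s0 t0)).
  + move=> s t s0 t0 st st1; apply: le_trans (lipF' s t s0 t0 st st1).
    exact: (state_norm1 (EFB _ _ s0 t0)).
- apply: (@C1_H1_of_ac (fun t => (X t).2) (fun t => (F (X t)).2) B).
  + by move=> t /EX[].
  + by move=> t /EF[].
  + move=> s t s0 t0 st st1; apply: le_trans (quo s t s0 t0 st st1).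
    exact: (state_norm2 (EQ _ _ s0 t0)).
  + move=> s t s0 t0 st st1; apply: le_trans (lipF' s t s0 t0 st st1).
    exact: (state_norm2 (EFB _ _ s0 t0)).
- move=> t _; split; apply: aeW => x _.
    by rewrite -[LHS]/(2 * ((X t).1.1 x * (X t).2.1 x)) mulrA.
  rewrite -[LHS]/(hilbert (fun x => (X t).1.1 x * (X t).1.1 x) x).
  by congr hilbert; apply/funext => y; rewrite expr2.
Qed.

Lemma real_induction (P : R -> Prop) t0 : 0 <= t0 -> P 0 ->
  (forall t, 0 <= t -> t < t0 -> P t ->
     exists2 d, 0 < d & forall s, t < s -> s < t + d -> s <= t0 -> P s) ->
  (forall t, 0 < t -> t <= t0 -> (forall s, 0 <= s -> s < t -> P s) -> P t) -> P t0.
Proof.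
move=> t00 P0 right left.
pose S := [set t | 0 <= t <= t0 /\ forall s, 0 <= s -> s <= t -> P s].
have S0 : S 0 by split; [rewrite lexx t00|move=> s s0 s1; rewrite (_ : s = 0)//; apply/le_anti/andP].
have hS : has_sup S by split; [exists 0|exists t0 => t [/andP[]]].
pose tau := sup S; have tau0 : 0 <= tau by apply: (ub_le_sup hS.2).
have taut : tau <= t0 by apply: ge_sup => [|t [/andP[]]//]; exists 0.
have below s : 0 <= s -> s < tau -> P s.
  move=> s0 st; have e0 : 0 < tau - s by rewrite subr_gt0.
  have [t [_ ht] lt] := sup_adherent e0 hS; apply: ht => //; move: lt; rewrite -/tau; lra.
have Ptau : P tau.
  by move: tau0; rewrite le_eqVlt => /predU1P[<-//|h]; exact: left.
move: taut; rewrite le_eqVlt => /predU1P[<-//|lt].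
have [d d0 hd] := right tau tau0 lt Ptau.
pose t' := Num.min t0 (tau + d / 2).
have tt' : tau < t' by rewrite lt_min lt/=; lra.
have St' : S t'.
  split; first by rewrite (le_trans tau0 (ltW tt'))/= ge_min lexx.
  move=> s s0; rewrite le_min => /andP[s1 s2]; case: (ltgtP s tau) => [|h|->//]; first exact: below.
  by apply: hd => //; lra.
have : t' <= tau by apply: (ub_le_sup hS.2).
by rewrite leNgt tt'.
Qed.

(** Brings an arbitrary solution into the form used for the flow: continuous representatives and an
    increment estimate, here with an error [e * |s - t|] in place of a quadratic one. *)
Lemma solution_representative u0 v0 T u v : solution u0 v0 T u v ->
  exists Y : R -> ((R -> R) * (R -> R)) * ((R -> R) * (R -> R)),
  (forall t, time_interval T t -> [/\ E (Y t), u t = (Y t).1.1 %[ae mu] & v t = (Y t).2.1 %[ae mu]]) /\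
  forall t e, time_interval T t -> 0 < e -> exists2 d, 0 < d &
    forall s, time_interval T s -> `|s - t| < d ->
      N (Y s - Y t - (s - t) *: F (Y t)) <= e * `|s - t|.
Proof.
move=> [[u' [v' [Cu Cv eqs]]] _].
have /choice[Y hY] : forall t, exists Y, time_interval T t ->
    [/\ E Y, u t = Y.1.1 %[ae mu] & v t = Y.2.1 %[ae mu]].
  move=> t; have [tT|] := pselect (time_interval T t); last by exists 0.
  have [Hu _ _ _] := Cu t tT; have [Hv _ _ _] := Cv t tT.
  have [p hp ep] := H1_ac Hu; have [r hr er] := H1_ac Hv.
  by exists (p, r).
exists Y; split => // t e tT e0.
have [Et eut evt] := hY t tT; have EFt := vector_field_space Et.
have [Hu Hu' cu _] := Cu t tT; have [Hv Hv' cv _] := Cv t tT.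
have [eu' ev'] := eqs t tT.
have fu : u' t = (F (Y t)).1.1 %[ae mu].
  have h := aeS2 (fun x (a : setT x -> _ = _) (b : setT x -> _ = _) => conj (a I) (b I)) eut evt.
  apply: aeS2 eu' h => x /= h1 [h2 h3] _.
  by rewrite h1// h2 h3 -mulrA.
have fv : v' t = (F (Y t)).2.1 %[ae mu].
  have -> : (F (Y t)).2.1 = hilbert (fun x => u t x ^+ 2).
    apply: hilbert_ae_eq.
    + have [h _] := Et; apply: measurable_funM; exact: ac_measurable.
    + by apply: measurable_funX; exact: H1_measurable.
    + by apply: aeS eut => y /= h _; rewrite h// expr2.
  exact: ev'.
have e2 : 0 < e / 2 by rewrite divr_gt0.
have [d1 d10 h1] := cvg0_within_lt cu e2; have [d2 d20 h2] := cvg0_within_lt cv e2.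
exists (Num.min d1 d2); first by rewrite lt_min d10.
move=> s sT; rewrite lt_min => /andP[s1 s2].
have [Es eus evs] := hY s sT; have Est := ip_memB state_ipP Es Et.
have [->|st] := eqVneq s t.
  by rewrite !subrr scale0r subr0 normr0 mulr0 (ip_norm0 state_ipP).
have st0 : s - t != 0 by rewrite subr_eq0.
have [Hus _ _ _] := Cu s sT; have [Hvs _ _ _] := Cv s sT.
have EQ : E ((s - t)^-1 *: (Y s - Y t) - F (Y t)).
  by apply: (ip_memB state_ipP) => //; exact: (ip_memZ state_ipP).
have quo (w w' : R -> R -> R) (p q r : (R -> R) * (R -> R)) :
    H1 (w s) -> H1 (w t) -> H1 (w' t) -> w s = p.1 %[ae mu] -> w t = q.1 %[ae mu] ->
    w' t = r.1 %[ae mu] -> AC ((s - t)^-1 *: (p - q) - r) ->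
    H1norm (fun x => (w s x - w t x) / (s - t) - w' t x) = N1 ((s - t)^-1 *: (p - q) - r).
  move=> /H1_measurable m1 /H1_measurable m2 /H1_measurable m3 a1 a2 a3 hA.
  apply: H1norm_ac => //.
    by apply: measurable_funB => //; apply: measurable_funM => //; exact: measurable_funB.
  have h := aeS2 (fun x (a : setT x -> _ = _) (b : setT x -> _ = _) => conj (a I) (b I)) a1 a2.
  apply: aeS2 a3 h => x /= k1 [k2 k3] _.
  by rewrite k1// k2 k3 mulrC.
have [EQ1 EQ2] := EQ.
have k1 := h1 s sT st s1; have k2 := h2 s sT st s2.
rewrite (quo u u' _ _ _ Hus Hu Hu' eus eut fu EQ1) ger0_norm ?ip_norm_ge0// in k1.
rewrite (quo v v' _ _ _ Hvs Hv Hv' evs evt fv EQ2) ger0_norm ?ip_norm_ge0// in k2.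
have -> : Y s - Y t - (s - t) *: F (Y t) = (s - t) *: ((s - t)^-1 *: (Y s - Y t) - F (Y t)).
  by rewrite scalerBr scalerA divff// scale1r.
rewrite (ip_normZ state_ipP)// mulrC ler_wpM2r//.
by apply: le_trans (state_norm_le EQ) _; move: k1 k2; rewrite -!/(_ - _); lra.
Qed.

Lemma increment_split (V : zmodType) (x x' y y' c d : V) :
  y - x = (y - y' - c) - (x - x' - d) + ((y' - x') + (c - d)).
Proof.
have ey : y - y' - c + (c + y') = y by rewrite addrA subrK subrK.
have ex : x - x' - d + (d + x') = x by rewrite addrA subrK subrK.
have -> : y' - x' + (c - d) = (c + y') - (d + x').
  by rewrite addrACA opprD (addrC y') (addrC (- x')).
by rewrite addrACA -opprD ey ex.
Qed.

Lemma barrier_step (phis phit bt bs h a e k : R) :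
  phis <= e / 2 * h + k + (phit + h * (a * phit)) -> k <= e / 2 * h -> e * h <= bt * h ->
  h * (a * phit) <= h * (a * bt) -> phit <= bt -> bt * (1 + (a + 1) * h) <= bs -> phis <= bs.
Proof. lra. Qed.

(** No bound on the second solution is known beforehand. The barrier [bar] stays below 1, so while
    the distance to [X] is below the barrier the two norms add up to at most [2 * M + 1], and [A] is
    a Lipschitz constant. *)
Lemma solution_unique (X : R -> ((R -> R) * (R -> R)) * ((R -> R) * (R -> R))) K M u0 v0 T u v :
  u0 = (X 0).1.1 %[ae mu] -> v0 = (X 0).2.1 %[ae mu] -> 0 <= K ->
  (forall t, 0 <= t -> E (X t)) -> (forall t, 0 <= t -> N (X t) <= M) ->
  (forall s t, 0 <= s -> s <= t ->
      N (X t - X s - (t - s) *: F (X s)) <= K * (t - s) ^+ 2 /\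
      (t - s <= 1 -> N (X t - X s) <= K * (t - s))) ->
  solution u0 v0 T u v -> forall t, time_interval T t ->
  u t = (X t).1.1 %[ae mu] /\ v t = (X t).2.1 %[ae mu].
Proof.
move=> eu ev K0 EX XM XE sol t0 t0T.
have [Y [hY dY]] := solution_representative sol; have [_ [iu iv]] := sol.
have [t00 t0lt] := t0T.
have inT s : 0 <= s -> s <= t0 -> time_interval T s.
  by move=> s0 st; split => //; apply: le_lt_trans t0lt; rewrite lee_fin.
have M0 : 0 <= M := le_trans (ip_norm_ge0 _) (XM 0 (lexx _)).
have EY s : 0 <= s -> s <= t0 -> E (Y s) by move=> s0 st; have [] := hY s (inT s s0 st).
pose phi t := N (Y t - X t).
suff phi0 : phi t0 = 0.
  have [Et a1 a2] := hY t0 t0T; have EXt := EX t0 t00.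
  have [w1 w2 _] := state_components (ip_memB state_ipP Et EXt).
  split; [apply: aeS a1|apply: aeS a2] => x /= h _; rewrite h//; apply/eqP; rewrite -subr_eq0 -normr_le0.
    by apply: le_trans (w1 x) _; rewrite -/(phi t0) phi0.
  by apply: le_trans (w2 x) _; rewrite -/(phi t0) phi0.
pose A := 9 * (2 * M + 1); have A0 : 0 <= A by rewrite mulr_ge0// addr_ge0// mulr_ge0.
suff key e : 0 < e -> e <= expR (- ((A + 1) * t0)) -> phi t0 <= e * expR ((A + 1) * t0).
  apply/eqP; rewrite eq_le ip_norm_ge0 andbT; apply/ler_addgt0Pr => e e0; rewrite add0r.
  have x0 := expR_gt0 ((A + 1) * t0).
  have := key (Num.min (e * expR (- ((A + 1) * t0))) (expR (- ((A + 1) * t0)))).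
  rewrite lt_min mulr_gt0 ?expR_gt0// ge_min lexx orbT => /(_ isT isT) h; apply: le_trans h _.
  rewrite -ler_pdivlMr// -expRN ge_min lexx//.
(* In the exponent, [A] pays for the Lipschitz growth of the difference and the extra 1 leaves
   [e * (s - t)], half for the error of [Y] and half for that of [X]. *)
move=> e0 e1; pose bar t := e * expR ((A + 1) * t).
have bar1 s : s <= t0 -> bar s <= 1.
  move=> st; apply: (@le_trans _ _ (expR (- ((A + 1) * t0)) * expR ((A + 1) * t0))).
    apply: ler_pM => //; rewrite ?expR_ge0 ?(ltW e0)//.
    by rewrite ler_expR ler_wpM2l// addr_ge0.
  by rewrite mulrC expRxMexpNx_1.
have bare s : 0 <= s -> e <= bar s.
  by move=> s0; rewrite /bar ler_peMr ?(ltW e0)// -expR0 ler_expR mulr_ge0// addr_ge0.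
have EB s : 0 <= s -> s <= t0 -> E (Y s - X s).
  by move=> s0 st; apply: (ip_memB state_ipP); [exact: EY|exact: EX].
have EFY s : 0 <= s -> s <= t0 -> E (F (Y s)) by move=> s0 st; apply: vector_field_space; exact: EY.
have EFX s : 0 <= s -> E (F (X s)) by move=> s0; apply: vector_field_space; exact: EX.
apply: (@real_induction (fun t => phi t <= bar t)) => //.
- apply: le_trans (bare 0 (lexx _)); apply: le_trans (ltW e0).
  have [[Y1 Y2] a1 a2] := hY 0 (inT 0 (lexx _) t00); have [X1 X2] := EX 0 (lexx _).
  have b1 : (Y 0).1.1 = (X 0).1.1 %[ae mu].
    have h := aeS2 (fun x (a : setT x -> _ = _) (b : setT x -> _ = _) => conj (a I) (b I)) a1 iu.
    by apply: aeS2 eu h => x /= k1 [k2 k3] _; rewrite -k2 k3 k1.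
  have b2 : (Y 0).2.1 = (X 0).2.1 %[ae mu].
    have h := aeS2 (fun x (a : setT x -> _ = _) (b : setT x -> _ = _) => conj (a I) (b I)) a2 iv.
    by apply: aeS2 ev h => x /= k1 [k2 k3] _; rewrite -k2 k3 k1.
  apply: le_trans (state_norm_le (EB 0 (lexx _) t00)) _.
  by rewrite (ac_norm_sub0 Y1 X1 b1) (ac_norm_sub0 Y2 X2 b2) addr0.
- move=> t t_0 tt0 pt; have tle := ltW tt0.
  have e2 : 0 < e / 2 by rewrite divr_gt0.
  have [d d0 hd] := dY t (e / 2) (inT t t_0 tle) e2.
  have K1 : 0 < K + 1 by rewrite ltr_wpDl.
  exists (Num.min d (e / 2 / (K + 1))); first by rewrite lt_min d0 divr_gt0.
  move=> s ts sd st0; have s_0 : 0 <= s by exact: le_trans (ltW ts).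
  have ts0 : 0 < s - t by rewrite subr_gt0.
  have : s - t < Num.min d (e / 2 / (K + 1)) by rewrite ltrBlDl.
  rewrite lt_min ltr_pdivlMr// => /andP[sd1 sd2].
  have := hd s (inT s s_0 st0); rewrite gtr0_norm// => /(_ sd1) n1.
  have [n2 _] := XE t s t_0 (ltW ts).
  have D0 := EB t t_0 tle; have Dt := EY t t_0 tle; have Ds := EY s s_0 st0.
  have D1 : E (Y s - Y t - (s - t) *: F (Y t)).
    by apply: (ip_memB state_ipP); [exact: (ip_memB state_ipP)|apply: (ip_memZ state_ipP); exact: EFY].
  have D2 : E (X s - X t - (s - t) *: F (X t)).
    by apply: (ip_memB state_ipP); [apply: (ip_memB state_ipP); exact: EX|apply: (ip_memZ state_ipP); exact: EFX].
  have D3 : E (F (Y t) - F (X t)) by apply: (ip_memB state_ipP); [exact: EFY|exact: EFX].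
  have D4 := ip_memZ state_ipP (s - t) D3; have D12 := ip_memB state_ipP D1 D2.
  have eq : Y s - X s = ((Y s - Y t - (s - t) *: F (Y t)) - (X s - X t - (s - t) *: F (X t))) +
      ((Y t - X t) + (s - t) *: (F (Y t) - F (X t))).
    by rewrite scalerBr; exact: increment_split.
  have n3 : N (F (Y t) - F (X t)) <= A * phi t.
    apply: le_trans (vector_field_lipschitz Dt (EX t t_0)) _; rewrite -/(phi t) ler_wpM2r ?ip_norm_ge0//.
    rewrite /A ler_wpM2l//.
    have : N (Y t) <= phi t + N (X t).
      by rewrite -[Y t in leLHS](subrK (X t)); apply: (ip_normD state_ipP) => //; exact: EX.
    move=> h; apply: (@le_trans _ _ (phi t + N (X t) + N (X t))); first by rewrite lerD2r.
    rewrite -addrA addrC mulr_natl mulr2n; apply: lerD; last exact: le_trans pt (bar1 t tle).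
    by apply: lerD; exact: XM.
  have n4 : phi s <= e / 2 * (s - t) + K * (s - t) ^+ 2 + (phi t + (s - t) * (A * phi t)).
    rewrite /phi eq; apply: le_trans (ip_normD state_ipP D12 (ip_memD state_ipP D0 D4)) _.
    apply: lerD; first by apply: le_trans (ip_normB state_ipP D1 D2) _; exact: lerD.
    apply: le_trans (ip_normD state_ipP D0 D4) _; rewrite lerD2l (ip_normZ state_ipP)// gtr0_norm//.
    by rewrite ler_wpM2l// ltW.
  have g : bar t * (1 + (A + 1) * (s - t)) <= bar s.
    rewrite /bar; have -> : (A + 1) * s = (A + 1) * t + (A + 1) * (s - t) by ring.
    rewrite expRD mulrA ler_wpM2l ?expR_ge1Dx// mulr_ge0 ?expR_ge0// ltW//.
  have Kst : K * (s - t) ^+ 2 <= e / 2 * (s - t).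
    rewrite expr2 mulrA ler_wpM2r ?(ltW ts0)//; apply: ltW; apply: le_lt_trans sd2.
    by rewrite mulrC ler_wpM2l ?(ltW ts0)// lerDl.
  have b1 := ler_wpM2r (ltW ts0) (bare t t_0).
  have b2 := ler_wpM2l (ltW ts0) (ler_wpM2l A0 pt).
  exact: barrier_step n4 Kst b1 b2 pt g.
(* Closedness from the left: between [t - m] and [t] the two curves move by at most [eta] in total,
   and [eta] is arbitrary. *)
- move=> t t_0 tt0 pt; apply/ler_addgt0Pr => eta eta0; have t_ge := ltW t_0.
  have [d d0 hd] := dY t 1 (inT t t_ge tt0) ltr01.
  pose C := 1 + N (F (Y t)) + K; have C0 : 0 < C.
    by rewrite /C -addrA ltr_pwDl// addr_ge0 ?ip_norm_ge0.
  pose m := Num.min (Num.min 1 t) (Num.min (d / 2) (eta / C)).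
  have m0 : 0 < m by rewrite !lt_min ltr01 t_0 !divr_gt0.
  have : m <= m by []; rewrite {2}/m !le_min => /andP[/andP[m1 m2] /andP[m3 m4]].
  pose s := t - m; have s_0 : 0 <= s by rewrite subr_ge0.
  have st : s < t by rewrite /s; lra.
  have st0 := le_trans (ltW st) tt0.
  have est : s - t = - m by rewrite /s; ring.
  have est' : t - s = m by rewrite /s; ring.
  have := hd s (inT s s_0 st0); rewrite est normrN gtr0_norm// mul1r => n1.
  have {}n1 : N (Y s - Y t - - m *: F (Y t)) <= m by apply: n1; lra.
  have [_] := XE s t s_0 (ltW st); rewrite est' => /(_ m1) n2.
  have Dt := EY t t_ge tt0; have Ds := EY s s_0 st0; have Xt := EX t t_ge; have Xs := EX s s_0.
  have DF := EFY t t_ge tt0.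
  have D1 : E (Y s - Y t - - m *: F (Y t)).
    by apply: (ip_memB state_ipP); [exact: (ip_memB state_ipP)|exact: (ip_memZ state_ipP)].
  have n3 : N (Y t - Y s) <= m * (1 + N (F (Y t))).
    rewrite (ip_normBC state_ipP)//.
    have -> : Y s - Y t = (Y s - Y t - - m *: F (Y t)) + - m *: F (Y t) by rewrite subrK.
    apply: le_trans (ip_normD state_ipP D1 (ip_memZ state_ipP _ DF)) _.
    by rewrite (ip_normZ state_ipP)// normrN gtr0_norm// mulrDr mulr1 lerD2r.
  have n4 : phi t <= N (Y t - Y s) + (phi s + N (X t - X s)).
    have e3 : Y t - X t = (Y t - Y s) + ((Y s - X s) - (X t - X s)).
      by rewrite opprB [Y s - X s + _]addrA subrK addrA subrK.
    have DX := ip_memB state_ipP Xt Xs; have DYs := ip_memB state_ipP Ds Xs.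
    rewrite /phi e3; apply: le_trans (ip_normD state_ipP (ip_memB state_ipP Dt Ds) (ip_memB state_ipP DYs DX)) _.
    by rewrite lerD2l; exact: (ip_normB state_ipP).
  have bs : bar s <= bar t.
    by rewrite /bar ler_wpM2l ?(ltW e0)// ler_expR ler_wpM2l ?addr_ge0// ltW.
  have mC : m * C <= eta by rewrite -ler_pdivlMr.
  apply: le_trans n4 _; rewrite addrCA; apply: lerD (le_trans (pt s s_0 st) bs) _.
  by apply: le_trans mC; rewrite /C mulrDr [m * K]mulrC; exact: lerD n3 n2.
Qed.

End Representatives.

(** * From almost everywhere to everywhere for the initial data *)

Section InitialData.
Context {R : realType}.
Local Notation mu := (@lebesgue_measure R).

(** [continuous_le_closure] for both signs of [f0], on a segment joining the point to the nearer end
    of [[a, a + dl]]. *)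
Lemma ae_supported (f f0 : R -> R) a dl : continuous f0 -> f = f0 %[ae mu] ->
  {ae mu, forall x, x \notin `[a, a + dl] -> f x = 0} -> supported a dl f0.
Proof.
move=> cf ff0 h x; rewrite in_itv/= negb_and -!ltNge.
have {}h : {ae mu, forall x, x \notin `[a, a + dl] -> f0 x = 0}.
  by apply: aeS2 ff0 h => y /= h1 h2 /h2 <-; rewrite h1.
have nz c : c * f0 x <= 0 -> (- c) * f0 x <= 0 -> c = 1 -> f0 x = 0.
  by move=> h1 h2 c1; apply/eqP; rewrite eq_le; move: h1 h2; rewrite c1 mulN1r mul1r oppr_le0 => -> ->.
have cc c : continuous (fun x => c * f0 x) by move=> y; apply: cvgM; [exact: cvg_cst|exact: cf].
have out y z : y < z -> (forall w, w \in `]y, z[ -> w \notin `[a, a + dl]) ->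
    forall w, w \in `[y, z] -> forall c, c * f0 w <= 0.
  move=> yz sub w wyz c; apply: (continuous_le_closure (cc c) yz) => //.
  by apply: aeS h => v hv /sub /hv ->; rewrite mulr0.
case/orP => hx; apply: (nz 1) => //.
- by apply: (@out x a) => //; [move=> w; rewrite !in_itv/= negb_and -!ltNge => /andP[_ ->]|rewrite in_itv/= lexx ltW].
- by apply: (@out x a) => //; [move=> w; rewrite !in_itv/= negb_and -!ltNge => /andP[_ ->]|rewrite in_itv/= lexx ltW].
- by apply: (@out (a + dl) x) => //; [move=> w; rewrite !in_itv/= negb_and -!ltNge => /andP[-> _]; rewrite orbT|rewrite in_itv/= lexx ltW].
- by apply: (@out (a + dl) x) => //; [move=> w; rewrite !in_itv/= negb_and -!ltNge => /andP[-> _]; rewrite orbT|rewrite in_itv/= lexx ltW].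
Qed.

Lemma ae_le_closure (f f0 : R -> R) a dl c : continuous f0 -> f = f0 %[ae mu] -> 0 < dl ->
  {ae mu, forall x, x \in `[a, a + dl] -> f x <= c} ->
  forall x, x \in `[a, a + dl] -> f0 x <= c.
Proof.
move=> cf ff0 dl0 h; apply: (continuous_le_closure cf); first by rewrite ltrDl.
apply: aeS2 ff0 h => y /= h1 h2; rewrite in_itv/= => /andP[y1 y2]; rewrite -h1//.
by apply: h2; rewrite in_itv/= !ltW.
Qed.

Lemma Lnormy_le (f : R -> R) (B : R) : (forall x, `|f x| <= B) ->
  ('N[mu]_+oo[EFin \o f] <= B%:E)%E.
Proof.
move=> fB; have B0 : 0 <= B := le_trans (normr_ge0 _) (fB 0).
rewrite unlock; case: ifP => _; last by rewrite lee_fin.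
by apply/ess_supP; apply: aeW => x; rewrite /= lee_fin.
Qed.

End InitialData.

Unset Implicit Arguments.
(** Uniqueness on every [[0, T)] makes the exhibited pair the solution meant in the English
    statement, and the half-line its maximal interval. *)
Theorem theorem1p2 (R : realType) (u0 v0 : R -> R) (a delta : R)
  (hu0 : H1 u0) (hv0 : H1 v0) (hdelta : 0 < delta)
  (hsupp : {ae @lebesgue_measure R, forall x, x \notin `[a, a + delta] -> u0 x = 0})
  (hneg : {ae @lebesgue_measure R, forall x, x \in `[a, a + delta] -> v0 x <= - 3})
  (hsmall : Num.sqrt delta *
      (L2norm (wderiv v0) + 3^-1 * Num.sqrt delta * L2norm (wderiv u0) ^+ 2)
    < 4^-1) :
  exists u v : R -> R -> R,
    [/\ solution u0 v0 +oo%E u v,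
        forall (T : \bar R) (u1 v1 : R -> R -> R), solution u0 v0 T u1 v1 ->
          forall t, time_interval T t ->
            u1 t = u t %[ae @lebesgue_measure R] /\
            v1 t = v t %[ae @lebesgue_measure R],
        exists M : R, forall t, 0 <= t -> H1norm (u t) <= M /\ H1norm (v t) <= M
      & exists C : R, forall t, 0 <= t ->
          [/\ ('N[@lebesgue_measure R]_+oo[EFin \o u t]
                 <= (C * expR (- 3 * t))%:E)%E,
              H1norm (u t) <= C * expR (- 3 * t)
            & H1norm (v t) <= C]].
Proof.
have [f0 [g [fg ef _]]] := H1_ac_pair hu0; have [h0 [k [hk eh _]]] := H1_ac_pair hv0.
have sup := ae_supported (ac_pair_continuous fg) ef hsupp.
have neg := ae_le_closure (ac_pair_continuous hk) eh hdelta hneg.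
have small : Num.sqrt delta *
    (ip_norm ip2 k + 3^-1 * Num.sqrt delta * ip_norm ip2 g ^+ 2) < 4^-1.
  by move: hsmall; rewrite (L2norm_wderiv (H1_measurable hv0) hk eh) (L2norm_wderiv (H1_measurable hu0) fg ef).
have EX0 : state_space ((f0, g), (h0, k)) by [].
have [X [K [M [X0 EX K0 XE XB]]]] := global_solution EX0 hdelta sup neg small.
have eu : u0 = (X 0).1.1 %[ae @lebesgue_measure R] by rewrite X0.
have ev : v0 = (X 0).2.1 %[ae @lebesgue_measure R] by rewrite X0.
have XM t : 0 <= t -> ip_norm state_ip (X t) <= M by move=> /XB[].
have nu t : 0 <= t -> H1norm (X t).1.1 <= M.
  move=> t0; have Et := EX t t0; have [p1 _] := Et; rewrite (H1norm_ac1 p1).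
  exact: le_trans (state_norm1 Et) (XM t t0).
have nv t : 0 <= t -> H1norm (X t).2.1 <= M.
  move=> t0; have Et := EX t t0; have [_ p2] := Et; rewrite (H1norm_ac1 p2).
  exact: le_trans (state_norm2 Et) (XM t t0).
exists (fun t => (X t).1.1), (fun t => (X t).2.1); split.
- exact: flow_solution eu ev K0 EX XM XE.
- by move=> T u1 v1 sol t tT; exact: solution_unique eu ev K0 EX XM XE sol t tT.
- by exists M => t t0; split; [exact: nu|exact: nv].
set y0 := ip_norm ip2 _ in XB; set sd := Num.sqrt delta in XB.
have y00 : 0 <= y0 := ip_norm_ge0 _.
have sd0 : 0 <= sd := sqrtr_ge0 _.
have M0 : 0 <= M := le_trans (ip_norm_ge0 _) (XM 0 (lexx _)).
pose C := sd * y0 + (delta + 1) * y0 + M.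
have c1 : 0 <= sd * y0 by rewrite mulr_ge0.
have c2 : 0 <= (delta + 1) * y0 by rewrite mulr_ge0// addr_ge0// ltW.
exists C => t t0; have [_ b1 b2] := XB t t0; have e0 := expR_ge0 (- 3 * t); split.
- apply: Lnormy_le => x; apply: le_trans (b1 x) _; rewrite ler_wpM2r//.
  by rewrite /C -addrA lerDl addr_ge0.
- have [p1 _] := EX t t0; rewrite (H1norm_ac1 p1); apply: le_trans b2 _.
  by rewrite ler_wpM2r// /C -addrA addrCA lerDl addr_ge0.
- by apply: le_trans (nv t t0) _; rewrite /C lerDr addr_ge0.
Qed.
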